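(* Suppose that $0\in\mathfrak{g}^*$ is a regular value of the moment map $\Phi:M\to\mathfrak{g}^*$ and that $G$ acts freely on $\Phi^{-1}(0)$. Let $\omega\in X(H)\cap\mathfrak{h}^*_+$ and, for every $k\in\mathbb{N}$, let $\{s_j^{(k,\omega)}\}_j$ be an orthonormal basis of $H^0(M,L^{\otimes k})_\omega$. If $p\notin\Phi^{-1}(0)$, then, as $k\to+\infty$, $$\sum_j\left\|s_j^{(k,\omega)}(p)\right\|^2=O(k^{-N}),\qquad N=1,2,\ldots.$$ This estimate is uniform on compact subsets of $M\setminus\big(\Phi^{-1}(0)\cup R\big)$, where $R=M\setminus\big(\tilde G\cdot\Phi^{-1}(0)\big)$.
   Context: Setting: $M$ is a connected $n$-dimensional complex projective manifold and $(L,h_L)$ is a Hermitian ample holomorphic line bundle on $M$ whose unique compatible covariant derivative $\nabla_L$ has curvature $-2\pi i\,\Omega$, with $\Omega$ a Kähler form. $G$ is a compact connected Lie group with Lie algebra $\mathfrak{g}$, $\mu:G\times M\to M$ is a holomorphic Hamiltonian action on $(M,\Omega)$ with moment map $\Phi:M\to\mathfrak{g}^*$. The action linearizes to a holomorphic action on $L$ leaving $h_L$ (hence $\nabla_L$) invariant. The moment map is the one associated to this linearization: if $X\subset L^*$ is the unit circle bundle with projection $\pi$, then for $\xi\in\mathfrak{g}$ the induced vector fields $\xi_M$ on $M$ and $\xi_X$ on $X$ satisfy $\xi_X=\xi_M^\sharp+(\langle\Phi,\xi\rangle\circ\pi)\,\partial/\partial\theta$, where $\xi_M^\sharp$ is the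 horizontal lift and $\partial/\partial\theta$ the generator of the $S^1$-action on $X$. For every $k$ there is an induced representation of $G$ on $H^0(M,L^{\otimes k})$, unitary for the $L^2$ Hermitian product associated to $\Omega$ and $h_L$. Fix a Cartan subalgebra $\mathfrak{h}\subset\mathfrak{g}$ with corresponding Cartan subgroup $H\subset G$, a root system in $\mathfrak{h}^*$ and a basis of it; $X(H)$ is the group of characters of $H$, identified with a subgroup of $\mathfrak{h}^*$ through the differential at the identity, and $\mathfrak{h}^*_+$ is the positive Weyl chamber. Finite-dimensional irreducible representations of $G$ correspond bijectively to $\omega\in X(H)\cap\mathfrak{h}^*_+$; $V_\omega$ is the one associated to $\omega$, and $H^0(M,L^{\otimes k})_\omega$ is the $V_\omega$-isotypical component of $H^0(M,L^{\otimes k})$. $\|s(p)\|$ is the norm of $s(p)$ in the Hermitian metric on $L^{\otimes k}$ induced by $h_L$. $\tilde G$ is the complexification of $G$; the actions of $G$ on $M$ and $L$ extend to holomorphic actions of $\tilde G$. For $A\subseteq M$, $\tilde G\cdot A=\{g\cdot m: g\in\tilde G,\ m\in A\}$. The set $R$ is called the set of unstable points of the action. *)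

(* Defs.v *)
From HB Require Import structures.
From mathcomp Require Import all_boot all_order all_algebra complex.
From mathcomp Require Import all_classical all_reals all_analysis.
Set Implicit Arguments.
Unset Strict Implicit.
Unset Printing Implicit Defensive.
Import Order.TTheory GRing.Theory Num.Theory.
Import numFieldNormedType.Exports.
Local Open Scope classical_set_scope.
Local Open Scope ring_scope.

(* The ascription to a numClosedFieldType gives the complex numbers the
   topology and norm of MathComp-Analysis. *)
Definition Cx (R : realType) : numClosedFieldType := R[i].

Definition reC (R : realType) (z : Cx R) : R := complex.Re z.
Definition imC (R : realType) (z : Cx R) : R := complex.Im z.
Definition mkC (R : realType) (a b : R) : Cx R := (a +i* b)%C.
Definition sqmod (R : realType) (z : Cx R) : R := reC z ^+ 2 + imC z ^+ 2.
Definition cis (R : realType) (x : R) : Cx R := mkC (cos x) (sin x).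

(* Iterated directional derivatives up to order k exist; at order 0 the
   function is continuous. *)
Fixpoint Ck (R : realType) (m : nat) (W : normedModType R) (k : nat)
    (U : set 'rV[R]_m) (f : 'rV[R]_m -> W) : Prop :=
  match k with
  | 0 => forall x, U x -> {for x, continuous f}
  | k'.+1 => (forall v x, U x -> derivable f x v) /\
             forall v, Ck k' U (fun x => 'D_v f x)
  end.

Definition smooth_on (R : realType) (m : nat) (W : normedModType R)
    (U : set 'rV[R]_m) (f : 'rV[R]_m -> W) : Prop := forall k, Ck k U f.

Definition holo_on (R : realType) (m : nat) (W : normedModType (Cx R))
    (U : set 'rV[Cx R]_m) (f : 'rV[Cx R]_m -> W) : Prop :=
  forall z, U z -> differentiable f z.

(* C^n is identified with R^(n+n): real parts first, then imaginary parts. *)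
Definition to_real (R : realType) (n : nat) (z : 'rV[Cx R]_n) : 'rV[R]_(n + n) :=
  row_mx (\row_j reC (z 0 j)) (\row_j imC (z 0 j)).

Definition of_real (R : realType) (n : nat) (x : 'rV[R]_(n + n)) : 'rV[Cx R]_n :=
  \row_j mkC (x 0 (lshift n j)) (x 0 (rshift n j)).

(* [cmap] is meaningful on [cdom] only, and [cinv] on the image of [cdom]. *)
Record chart (T V : Type) := Chart {
  cdom : set T; cmap : T -> V; cinv : V -> T }.

Definition chart_axiom (T V : topologicalType) (c : chart T V) : Prop :=
  [/\ open (cdom c), open (cmap c @` cdom c),
      forall x, cdom c x -> cinv c (cmap c x) = x,
      forall x, cdom c x -> {for x, continuous (cmap c)} &
      forall v, (cmap c @` cdom c) v -> {for v, continuous (cinv c)}].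

Definition is_atlas (T V : topologicalType) (A : set (chart T V)) : Prop :=
  (forall c, A c -> chart_axiom c) /\ forall x, exists2 c, A c & cdom c x.

Definition real_chart (R : realType) (T : Type) (n : nat)
    (c : chart T 'rV[Cx R]_n) : chart T 'rV[R]_(n + n) :=
  Chart (cdom c) (@to_real R n \o cmap c) (cinv c \o @of_real R n).

Definition real_atlas (R : realType) (T : Type) (n : nat)
    (A : set (chart T 'rV[Cx R]_n)) : set (chart T 'rV[R]_(n + n)) :=
  [set real_chart c | c in A].

Definition prod_chart (K T S : Type) (m p : nat) (c : chart T 'rV[K]_m)
    (e : chart S 'rV[K]_p) : chart (T * S) 'rV[K]_(m + p) :=
  Chart (cdom c `*` cdom e)
        (fun x => row_mx (cmap c x.1) (cmap e x.2))
        (fun v => (cinv c (lsubmx v), cinv e (rsubmx v))).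

Definition prod_atlas (K T S : Type) (m p : nat) (A : set (chart T 'rV[K]_m))
    (B : set (chart S 'rV[K]_p)) : set (chart (T * S) 'rV[K]_(m + p)) :=
  [set prod_chart c e | c in A & e in B].

Definition smooth_map (R : realType) (m p : nat) (T S : topologicalType)
    (A : set (chart T 'rV[R]_m)) (B : set (chart S 'rV[R]_p)) (f : T -> S) : Prop :=
  continuous f /\
  forall c e, A c -> B e ->
    smooth_on (cmap c @` (cdom c `&` f @^-1` cdom e)) (cmap e \o f \o cinv c).

Definition holo_map (R : realType) (m p : nat) (T S : topologicalType)
    (A : set (chart T 'rV[Cx R]_m)) (B : set (chart S 'rV[Cx R]_p)) (f : T -> S)
    : Prop :=
  continuous f /\
  forall c e, A c -> B e ->
    holo_on (cmap c @` (cdom c `&` f @^-1` cdom e)) (cmap e \o f \o cinv c).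

Definition smooth_fun (R : realType) (m : nat) (T : topologicalType)
    (W : normedModType R) (A : set (chart T 'rV[R]_m)) (U : set T) (f : T -> W)
    : Prop :=
  forall c, A c -> smooth_on (cmap c @` (cdom c `&` U)) (f \o cinv c).

Definition smooth_cfun (R : realType) (m : nat) (T : topologicalType)
    (A : set (chart T 'rV[R]_m)) (U : set T) (f : T -> Cx R) : Prop :=
  smooth_fun (W := R^o) A U (@reC R \o f) /\ smooth_fun (W := R^o) A U (@imC R \o f).

Definition holo_fun (R : realType) (m : nat) (T : topologicalType)
    (A : set (chart T 'rV[Cx R]_m)) (U : set T) (f : T -> Cx R) : Prop :=
  forall c, A c ->
    holo_on (W := (Cx R)^o) (cmap c @` (cdom c `&` U)) (f \o cinv c).

(* Smoothness of the identity with respect to [A] on both sides is smoothness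
   of the transition maps.  Second countability is not required: all the
   manifolds below are compact or connected Lie groups, except the test groups
   in the universal property of the complexification, where it is immaterial. *)
Definition smooth_manifold (R : realType) (m : nat) (T : topologicalType)
    (A : set (chart T 'rV[R]_m)) : Prop :=
  [/\ hausdorff_space T, is_atlas A & smooth_map A A id].

Definition complex_manifold (R : realType) (m : nat) (T : topologicalType)
    (A : set (chart T 'rV[Cx R]_m)) : Prop :=
  [/\ hausdorff_space T, is_atlas A & holo_map A A id].

#[short(type="topGroupType")]
HB.structure Definition TopGroup := {G of Topological G & Group G}.

Definition lie_group (R : realType) (d : nat) (G : topGroupType)
    (A : set (chart G 'rV[R]_d)) : Prop :=
  [/\ smooth_manifold A,
      smooth_map (prod_atlas A A) A (fun x : G * G => (x.1 * x.2)%g) &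
      smooth_map A A (fun x : G => (x^-1)%g)].

Definition complex_lie_group (R : realType) (d : nat) (G : topGroupType)
    (A : set (chart G 'rV[Cx R]_d)) : Prop :=
  [/\ complex_manifold A,
      holo_map (prod_atlas A A) A (fun x : G * G => (x.1 * x.2)%g) &
      holo_map A A (fun x : G => (x^-1)%g)].

Definition group_hom (G H : groupType) (f : G -> H) : Prop :=
  forall x y, f (x * y)%g = (f x * f y)%g.

Definition is_complexification (R : realType) (d dc : nat) (G Gc : topGroupType)
    (AG : set (chart G 'rV[R]_d)) (AGc : set (chart Gc 'rV[Cx R]_dc))
    (iota : G -> Gc) : Prop :=
  [/\ complex_lie_group AGc, group_hom iota, smooth_map AG (real_atlas AGc) iota &
      forall (K : topGroupType) (r : nat) (AK : set (chart K 'rV[Cx R]_r)) (f : G -> K),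
        complex_lie_group AK -> group_hom f -> smooth_map AG (real_atlas AK) f ->
        exists! F : Gc -> K, [/\ group_hom F, holo_map AGc AK F & F \o iota = f]].

(* The Lie algebra is the tangent space at 1, identified with 'rV_d by a fixed
   chart [c1] around 1. *)

(* A curve with value 1 and velocity [xi] at [t = 0]. *)
Definition curve1 (R : realType) (d : nat) (G : topGroupType)
    (c1 : chart G 'rV[R]_d) (xi : 'rV[R]_d) (t : R) : G :=
  cinv c1 (cmap c1 1%g + t *: xi).

Definition Ad (R : realType) (d : nat) (G : topGroupType)
    (c1 : chart G 'rV[R]_d) (g : G) (xi : 'rV[R]_d) : 'rV[R]_d :=
  derive1 (fun t : R => cmap c1 (g * curve1 c1 xi t * g^-1)%g) 0.

(* [xi, eta] = ad(xi) eta, the derivative of Ad at 1 in the direction xi. *)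
Definition bracket (R : realType) (d : nat) (G : topGroupType)
    (c1 : chart G 'rV[R]_d) (xi eta : 'rV[R]_d) : 'rV[R]_d :=
  derive1 (fun t : R => Ad c1 (curve1 c1 xi t) eta) 0.

(* [exp_rel c1 xi g] : g = exp(xi). *)
Definition exp_rel (R : realType) (d : nat) (G : topGroupType)
    (c1 : chart G 'rV[R]_d) (xi : 'rV[R]_d) (g : G) : Prop :=
  exists gam : R -> G,
    [/\ continuous gam, forall s t, gam (s + t) = (gam s * gam t)%g,
        is_derive (0 : R) (1 : R) (cmap c1 \o gam) xi & gam 1 = g].

(* In the Lie algebra of a compact group, Cartan subalgebras are the maximal
   abelian subalgebras. *)
Definition abelian_sub (R : realType) (d : nat) (G : topGroupType)
    (c1 : chart G 'rV[R]_d) (h : {vspace 'rV[R]_d}) : Prop :=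
  forall xi eta, xi \in h -> eta \in h -> bracket c1 xi eta = 0.

Definition cartan_subalgebra (R : realType) (d : nat) (G : topGroupType)
    (c1 : chart G 'rV[R]_d) (h : {vspace 'rV[R]_d}) : Prop :=
  abelian_sub c1 h /\
  forall h' : {vspace 'rV[R]_d}, abelian_sub c1 h' -> (h <= h')%VS -> h' = h.

Definition cartan_subgroup (R : realType) (d : nat) (G : topGroupType)
    (c1 : chart G 'rV[R]_d) (h : {vspace 'rV[R]_d}) : set G :=
  [set g | exists2 xi, xi \in h & exp_rel c1 xi g].

Definition dual (R : realType) (d : nat) (h : {vspace 'rV[R]_d}) :=
  'Hom(subvs_of h, R^o).

Definition ev (R : realType) (d : nat) (h : {vspace 'rV[R]_d}) (w : dual h)
    (xi : subvs_of h) : R := w xi.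

(* The group X(H) inside h^*: [w] is identified with the character whose
   differential at 1 is i w, that is exp(xi) |-> e^(i w(xi)). *)
Definition char_lattice (R : realType) (d : nat) (G : topGroupType)
    (c1 : chart G 'rV[R]_d) (h : {vspace 'rV[R]_d}) : set (dual h) :=
  [set w | exists chi : G -> Cx R,
     [/\ forall x y, cartan_subgroup c1 h x -> cartan_subgroup c1 h y ->
           chi (x * y)%g = chi x * chi y,
         {within cartan_subgroup c1 h, continuous chi} &
         forall (xi : subvs_of h) g, exp_rel c1 (vsval xi) g -> chi g = cis (ev w xi)]].

(* Nonzero weights of the complexified adjoint representation: the root vector
   is A + i B and satisfies [xi, A + i B] = i a(xi) (A + i B) for xi in h. *)
Definition is_root (R : realType) (d : nat) (G : topGroupType)
    (c1 : chart G 'rV[R]_d) (h : {vspace 'rV[R]_d}) (a : dual h) : Prop :=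
  a != 0 /\ exists A B : 'rV[R]_d, (A, B) <> (0, 0) /\
    forall xi : subvs_of h,
      bracket c1 (vsval xi) A = - ev a xi *: B /\ bracket c1 (vsval xi) B = ev a xi *: A.

Definition nat_comb (R : realType) (d : nat) (h : {vspace 'rV[R]_d})
    (Delta : seq (dual h)) (a : dual h) : Prop :=
  exists c : nat -> nat, a = \sum_(i < size Delta) Delta`_i *+ c i.

Definition root_basis (R : realType) (d : nat) (G : topGroupType)
    (c1 : chart G 'rV[R]_d) (h : {vspace 'rV[R]_d}) (Delta : seq (dual h)) : Prop :=
  [/\ free Delta, forall a, a \in Delta -> is_root c1 a &
      forall a : dual h, is_root c1 a -> nat_comb Delta a \/ nat_comb Delta (- a)].

Definition pairing (R : realType) (d : nat) (a xi : 'rV[R]_d) : R := (a *m xi^T) 0 0.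

Definition invariant_ip (R : realType) (d : nat) (G : topGroupType)
    (c1 : chart G 'rV[R]_d) (B : 'M[R]_d) : Prop :=
  [/\ B^T = B, forall xi, xi != 0 -> 0 < pairing (xi *m B) xi &
      forall g xi eta, pairing (Ad c1 g xi *m B) (Ad c1 g eta) = pairing (xi *m B) eta].

(* The closed positive chamber (w, a) >= 0 for a in the basis; (w, a) is
   computed as w(t) where t in h is dual to a for an Ad-invariant inner
   product, the choice of which does not affect the sign. *)
Definition weyl_chamber (R : realType) (d : nat) (G : topGroupType)
    (c1 : chart G 'rV[R]_d) (h : {vspace 'rV[R]_d}) (Delta : seq (dual h))
    : set (dual h) :=
  [set w | forall (B : 'M[R]_d) (a : dual h) (t : subvs_of h),
     invariant_ip c1 B -> a \in Delta ->
     (forall xi : subvs_of h, pairing (vsval t *m B) (vsval xi) = ev a xi) ->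
     0 <= ev w t].

Definition irreducible_rep (R : realType) (r : nat) (G : topGroupType)
    (rho : G -> 'M[Cx R]_r) : Prop :=
  [/\ continuous rho, rho 1%g = 1%:M, forall x y, rho (x * y)%g = rho x *m rho y,
      (0 < r)%N &
      forall W : {vspace 'cV[Cx R]_r},
        (forall g v, v \in W -> rho g *m v \in W) -> W = 0%VS \/ W = fullv].

Definition is_weight (R : realType) (d r : nat) (G : topGroupType)
    (c1 : chart G 'rV[R]_d) (h : {vspace 'rV[R]_d}) (rho : G -> 'M[Cx R]_r)
    (w : dual h) : Prop :=
  exists2 v : 'cV[Cx R]_r, v != 0 &
    forall (xi : subvs_of h) g, exp_rel c1 (vsval xi) g ->
      rho g *m v = cis (ev w xi) *: v.

Definition highest_weight (R : realType) (d r : nat) (G : topGroupType)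
    (c1 : chart G 'rV[R]_d) (h : {vspace 'rV[R]_d}) (Delta : seq (dual h))
    (rho : G -> 'M[Cx R]_r) (w : dual h) : Prop :=
  is_weight c1 rho w /\
  forall w' : dual h, is_weight c1 rho w' -> nat_comb Delta (w - w').

(* Every line bundle L has a nowhere vanishing (in general discontinuous)
   section, so as a set L is M * C, linearly on fibres, and its k-th tensor
   power is M * C as well.  The holomorphic structure is carried by a family of
   local holomorphic frames (U, e), where e : M -> C is read in this
   set-theoretic trivialisation; the transition functions e / f are required to
   be holomorphic, and L^k has the frames e^k.  Thus:
   - sections of L^k are functions M -> C, holomorphic in the frames e^k;
   - a Hermitian metric is a function [hL] > 0, |z|^2 hL(p) being the squared
     norm of z in the fibre at p, smooth in the frames; the norm induced on
     L^k is |z|^2 hL(p)^k;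
   - a lift of an action [mu] to L, linear on fibres, is a cocycle [j]:
     g maps (p, z) to (mu g p, j g p * z). *)
Definition frame_family (R : realType) (M : Type) := set (set M * (M -> Cx R)).

Definition line_bundle (R : realType) (n : nat) (M : topologicalType)
    (AM : set (chart M 'rV[Cx R]_n)) (fr : frame_family R M) : Prop :=
  [/\ forall U e, fr (U, e) -> open U /\ (forall p, U p -> e p != 0),
      forall p, exists U e, fr (U, e) /\ U p &
      forall U e V f, fr (U, e) -> fr (V, f) ->
        holo_fun AM (U `&` V) (fun p => e p / f p)].

(* H^0(M, L^k) *)
Definition holo_section (R : realType) (n : nat) (M : topologicalType)
    (AM : set (chart M 'rV[Cx R]_n)) (fr : frame_family R M) (k : nat)
    (s : M -> Cx R) : Prop :=
  forall U e, fr (U, e) -> holo_fun AM U (fun p => s p / e p ^+ k).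

(* Some sections S_i of L^k define a holomorphic embedding [S_0 : ... ] into a
   projective space: no base point, injectivity, injective differential. *)
Definition very_ample_power (R : realType) (n : nat) (M : topologicalType)
    (AM : set (chart M 'rV[Cx R]_n)) (fr : frame_family R M) (k : nat) : Prop :=
  exists (r : nat) (S : 'I_r -> M -> Cx R),
    [/\ forall i, holo_section AM fr k (S i),
        forall p, exists i, S i p != 0,
        forall p q, (exists a : Cx R, forall i, S i p = a * S i q) -> p = q &
        forall U e c p (v : 'rV[Cx R]_n), fr (U, e) -> AM c -> U p -> cdom c p ->
          let F := fun z : 'rV[Cx R]_n =>
            \row_(i < r) (S i (cinv c z) / e (cinv c z) ^+ k) : 'rV[Cx R]_r in
          (exists a : Cx R, 'D_v F (cmap c p) = a *: F (cmap c p)) -> v = 0].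

Definition ample (R : realType) (n : nat) (M : topologicalType)
    (AM : set (chart M 'rV[Cx R]_n)) (fr : frame_family R M) : Prop :=
  exists2 k, (0 < k)%N & very_ample_power AM fr k.

Definition projective_manifold (R : realType) (n : nat) (M : topologicalType)
    (AM : set (chart M 'rV[Cx R]_n)) : Prop :=
  [/\ complex_manifold AM, compact [set: M] &
      exists fr, line_bundle AM fr /\ very_ample_power AM fr 1].

Definition hermitian_metric (R : realType) (n : nat) (M : topologicalType)
    (AM : set (chart M 'rV[Cx R]_n)) (fr : frame_family R M) (hL : M -> R) : Prop :=
  (forall p, 0 < hL p) /\
  forall U e, fr (U, e) ->
    smooth_fun (W := R^o) (real_atlas AM) U (fun p => sqmod (e p) * hL p).

(* The Chern connection and its curvature are expressed in a chart [c] and a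
   frame [e]. *)

Definition log_norm (R : realType) (n : nat) (M : Type) (c : chart M 'rV[Cx R]_n)
    (e : M -> Cx R) (hL : M -> R) (x : 'rV[R]_(n + n)) : R :=
  let p := cinv (real_chart c) x in ln (sqmod (e p) * hL p).

Definition ddx (R : realType) (n : nat) (j : 'I_n) (u : 'rV[R]_(n + n) -> R) :
    'rV[R]_(n + n) -> R :=
  fun x => 'D_(delta_mx 0 (lshift n j)) (u : _ -> R^o) x.
Definition ddy (R : realType) (n : nat) (j : 'I_n) (u : 'rV[R]_(n + n) -> R) :
    'rV[R]_(n + n) -> R :=
  fun x => 'D_(delta_mx 0 (rshift n j)) (u : _ -> R^o) x.

(* The connection form a = d' log |e|^2 (so nabla e = a e), on the tangent
   vector v; d'_j = (d/dx_j - i d/dy_j) / 2. *)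
Definition conn_form (R : realType) (n : nat) (M : Type) (c : chart M 'rV[Cx R]_n)
    (e : M -> Cx R) (hL : M -> R) (x : 'rV[R]_(n + n)) (v : 'rV[Cx R]_n) : Cx R :=
  let u := log_norm c e hL in
  \sum_(j < n) mkC (ddx j u x / 2) (- ddy j u x / 2) * v 0 j.

(* The curvature is da = \sum F_jk dz_j /\ dzbar_k with
   F_jk = - d'_j d''_k log |e|^2, where d''_k = (d/dx_k + i d/dy_k) / 2. *)
Definition curvature (R : realType) (n : nat) (M : Type) (c : chart M 'rV[Cx R]_n)
    (e : M -> Cx R) (hL : M -> R) (x : 'rV[R]_(n + n)) : 'M[Cx R]_n :=
  let u := log_norm c e hL in
  \matrix_(j, k) - mkC ((ddx j (ddx k u) x + ddy j (ddy k u) x) / 4)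
                       ((ddx j (ddy k u) x - ddy j (ddx k u) x) / 4).

Definition curv_herm (R : realType) (n : nat) (F : 'M[Cx R]_n) (v w : 'rV[Cx R]_n)
    : Cx R := \sum_(j < n) \sum_(k < n) F j k * v 0 j * (w 0 k)^*.

(* Omega = (i / 2 pi) \sum F_jk dz_j /\ dzbar_k on the tangent vectors v, w,
   i.e. the curvature is -2 pi i Omega. *)
Definition kahler_form (R : realType) (n : nat) (F : 'M[Cx R]_n) (v w : 'rV[Cx R]_n)
    : R := - (imC (curv_herm F v w) / pi).

(* Omega is closed and of type (1,1) by construction: it is a Kaehler form as
   soon as it is positive. *)
Definition kahler_curvature (R : realType) (n : nat) (M : topologicalType)
    (AM : set (chart M 'rV[Cx R]_n)) (fr : frame_family R M) (hL : M -> R) : Prop :=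
  forall U e c p (v : 'rV[Cx R]_n), fr (U, e) -> AM c -> U p -> cdom c p -> v != 0 ->
    0 < curv_herm (curvature c e hL (cmap (real_chart c) p)) v v.

Definition box (R : realType) (m : nat) (a b : 'rV[R]_m) : set 'rV[R]_m :=
  [set x | forall i, a 0 i <= x 0 i <= b 0 i].

Fixpoint box_integral (R : realType) (m : nat) :
    'rV[R]_m -> 'rV[R]_m -> ('rV[R]_m -> R) -> R :=
  match m return 'rV[R]_m -> 'rV[R]_m -> ('rV[R]_m -> R) -> R with
  | 0 => fun _ _ f => f 0
  | m'.+1 => fun a b f =>
      (\int[lebesgue_measure]_(t in `[a 0 ord0, b 0 ord0])
         box_integral (\row_i a 0 (lift ord0 i)) (\row_i b 0 (lift ord0 i))
           (fun y : 'rV[R]_m' => f (row_mx (const_mx t : 'rV[R]_1) y)))%R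
  end.

(* Omega^n / n! = pi^-n det(F) dx dy.  The values on coordinate boxes determine
   the Borel measure. *)
Definition volume_measure (R : realType) (n : nat) (M : ptopologicalType)
    (AM : set (chart M 'rV[Cx R]_n)) (fr : frame_family R M) (hL : M -> R)
    (vol : {measure set (g_sigma_algebraType (@open M)) -> \bar R}) : Prop :=
  forall U e c (a b : 'rV[R]_(n + n)), fr (U, e) -> AM c ->
    (forall i, a 0 i <= b 0 i) ->
    box a b `<=` cmap (real_chart c) @` (cdom c `&` U) ->
    vol (cinv (real_chart c) @` box a b) =
    (box_integral a b (fun x => reC (\det (curvature c e hL x)) / pi ^+ n))%:E.

Definition norm2 (R : realType) (M : Type) (hL : M -> R) (k : nat) (s : M -> Cx R)
    (p : M) : R := sqmod (s p) * hL p ^+ k.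

Definition l2_product (R : realType) (M : ptopologicalType) (hL : M -> R)
    (vol : {measure set (g_sigma_algebraType (@open M)) -> \bar R}) (k : nat)
    (s t : M -> Cx R) : Cx R :=
  mkC (\int[vol]_p (reC (s p * (t p)^*) * hL p ^+ k))%R
      (\int[vol]_p (imC (s p * (t p)^*) * hL p ^+ k))%R.

Definition is_action (G : groupType) (M : Type) (mu : G -> M -> M) : Prop :=
  (forall p, mu 1%g p = p) /\ forall g g' p, mu (g * g')%g p = mu g (mu g' p).

Definition is_lift (R : realType) (G : groupType) (M : Type) (mu : G -> M -> M)
    (j : G -> M -> Cx R) : Prop :=
  (forall p, j 1%g p = 1) /\ forall g g' p, j (g * g')%g p = j g (mu g' p) * j g' p.

(* Smooth actions of a real Lie group on M by holomorphic maps, and their lifts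
   by holomorphic maps of L. *)
Definition holo_action (R : realType) (d n : nat) (G : topGroupType)
    (M : topologicalType) (AG : set (chart G 'rV[R]_d))
    (AM : set (chart M 'rV[Cx R]_n)) (mu : G -> M -> M) : Prop :=
  [/\ is_action mu,
      smooth_map (prod_atlas AG (real_atlas AM)) (real_atlas AM)
        (fun x : G * M => mu x.1 x.2) &
      forall g, holo_map AM AM (mu g)].

Definition holo_lift (R : realType) (d n : nat) (G : topGroupType)
    (M : topologicalType) (AG : set (chart G 'rV[R]_d))
    (AM : set (chart M 'rV[Cx R]_n)) (fr : frame_family R M) (mu : G -> M -> M)
    (j : G -> M -> Cx R) : Prop :=
  is_lift mu j /\
  forall U e V f, fr (U, e) -> fr (V, f) ->
    smooth_cfun (prod_atlas AG (real_atlas AM))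
      [set x : G * M | U x.2 /\ V (mu x.1 x.2)]
      (fun x => j x.1 x.2 * e x.2 / f (mu x.1 x.2)) /\
    forall g, holo_fun AM (U `&` mu g @^-1` V) (fun p => j g p * e p / f (mu g p)).

Definition metric_invariant (R : realType) (G M : Type) (mu : G -> M -> M)
    (j : G -> M -> Cx R) (hL : M -> R) : Prop :=
  forall g p, sqmod (j g p) * hL (mu g p) = hL p.

Definition complex_action (R : realType) (d n : nat) (Gc : topGroupType)
    (M : topologicalType) (AGc : set (chart Gc 'rV[Cx R]_d))
    (AM : set (chart M 'rV[Cx R]_n)) (mu : Gc -> M -> M) : Prop :=
  is_action mu /\ holo_map (prod_atlas AGc AM) AM (fun x : Gc * M => mu x.1 x.2).

Definition complex_lift (R : realType) (d n : nat) (Gc : topGroupType)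
    (M : topologicalType) (AGc : set (chart Gc 'rV[Cx R]_d))
    (AM : set (chart M 'rV[Cx R]_n)) (fr : frame_family R M) (mu : Gc -> M -> M)
    (j : Gc -> M -> Cx R) : Prop :=
  is_lift mu j /\
  forall U e V f, fr (U, e) -> fr (V, f) ->
    holo_fun (prod_atlas AGc AM)
      [set x : Gc * M | U x.2 /\ V (mu x.1 x.2)]
      (fun x => j x.1 x.2 * e x.2 / f (mu x.1 x.2)).

(* The induced vector field xi_M at p, in the chart c. *)
Definition ind_field (R : realType) (d n : nat) (G : topGroupType) (M : Type)
    (c1 : chart G 'rV[R]_d) (mu : G -> M -> M) (c : chart M 'rV[Cx R]_n)
    (xi : 'rV[R]_d) (p : M) : 'rV[Cx R]_n :=
  of_real (derive1 (fun t : R => cmap (real_chart c) (mu (curve1 c1 xi t) p)) 0).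

(* The dual g^* is identified with 'rV_d by [pairing].  The conditions are
   smoothness, Ad^*-equivariance and d<Phi, xi> = - i(xi_M) Omega. *)
Definition moment_map (R : realType) (d n : nat) (G : topGroupType)
    (M : topologicalType) (c1 : chart G 'rV[R]_d) (AM : set (chart M 'rV[Cx R]_n))
    (fr : frame_family R M) (hL : M -> R) (mu : G -> M -> M) (Phi : M -> 'rV[R]_d)
    : Prop :=
  [/\ smooth_fun (real_atlas AM) setT Phi,
      forall g p xi, pairing (Phi (mu g p)) (Ad c1 g xi) = pairing (Phi p) xi &
      forall U e c p xi (v : 'rV[R]_(n + n)),
        fr (U, e) -> AM c -> U p -> cdom c p ->
        let x := cmap (real_chart c) p in
        pairing ('D_v (Phi \o cinv (real_chart c)) x) xi =
        - kahler_form (curvature c e hL x) (ind_field c1 mu c xi p) (of_real v)].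

(* xi_X = xi_M^# + <Phi, xi> d/dtheta on the unit circle bundle X of L^*.
   In the dual frame e^* a point of X is z e^*(p).  Vertical components at
   that point:
   - the horizontal lift of v has z' = z a(v), a the connection form of e;
   - d/dtheta has z' = 2 pi i z (S^1 = R/Z, so that the connection 1-form with
     value 1 on d/dtheta has differential Omega, and the Hamilton equation of
     [moment_map] follows without a factor 2 pi);
   - g acts on L^* by duality, e^*(p) |-> J(g)^-1 e^*(g p) where
     J(g) = j g p * e p / e (g p), so xi_X has z' = - z J'. *)
Definition moment_of_lift (R : realType) (d n : nat) (G : topGroupType)
    (M : topologicalType) (c1 : chart G 'rV[R]_d) (AM : set (chart M 'rV[Cx R]_n))
    (fr : frame_family R M) (hL : M -> R) (mu : G -> M -> M) (j : G -> M -> Cx R)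
    (Phi : M -> 'rV[R]_d) : Prop :=
  forall U e c p xi, fr (U, e) -> AM c -> U p -> cdom c p ->
    let J := fun t : R => let g := curve1 c1 xi t in j g p * e p / e (mu g p) in
    let J' := mkC (derive1 (fun t => reC (J t) : R^o) 0)
                  (derive1 (fun t => imC (J t) : R^o) 0) in
    - J' = conn_form c e hL (cmap (real_chart c) p) (ind_field c1 mu c xi p)
           + mkC 0 (2 * pi * pairing (Phi p) xi).

Definition zero_level (R : realType) (d : nat) (M : Type) (Phi : M -> 'rV[R]_d)
    : set M := [set p | Phi p = 0].

Definition zero_regular (R : realType) (d n : nat) (M : Type)
    (AM : set (chart M 'rV[Cx R]_n)) (Phi : M -> 'rV[R]_d) : Prop :=
  forall c p, zero_level Phi p -> AM c -> cdom c p ->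
  forall eta : 'rV[R]_d, exists v : 'rV[R]_(n + n),
    'D_v (Phi \o cinv (real_chart c)) (cmap (real_chart c) p) = eta.

Definition free_on (G : groupType) (M : Type) (mu : G -> M -> M) (Z : set M) : Prop :=
  forall g p, Z p -> mu g p = p -> g = 1%g.

Definition saturation (G M : Type) (mu : G -> M -> M) (A : set M) : set M :=
  [set q | exists g, exists2 p, A p & q = mu g p].

Definition unstable_set (R : realType) (d : nat) (Gc M : Type) (muc : Gc -> M -> M)
    (Phi : M -> 'rV[R]_d) : set M := ~` saturation muc (zero_level Phi).

Definition section_act (R : realType) (G : groupType) (M : Type) (mu : G -> M -> M)
    (j : G -> M -> Cx R) (k : nat) (g : G) (s : M -> Cx R) : M -> Cx R :=
  fun q => let p := mu (g^-1)%g q in j g p ^+ k * s p.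

Definition intertwiner (R : realType) (n r : nat) (G : topGroupType)
    (M : topologicalType) (AM : set (chart M 'rV[Cx R]_n)) (fr : frame_family R M)
    (mu : G -> M -> M) (j : G -> M -> Cx R) (rho : G -> 'M[Cx R]_r) (k : nat)
    (T : 'cV[Cx R]_r -> M -> Cx R) : Prop :=
  [/\ forall v, holo_section AM fr k (T v),
      forall (a : Cx R) v w p, T (a *: v + w) p = a * T v p + T w p &
      forall g v, T (rho g *m v) = section_act mu j k g (T v)].

Definition isotypical (R : realType) (n r : nat) (G : topGroupType)
    (M : topologicalType) (AM : set (chart M 'rV[Cx R]_n)) (fr : frame_family R M)
    (mu : G -> M -> M) (j : G -> M -> Cx R) (rho : G -> 'M[Cx R]_r) (k : nat)
    : set (M -> Cx R) :=
  [set s | exists (l : nat) (T : 'I_l -> 'cV[Cx R]_r -> M -> Cx R)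
                  (v : 'I_l -> 'cV[Cx R]_r),
     (forall i, intertwiner AM fr mu j rho k (T i)) /\
     forall p, s p = \sum_(i < l) T i (v i) p].

Definition orthonormal_basis (R : realType) (M : ptopologicalType) (hL : M -> R)
    (vol : {measure set (g_sigma_algebraType (@open M)) -> \bar R}) (k : nat)
    (E : set (M -> Cx R)) (b : nat) (s : 'I_b -> M -> Cx R) : Prop :=
  [/\ forall i, E (s i),
      forall i i', l2_product hL vol k (s i) (s i') = (i == i')%:R &
      forall t, E t -> exists a : 'I_b -> Cx R,
        forall p, t p = \sum_(i < b) a i * s i p].

(* Main.v *)
Require Import Defs.
From HB Require Import structures.
From mathcomp Require Import all_boot all_order all_algebra complex.
From mathcomp Require Import all_classical all_reals all_analysis.
From mathcomp Require Import measurable_realfun.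
From mathcomp Require Import ring lra.
Import Order.TTheory GRing.Theory Num.Theory.
Import numFieldNormedType.Exports.
Local Open Scope classical_set_scope.
Local Open Scope ring_scope.
Set Implicit Arguments.
Unset Strict Implicit.

(** Outside the zero level of the moment map the densities of the isotypical
    components decay like e^(-ak), uniformly on compact sets.  Two estimates
    give this.

    Growth.  Let Phi(p) <> 0 and xi = Phi(p), so that <Phi, xi> > 0 near p.
    In a holomorphic frame e of L let F be the local expression of a section
    of L^k and let H = |e|^2.  For a G-invariant section, differentiating the
    invariance along xi shows that dF(xi_M) = k J' F, where J' is the derivative
    of the lifted action; the formula for the lift of xi_M says that J' is
    minus a(xi_M) + 2 pi i <Phi, xi>, with a = d' log H.  As F is holomorphic, its
    derivative in the direction i xi_M is i times this, the connection terms
    cancel against the derivative of H^k, and |F|^2 H^k is seen to grow along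
    i xi_M at the rate 4 pi k <Phi, xi>.  Following i xi_M for a fixed time
    therefore multiplies the squared norm by e^(ak): near p a section
    bounded by A has squared norm at most A e^(-ak).  Only an inequality
    for directional derivatives is needed, hence a compactness argument replaces
    the flow ([growth_along_directions]).

    A section in the omega-component is not invariant, but it moves in a space
    of bounded dimension: fix elements g_0 = 1, ..., g_N of G whose images span
    the linear span of rho(G).  The translates g_m s then satisfy a linear
    system along xi whose matrix depends only on rho ([rep_span],
    [flow_differential]).  Its contribution is bounded independently of k and is
    absorbed by 4 pi k <Phi, xi> for large k ([flow_mass_growth],
    [isotypical_decay]).  That t |-> rho(exp t xi) is differentiable at 0 is
    read off from the sections themselves: matrix entries of rho are
    combinations of values of translated sections ([rep_cderiv]).

    From L^2 to the supremum.  For every theta < 1 there is C with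
    sup |s|^2 <= C theta^(-(2n+2)k) |s|_(L^2)^2 for all holomorphic sections of
    L^k ([sup_L2]).  At a point where |s|^2 is maximal, H varies little on a
    small ball, so F is there at most theta^(-k) times its value at the centre;
    by the Schwarz lemma |F| stays above half of that value on a ball of radius
    proportional to theta^k, whose volume is bounded below because the curvature
    is positive.  The one-variable facts behind the Schwarz lemma (the theorem of
    Goursat, mean values on circles, the maximum principle) are proved first.

    Conclusion ([bergman_decay]).  Apply both estimates to
    sigma = sum_i conj(s_i(q)) s_i, q near p, with theta^(2n+2) = e^(-a/2).  With
    w = sum_i |s_i(q)|^2 (values in the fixed set-theoretic trivialisation),
    orthonormality gives |sigma|_(L^2)^2 = w, while |sigma|^2 at q is w times the
    density sum_i |s_i|^2 at q.  Hence the density is at most C e^(ak/2) e^(-ak). *)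

(** * Complex numbers *)

Section ComplexBasics.
Variable R : realType.
Implicit Types z w : Cx R.

Definition cabs z : R := Num.sqrt (sqmod z).

(** The norm of a complex number is itself a complex number; [cabs] is its real
    value, which is what all estimates below are about. *)
Lemma cabsE z : `|z| = (cabs z)%:C%C.
Proof. by rewrite /cabs /sqmod /reC /imC -normc_def. Qed.

Lemma cabsM z w : cabs (z * w) = cabs z * cabs w.
Proof. by apply: complexI; rewrite rmorphM /= -!cabsE normrM. Qed.

Lemma cabsD z w : cabs (z + w) <= cabs z + cabs w.
Proof. by rewrite -lecR rmorphD /= -!cabsE ler_normD. Qed.

Lemma cabsN z : cabs (- z) = cabs z.
Proof. by apply: complexI; rewrite -!cabsE normrN. Qed.

Lemma cabs_ge0 z : 0 <= cabs z. Proof. exact: sqrtr_ge0. Qed.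

Lemma cabs0 : cabs 0 = 0.
Proof. by apply: complexI; rewrite -cabsE normr0. Qed.

Lemma cabs1 : cabs 1 = 1.
Proof. by apply: complexI; rewrite -cabsE normr1. Qed.

Lemma cabs_eq0 z : (cabs z == 0) = (z == 0).
Proof. by rewrite -(inj_eq (@complexI R)) -cabsE normr_eq0. Qed.

Lemma cabs_gt0 z : (0 < cabs z) = (z != 0).
Proof. by rewrite lt_neqAle eq_sym cabs_eq0 cabs_ge0 andbT. Qed.

Lemma cabsV z : cabs z^-1 = (cabs z)^-1.
Proof. by apply: complexI; rewrite -cabsE normfV cabsE -fmorphV. Qed.

Lemma cabsX z n : cabs (z ^+ n) = cabs z ^+ n.
Proof. by elim: n => [|n IH]; rewrite ?expr0 ?cabs1 // !exprS cabsM IH. Qed.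

Lemma sqmod_ge0 z : 0 <= sqmod z.
Proof. by rewrite /sqmod addr_ge0 ?sqr_ge0. Qed.

Lemma sqr_cabs z : cabs z ^+ 2 = sqmod z.
Proof. by rewrite /cabs sqr_sqrtr ?sqmod_ge0. Qed.

Lemma sqmodM z w : sqmod (z * w) = sqmod z * sqmod w.
Proof. by rewrite -!sqr_cabs cabsM exprMn. Qed.

Lemma sqmodX z n : sqmod (z ^+ n) = sqmod z ^+ n.
Proof. by rewrite -!sqr_cabs cabsX exprAC. Qed.

Lemma sqmod_eq0 z : (sqmod z == 0) = (z == 0).
Proof. by rewrite -sqr_cabs sqrf_eq0 cabs_eq0. Qed.

Lemma sqmod_gt0 z : (0 < sqmod z) = (z != 0).
Proof. by rewrite lt_neqAle eq_sym sqmod_eq0 sqmod_ge0 andbT. Qed.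

Lemma reCD z w : reC (z + w) = reC z + reC w.
Proof. by case: z w => [a b] [c d]. Qed.
Lemma imCD z w : imC (z + w) = imC z + imC w.
Proof. by case: z w => [a b] [c d]. Qed.
Lemma reCN z : reC (- z) = - reC z.
Proof. by case: z => [a b]. Qed.
Lemma imCN z : imC (- z) = - imC z.
Proof. by case: z => [a b]. Qed.
Lemma reCM z w : reC (z * w) = reC z * reC w - imC z * imC w.
Proof. by case: z w => [a b] [c d]. Qed.
Lemma imCM z w : imC (z * w) = reC z * imC w + imC z * reC w.
Proof. by case: z w => [a b] [c d]. Qed.
Lemma reC0 : reC (0 : Cx R) = 0. Proof. by []. Qed.
Lemma imC0 : imC (0 : Cx R) = 0. Proof. by []. Qed.
Lemma reC1 : reC (1 : Cx R) = 1. Proof. by []. Qed.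
Lemma imC1 : imC (1 : Cx R) = 0. Proof. by []. Qed.
Lemma reCR (a : R) : reC (a%:C%C : Cx R) = a. Proof. by []. Qed.
Lemma imCR (a : R) : imC (a%:C%C : Cx R) = 0. Proof. by []. Qed.
Lemma reC_conj z : reC z^* = reC z. Proof. by case: z. Qed.
Lemma imC_conj z : imC z^* = - imC z. Proof. by case: z. Qed.
Lemma mkCE z : mkC (reC z) (imC z) = z. Proof. by case: z. Qed.
Lemma reC_mkC (a b : R) : reC (mkC a b) = a. Proof. by []. Qed.
Lemma imC_mkC (a b : R) : imC (mkC a b) = b. Proof. by []. Qed.

Lemma Cx_eq z w : reC z = reC w -> imC z = imC w -> z = w.
Proof. by case: z w => [a b] [c d]; rewrite /reC /imC /= => -> ->. Qed.

Lemma reC_le z : `|reC z| <= cabs z.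
Proof. by rewrite -sqrtr_sqr /cabs ler_sqrt ?sqmod_ge0 // /sqmod lerDl sqr_ge0. Qed.
Lemma imC_le z : `|imC z| <= cabs z.
Proof. by rewrite -sqrtr_sqr /cabs ler_sqrt ?sqmod_ge0 // /sqmod lerDr sqr_ge0. Qed.

Lemma cabs_le_sum z : cabs z <= `|reC z| + `|imC z|.
Proof.
rewrite -(ler_sqr (x := cabs z)) ?nnegrE ?cabs_ge0 ?addr_ge0 // sqr_cabs /sqmod sqrrD.
rewrite !real_normK ?num_real // addrAC lerDl mulrn_wge0 // mulr_ge0 //.
Qed.

Lemma cabs_sum (I : Type) (r : seq I) (f : I -> Cx R) :
  cabs (\sum_(i <- r) f i) <= \sum_(i <- r) cabs (f i).
Proof.
elim: r => [|i r IH]; first by rewrite !big_nil cabs0.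
rewrite !big_cons; apply: le_trans (cabsD _ _) _; by rewrite lerD2l.
Qed.

Lemma conj_sqmod z : z * z^* = (sqmod z)%:C%C.
Proof. by apply: Cx_eq; rewrite ?reCM ?imCM ?reC_conj ?imC_conj ?reCR ?imCR /sqmod; ring. Qed.

Lemma cabs_real (a : R) : cabs (a%:C%C : Cx R) = `|a|.
Proof. by rewrite /cabs /sqmod reCR imCR expr0n addr0 sqrtr_sqr. Qed.

Lemma cabs_conj z : cabs z^* = cabs z.
Proof. by rewrite /cabs /sqmod reC_conj imC_conj sqrrN. Qed.

End ComplexBasics.

Section ComplexTopology.
Variable R : realType.
Local Notation C := (Cx R).

Lemma nbhsCP (z : C) (P : set C) :
  nbhs z P <-> exists2 d : R, 0 < d & forall w, cabs (w - z) <= d -> P w.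
Proof.
split.
  move=> /nbhs_ballP[e /= e0 H].
  have e0' : 0 < e :> R[i] by exact: e0.
  move: e0'; rewrite ltcE /= => /andP[/eqP ime ree].
  exists (complex.Re e / 2); first by rewrite divr_gt0.
  move=> w hw; apply: H; rewrite -ball_normE /= distrC cabsE.
  have -> : e = ((complex.Re e)%:C)%C by apply: Cx_eq => //=; rewrite /imC ime.
  rewrite [X in is_true X]ltcR (le_lt_trans hw) // ltr_pdivrMr // mulr_natr mulr2n ltrDr //.
move=> [d d0 H]; apply/nbhs_ballP; exists (d%:C)%C; first by rewrite /= [X in is_true X]ltcR.
move=> w; rewrite -ball_normE /= distrC cabsE [X in is_true X]ltcR => /ltW; exact: H.
Qed.

Lemma cvgCP (T : Type) (F : set_system T) {FF : Filter F} (f : T -> C) (l : C) :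
  f @ F --> l <-> forall e : R, 0 < e -> \forall x \near F, cabs (f x - l) <= e.
Proof.
split=> [H e e0|H].
  by apply: (H (fun w => cabs (w - l) <= e)); apply/nbhsCP; exists e.
move=> P /nbhsCP[d d0 HP]; apply: filterS (H _ d0) => x /HP //.
Qed.

Lemma cvgC_split (T : Type) (F : set_system T) {FF : Filter F} (f : T -> C) (l : C) :
  f @ F --> l <-> ((fun x => reC (f x)) @ F --> reC l) /\ ((fun x => imC (f x)) @ F --> imC l).
Proof.
rewrite cvgCP; split=> [H|[H1 H2] e e0].
  split; apply/cvgrPdist_le => e e0; apply: filterS (H _ e0) => x; apply: le_trans.
    by rewrite distrC -reCN -reCD reC_le.
  by rewrite distrC -imCN -imCD imC_le.
have e20 : 0 < e / 2 by lra.
move/cvgrPdist_le/(_ _ e20) : H1 => H1; move/cvgrPdist_le/(_ _ e20) : H2 => H2.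
near=> x.
apply: le_trans (cabs_le_sum _) _.
rewrite reCD imCD reCN imCN [e]splitr ![`|_ (f _) - _|]distrC.
by apply: lerD; near: x.
Unshelve. all: end_near. Qed.

(** Differentiability in the form in which errors are propagated: an affine
    approximation with an explicit radius. *)
Lemma derivableC (F : C -> C) (w : C) : derivable (F : C^o -> C^o) w 1 ->
  exists l : C, forall e : R, 0 < e -> exists2 d, 0 < d &
    forall h, cabs h <= d -> cabs (F (w + h) - F w - l * h) <= e * cabs h.
Proof.
move=> /cvg_ex[/= l Hl]; exists l => e e0.
move: Hl => /cvgCP/(_ _ e0).
rewrite near_withinE => /nbhsCP[d d0 H]; exists d => // h hd.
have [->|h0] := eqVneq h 0; first by rewrite addr0 subrr mulr0 subr0 cabs0 mulr0.
have := H h; rewrite subr0 => /(_ hd h0).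
rewrite /GRing.scale /= mulr1 [w + h]addrC => H1.
have -> : F (h + w) - F w - l * h = (h^-1 * (F (h + w) - F w) - l) * h.
  by rewrite mulrBl [_^-1 * _]mulrC mulfVK.
by rewrite cabsM ler_wpM2r ?cabs_ge0.
Qed.

End ComplexTopology.

(** * The theorem of Goursat *)

Lemma MVT_is_derive (R : realType) (f df : R -> R) (a b : R) : a <= b ->
  (forall t, a <= t <= b -> is_derive t (1 : R) f (df t)) ->
  exists2 t, a <= t <= b & f b - f a = df t * (b - a).
Proof.
move=> ab H; have := @MVT_segment R f df a b ab; case.
- by move=> t; rewrite in_itv /= => /andP[/ltW ? /ltW ?]; apply: H; apply/andP.
- apply: derivable_within_continuous => t; rewrite in_itv /= => tab.
  by have [] := H t tab.
by move=> t tab E; exists t.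
Qed.

Section Goursat.
Variables (R : realType) (A B P Q : R -> R -> R).

(** The integral of P dx + Q dy over the boundary of the rectangle
    [a, b] x [c, d], expressed with primitives: A(., y) is a primitive of P(., y) and
    B(x, .) one of Q(x, .).  Using primitives avoids all discussion of line
    integrals. *)
Definition rect_sum (r : R * R * R * R) : R :=
  let: (a, b, c, d) := r in
  (A b c - A a c) + (B b d - B b c) - (A b d - A a d) - (B a d - B a c).

Definition in_rect (r : R * R * R * R) (x y : R) : Prop :=
  let: (a, b, c, d) := r in (a <= x <= b) /\ (c <= y <= d).

Definition half_perimeter (r : R * R * R * R) : R :=
  let: (a, b, c, d) := r in (b - a) + (d - c).

Definition proper_rect (r : R * R * R * R) : Prop :=
  let: (a, b, c, d) := r in a <= b /\ c <= d.

(** A mean value inequality: if df is e-close to an affine function, then f is,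
    up to e (b - a), the corresponding quadratic one. *)
Lemma MVT_affine (f df : R -> R) (a b x P0 p1 p2 e : R) : a <= b ->
  (forall t, a <= t <= b -> is_derive t (1 : R) f (df t)) ->
  (forall t, a <= t <= b -> `|df t - P0 - p1 * (t - x) - p2| <= e) ->
  `|f b - f a - (P0 * (b - a) + p1 * ((b - x) ^+ 2 - (a - x) ^+ 2) / 2 + p2 * (b - a))|
     <= e * (b - a).
Proof.
move=> ab Hd Hb.
pose g t := f t - (P0 * t + p1 / 2 * (t - x) ^+ 2 + p2 * t).
have dg t : a <= t <= b -> is_derive t (1 : R) g (df t - P0 - p1 * (t - x) - p2).
  move=> tab; have ft := Hd t tab.
  have -> : g = f - ((P0 *: id) + (p1 / 2) *: ((id - cst x) ^+ 2) + p2 *: id) by [].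
  have d1 := is_deriveB (is_derive_id t (1 : R)) (is_derive_cst x t (1 : R)).
  have d2 := is_deriveD (is_deriveD (is_deriveZ P0 (is_derive_id t (1 : R)))
    (is_deriveZ (p1 / 2) (is_deriveX 2 d1))) (is_deriveZ p2 (is_derive_id t (1 : R))).
  apply: (is_derive_eq (is_deriveB ft d2)); rewrite /GRing.scale /= !mulr1 subr0 expr1 /=.
  rewrite -[(id - cst x) t]/(t - x).
  by move: (df t) (t - x) => y z; field.
have [t tab E] := MVT_is_derive ab dg.
have -> : f b - f a - (P0 * (b - a) + p1 * ((b - x) ^+ 2 - (a - x) ^+ 2) / 2 + p2 * (b - a))
   = g b - g a by rewrite /g; field.
by rewrite E normrM (ger0_norm (x := b - a)) ?subr_ge0 // ler_wpM2r ?subr_ge0 // Hb.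
Qed.

Variables (r0 : R * R * R * R).
Hypothesis dA : forall x y, in_rect r0 x y -> is_derive x (1 : R) (A^~ y) (P x y).
Hypothesis dB : forall x y, in_rect r0 x y -> is_derive y (1 : R) (B x) (Q x y).
Hypothesis dPQ : forall x y, in_rect r0 x y -> exists p1 p2 q2 : R,
  forall e, 0 < e -> exists2 del, 0 < del &
  forall x' y', in_rect r0 x' y' -> `|x' - x| <= del -> `|y' - y| <= del ->
   `|P x' y' - P x y - p1 * (x' - x) - p2 * (y' - y)| <= e * (`|x' - x| + `|y' - y|) /\
   `|Q x' y' - Q x y - p2 * (x' - x) - q2 * (y' - y)| <= e * (`|x' - x| + `|y' - y|).

Definition sub_rect (r r' : R * R * R * R) : Prop :=
  let: (a, b, c, d) := r in let: (a', b', c', d') := r' in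
  [/\ a' <= a, b <= b', c' <= c & d <= d'].

(** Goursat's local estimate.  The two functions are affine up to an error e
    times the size, with the same coefficient p2 for dP/dy and dQ/dx: the
    form P dx + Q dy is closed, and the affine parts cancel in the sum. *)
Lemma rect_sum_near (x y k : R) : in_rect r0 x y -> 0 < k -> exists2 del, 0 < del &
  forall r, proper_rect r -> sub_rect r r0 -> in_rect r x y -> half_perimeter r <= del ->
    `|rect_sum r| <= k * half_perimeter r ^+ 2.
Proof.
move=> xy k0; have [p1 [p2 [q2 H]]] := dPQ xy.
have k20 : 0 < k / 2 by lra.
have [del del0 {}H] := H _ k20; exists del => //.
case: r0 H dA dB => [[[a0 b0] c0] d0] H dA' dB'.
move=> [[[a b] c] d] /= [ab cd] [a0a bb0 c0c dd0] [xab ycd] sdel.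
set s := b - a + (d - c) in sdel *.
have s0 : 0 <= s by rewrite /s; lra.
have bnd x' y' : a <= x' <= b -> c <= y' <= d ->
  `|x' - x| <= del /\ `|y' - y| <= del /\ `|x' - x| + `|y' - y| <= s.
  move=> h1 h2.
  have : `|x' - x| <= b - a by rewrite ler_norml; lra.
  have : `|y' - y| <= d - c by rewrite ler_norml; lra.
  rewrite /s in sdel *; split; [|split]; lra.
have rx x' : a <= x' <= b -> a0 <= x' <= b0 by lra.
have ry y' : c <= y' <= d -> c0 <= y' <= d0 by lra.
have key x' y' : a <= x' <= b -> c <= y' <= d ->
   `|P x' y' - P x y - p1 * (x' - x) - p2 * (y' - y)| <= k / 2 * s /\
   `|Q x' y' - Q x y - q2 * (y' - y) - p2 * (x' - x)| <= k / 2 * s.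
  move=> hx hy; have [h1 [h2 h3]] := bnd _ _ hx hy.
  have [u1 u2] := H x' y' (conj (rx _ hx) (ry _ hy)) h1 h2.
  split; first by rewrite (le_trans u1) // ler_wpM2l // ltW.
  by rewrite addrAC (le_trans u2) // ler_wpM2l // ltW.
have cc : c <= c <= d by lra.
have dd : c <= d <= d by lra.
have aa : a <= a <= b by lra.
have bb : a <= b <= b by lra.
have HA y' (hy : c <= y' <= d) := @MVT_affine (A^~ y') (P^~ y') a b x (P x y) p1 (p2 * (y' - y)) _ ab
  (fun t ht => dA' t y' (conj (rx _ ht) (ry _ hy))) (fun t ht => (key t y' ht hy).1).
have HB x' (hx : a <= x' <= b) := @MVT_affine (B x') (Q x') c d y (Q x y) q2 (p2 * (x' - x)) _ cd
  (fun t ht => dB' x' t (conj (rx _ hx) (ry _ ht))) (fun t ht => (key x' t hx ht).2).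
have := HA c cc; have := HA d dd; have := HB a aa; have := HB b bb.
rewrite !ler_norml => /andP[m1 m2] /andP[m3 m4] /andP[m5 m6] /andP[m7 m8].
have -> : k * s ^+ 2 = k / 2 * s * (b - a) + k / 2 * s * (d - c) + k / 2 * s * (b - a) + k / 2 * s * (d - c).
  by rewrite /s; field.
by apply/andP; split; lra.
Qed.

Let bad k r := [/\ proper_rect r, sub_rect r r0 & k * half_perimeter r ^+ 2 < `|rect_sum r|].

(** The sum over a rectangle is that over its four quarters, so one of them
    retains a quarter of it, that is, the same quotient by the squared
    half-perimeter. *)
Lemma rect_bisect k r : bad k r -> exists r', [/\ bad k r', sub_rect r' r &
  half_perimeter r' = half_perimeter r / 2].
Proof.
case: r => [[[a b] c] d]; rewrite /bad.
case E0 : r0 => [[[a0 b0] c0] d0] /= [[ab cd] [a0a bb0 c0c dd0] Hk].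
pose x := (a + b) / 2; pose y := (c + d) / 2.
have xE : x = (a + b) / 2 by []. have yE : y = (c + d) / 2 by [].
have : `|rect_sum (a, b, c, d)| <= `|rect_sum (a, x, c, y)| + `|rect_sum (x, b, c, y)|
    + `|rect_sum (a, x, y, d)| + `|rect_sum (x, b, y, d)|.
  have -> : rect_sum (a, b, c, d) = rect_sum (a, x, c, y) + rect_sum (x, b, c, y)
    + rect_sum (a, x, y, d) + rect_sum (x, b, y, d) by rewrite /rect_sum; ring.
  do 2!(apply: le_trans (ler_normD _ _) _; rewrite lerD2r); exact: ler_normD.
set h := b - a + (d - c) in Hk *.
have hE r' : half_perimeter r' = h / 2 -> k * half_perimeter r' ^+ 2 = k * h ^+ 2 / 4.
  by move=> ->; field.
have [h1|h1] := ltP (k * h ^+ 2 / 4) `|rect_sum (a, x, c, y)|.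
  move=> _; exists (a, x, c, y); split; [split|..]; rewrite ?hE //=; rewrite /h; try split; lra.
have [h2|h2] := ltP (k * h ^+ 2 / 4) `|rect_sum (x, b, c, y)|.
  move=> _; exists (x, b, c, y); split; [split|..]; rewrite ?hE //=; rewrite /h; try split; lra.
have [h3|h3] := ltP (k * h ^+ 2 / 4) `|rect_sum (a, x, y, d)|.
  move=> _; exists (a, x, y, d); split; [split|..]; rewrite ?hE //=; rewrite /h; try split; lra.
have [h4|h4] := ltP (k * h ^+ 2 / 4) `|rect_sum (x, b, y, d)|.
  move=> _; exists (x, b, y, d); split; [split|..]; rewrite ?hE //=; rewrite /h; try split; lra.
move=> h5; exfalso; move: Hk; rewrite /rect_sum in h1 h2 h3 h4 h5 *; lra.
Qed.

Lemma sub_rect_trans r1 r2 r3 : sub_rect r1 r2 -> sub_rect r2 r3 -> sub_rect r1 r3.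
Proof.
case: r1 => [[[a b] c] d]; case: r2 => [[[a' b'] c'] d']; case: r3 => [[[e f] g] h] /=.
by move=> [h1 h2 h3 h4] [h5 h6 h7 h8]; split; lra.
Qed.

Lemma sub_rect_refl r : sub_rect r r.
Proof. by case: r => [[[a b] c] d]; split. Qed.

(** Otherwise repeated bisection gives nested rectangles, along which the sum is
    at least k times the squared size; at the common point this
    contradicts [rect_sum_near]. *)
Theorem goursat : proper_rect r0 -> rect_sum r0 = 0.
Proof.
move=> pr0; apply/eqP; rewrite -normr_eq0; apply/negPn/negP => T0.
have {}T0 : 0 < `|rect_sum r0| by rewrite lt_neqAle eq_sym T0 normr_ge0.
set h0 := half_perimeter r0.
pose k := `|rect_sum r0| / (h0 ^+ 2 + 1).
have h1 : 0 < h0 ^+ 2 + 1 by have := sqr_ge0 h0; lra.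
have k0 : 0 < k by rewrite divr_gt0.
have bad0 : bad k r0.
  split=> //; first exact: sub_rect_refl.
  by rewrite -/h0 /k mulrAC ltr_pdivrMr // ltr_pM2l //; lra.
have /choice[f Hf] : forall r, exists r', bad k r ->
    [/\ bad k r', sub_rect r' r & half_perimeter r' = half_perimeter r / 2].
  move=> r; have [/rect_bisect[r' Hr']|nb] := pselect (bad k r); last by exists r.
  by exists r'.
pose rs n := iter n f r0.
have rbad n : bad k (rs n) by elim: n => //= n /Hf[].
have rsub n m : (n <= m)%N -> sub_rect (rs m) (rs n).
  move=> /subnK <-; elim: (m - n)%N => [|i IH]; first exact: sub_rect_refl.
  rewrite addSn /=; apply: sub_rect_trans IH.
  by have [] := Hf _ (rbad (i + n)%N).
have rh n : half_perimeter (rs n) = h0 / 2 ^+ n.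
  elim: n => [|n IH]; first by rewrite expr0 divr1.
  by have [_ _ /= ->] := Hf _ (rbad n); rewrite IH exprS invfM mulrA mulrAC -mulrA.
pose lo n := (rs n).1.1.1; pose hi n := (rs n).1.1.2.
pose lo' n := (rs n).1.2; pose hi' n := (rs n).2.
have lohi n m : lo n <= hi m /\ lo' n <= hi' m.
  rewrite /lo /hi /lo' /hi'.
  have := rsub n _ (leq_maxl n m); have := rsub m _ (leq_maxr n m).
  have [] := rbad (maxn n m).
  move: (rs n) (rs m) (rs (maxn n m)) => [[[? ?] ?] ?] [[[? ?] ?] ?] [[[? ?] ?] ?] /=.
  by move=> [? ?] _ _ [? ? ? ?] [? ? ? ?]; split; lra.
have supP (u v : nat -> R) : (forall n m, u n <= v m) ->
    forall n, u n <= sup (range u) <= v n.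
  move=> uv n; apply/andP; split.
    apply: ub_le_sup; last by exists n.
    by exists (v 0%N) => _ [i _ <-].
  by apply: ge_sup; [exists (u 0%N); exists 0%N|move=> _ [i _ <-]].
(* The point common to all the rectangles. *)
pose x := sup (range lo); pose y := sup (range lo').
have xP n : lo n <= x <= hi n by apply: supP => i j; have [] := lohi i j.
have yP n : lo' n <= y <= hi' n by apply: supP => i j; have [] := lohi i j.
have xyin n : in_rect (rs n) x y.
  by move: (xP n) (yP n); rewrite /lo /hi /lo' /hi'; case: (rs n) => [[[? ?] ?] ?] /=.
have [del del0 Hdel] := rect_sum_near (xyin 0%N) k0.
have [n hn] : exists n, h0 / 2 ^+ n <= del.
  exists (Num.Def.archi_bound (h0 / del)).
  rewrite ler_pdivrMr ?exprn_gt0 // mulrC -ler_pdivrMr //.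
  exact/ltW/upper_nthrootP.
have [p1 p2] := rbad n.
by rewrite ltNge Hdel // rh.
Qed.

End Goursat.

(** * The maximum principle *)

Section Polar.
Variable R : realType.
Local Notation C := (Cx R).

Definition prim (al : R) (f : R -> R) (x : R) : R :=
  (\int[@lebesgue_measure R]_(t in `[al, x]) f t)%R.

Lemma prim_derive (f : R -> R) (al x : R) : continuous f -> al < x ->
  is_derive x (1 : R) (prim al f) (f x).
Proof.
move=> cf alx.
have xu : x < x + 1 by lra.
have [] := @continuous_FTC1 R f (BLeft al) x (x + 1) xu.
- apply: continuous_compact_integrable; first exact: segment_compact.
  exact: continuous_subspaceT.
- by rewrite lte_fin.
- exact: cf.
by rewrite derive1E => d e; split.
Qed.

(** The complex exponential e^(x + iy), used as polar coordinates around a point. *)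
Definition expc (x y : R) : C := mkC (expR x * cos y) (expR x * sin y).

Lemma cabs_expc x y : cabs (expc x y) = expR x.
Proof.
rewrite /cabs /sqmod /reC /imC /= !exprMn -mulrDr cos2Dsin2 mulr1.
by rewrite sqrtr_sqr ger0_norm // expR_ge0.
Qed.

Lemma expc_neq0 x y : expc x y != 0.
Proof. by rewrite -cabs_gt0 cabs_expc expR_gt0. Qed.

Lemma expc2pi x : expc x (2 * pi) = expc x 0.
Proof. by rewrite /expc mulr_natl cos2pi sin2pi cos0 sin0. Qed.

Lemma expcD x y s t : expc (x + s) (y + t) = expc x y * expc s t.
Proof.
apply: Cx_eq; rewrite ?reCM ?imCM /reC /imC /= expRD ?cosD ?sinD; ring.
Qed.

Lemma derive_bound (f : R -> R) (x l : R) : is_derive x (1 : R) f l ->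
  forall e, 0 < e -> exists2 d, 0 < d &
    forall h, `|h| <= d -> `|f (x + h) - f x - l * h| <= e * `|h|.
Proof.
move=> [df lE] e e0; move: df; rewrite /derivable => /cvg_ex[/= l' Hl].
have l'E : l' = l by rewrite -lE; apply/esym/cvg_lim.
subst l'.
move/cvgrPdist_le/(_ _ e0) : Hl; rewrite near_withinE => /nbhs_ballP[d /= d0 H].
exists (d / 2); first by rewrite divr_gt0.
move=> h hd; have [->|h0] := eqVneq h 0; first by rewrite addr0 subrr mulr0 subr0 normr0 mulr0.
have hb : ball 0 d h by rewrite -ball_normE /= sub0r normrN; lra.
have := H h hb h0; rewrite /GRing.scale /= mulr1 [x + h]addrC => H1.
have -> : f (h + x) - f x - l * h = - ((l - h^-1 * (f (h + x) - f x)) * h).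
  by rewrite mulrBl [_^-1 * _]mulrC mulfVK // opprB.
by rewrite normrN normrM ler_wpM2r.
Qed.

Lemma expc_diff (e : R) : 0 < e -> exists2 d, 0 < d &
  forall s t, `|s| <= d -> `|t| <= d ->
    cabs (expc s t - 1 - mkC s t) <= e * (`|s| + `|t|).
Proof.
move=> e0; set e1 := Num.min (e / 6) (1 / 4).
have e10 : 0 < e1 by rewrite lt_min; apply/andP; split; lra.
have e1e : e1 <= e / 6 by rewrite ge_min lexx.
have e14 : e1 <= 1 / 4 by rewrite ge_min lexx orbT.
have [d1 d10 H1] := derive_bound (is_derive_expR 0) e10.
have [d2 d20 H2] := derive_bound (is_derive_cos (0 : R)) e10.
have [d3 d30 H3] := derive_bound (is_derive_sin (0 : R)) e10.
exists (Num.min (e1 / 2) (Num.min d1 (Num.min d2 d3))).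
  by rewrite !lt_min d10 d20 d30 !andbT; lra.
move=> s t; rewrite !le_min => /and4P[s0 s1 _ _] /and4P[t0 _ t2 t3].
have := H1 _ s1; have := H2 _ t2; have := H3 _ t3.
rewrite !add0r cos0 sin0 expR0 subr0 oppr0 mul0r subr0 !mul1r => h3 h2 h1.
apply: le_trans (cabs_le_sum _) _.
rewrite !reCD !imCD !reCN !imCN reC1 imC1 /reC /imC /= subr0.
have c1 : `|cos t| <= 1 by rewrite ler_norml cos_geN1 cos_le1.
have es : `|expR s - 1| <= 5 / 4 * `|s|.
  have -> : expR s - 1 = expR s - 1 - s + s by ring.
  have : e1 * `|s| <= 1 / 4 * `|s| by rewrite ler_wpM2r.
  by move=> b0; apply: le_trans (ler_normD _ _) _; lra.
have es3 : `|expR s| <= 3.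
  have -> : expR s = expR s - 1 + 1 by ring.
  by apply: le_trans (ler_normD _ _) _; rewrite normr1; lra.
have -> : expR s * cos t - 1 - s = (expR s - 1 - s) * cos t + (1 + s) * (cos t - 1) by ring.
have -> : expR s * sin t - t = expR s * (sin t - t) + t * (expR s - 1) by ring.
have s2 : `|1 + s| <= 2 by apply: le_trans (ler_normD _ _) _; rewrite normr1; lra.
have b1 : `|(expR s - 1 - s) * cos t + (1 + s) * (cos t - 1)| <= e1 * `|s| + 2 * (e1 * `|t|).
  apply: le_trans (ler_normD _ _) _; rewrite !normrM lerD //.
    by rewrite -[leRHS]mulr1 ler_pM.
  by rewrite ler_pM.
have b2 : `|expR s * (sin t - t) + t * (expR s - 1)| <= 3 * (e1 * `|t|) + `|t| * e1.
  apply: le_trans (ler_normD _ _) _; rewrite !normrM lerD //.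
    by rewrite ler_pM.
  by rewrite ler_wpM2l //; lra.
have bs : e1 * `|s| <= e / 6 * `|s| by rewrite ler_wpM2r.
have bt : e1 * `|t| <= e / 6 * `|t| by rewrite ler_wpM2r.
have es0 : 0 <= e * `|s| by rewrite mulr_ge0 // ltW.
lra.
Qed.

(** The chain rule for F(w + e^(x + iy)): as a function of (x, y) it is
    differentiable and satisfies the Cauchy-Riemann equations, which are
    encoded by the single complex coefficient m. *)
Lemma polar_diff (F : C -> C) (w : C) (x y : R) :
  derivable (F : C^o -> C^o) (w + expc x y) 1 ->
  exists m : C, forall e, 0 < e -> exists2 d, 0 < d &
   forall x' y', `|x' - x| <= d -> `|y' - y| <= d ->
    cabs (F (w + expc x' y') - F (w + expc x y) - m * mkC (x' - x) (y' - y))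
      <= e * (`|x' - x| + `|y' - y|).
Proof.
move=> /derivableC[l Hl]; set E := expc x y; exists (l * E) => e e0.
have E0 : 0 <= cabs E := cabs_ge0 _. have l0 : 0 <= cabs l := cabs_ge0 _.
have lE0 : 0 <= cabs l * cabs E by rewrite mulr_ge0.
pose e1 := e / (4 * (cabs E + 1)).
have e10 : 0 < e1 by rewrite divr_gt0 //; lra.
pose e2 := Num.min 1 (e / (2 * (cabs l * cabs E + 1))).
have e20 : 0 < e2 by rewrite lt_min ltr01 divr_gt0 //; lra.
have e21 : e2 <= 1 by rewrite ge_min lexx.
have e2e : e2 * (cabs l * cabs E + 1) <= e / 2.
  rewrite -ler_pdivlMr; last lra.
  by rewrite ge_min; apply/orP; right; rewrite -mulrA -invfM.
have [d1 d10 H1] := Hl _ e10.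
have [d2 d20 H2] := expc_diff e20.
exists (Num.min d2 (d1 / (4 * (cabs E + 1)))).
  by rewrite lt_min d20 divr_gt0 //; lra.
move=> x' y'; rewrite !le_min => /andP[s1 s2] /andP[t1 t2].
set s := x' - x in s1 s2 *; set t := y' - y in t1 t2 *.
set k := expc s t - 1 - mkC s t.
have kb := H2 _ _ s1 t1; rewrite -/k in kb.
set sg := `|s| + `|t| in kb *.
have sg0 : 0 <= sg by rewrite addr_ge0.
pose h := E * (mkC s t + k).
have Eh : expc x' y' = E + h.
  have -> : expc x' y' = expc (x + s) (y + t) by rewrite /s /t !addrA ![_ + _ - _]addrAC !subrr !add0r.
  by rewrite expcD -/E /h /k; ring.
have mst : cabs (mkC s t) <= sg by apply: cabs_le_sum.
have hb : cabs h <= cabs E * (2 * sg).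
  rewrite cabsM ler_wpM2l // (le_trans (cabsD _ _)) //.
  have : e2 * sg <= sg by rewrite ler_piMl.
  lra.
have hd : cabs h <= d1.
  apply: le_trans hb _.
  have q : sg <= 2 * (d1 / (4 * (cabs E + 1))) by rewrite /sg; lra.
  have -> : d1 = (cabs E + 1) * (2 * (2 * (d1 / (4 * (cabs E + 1))))) by field; lra.
  by rewrite ler_pM ?mulr_ge0 // ?lerDl // ler_wpM2l.
have wEh : w + E + h = w + expc x' y' by rewrite Eh addrA.
have := H1 _ hd; rewrite wEh => H3.
have -> : F (w + expc x' y') - F (w + E) - l * E * mkC s t =
  (F (w + expc x' y') - F (w + E) - l * h) + l * E * k by rewrite /h; ring.
apply: le_trans (cabsD _ _) _.
have b1 : e1 * cabs h <= e / 2 * sg.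
  apply: (@le_trans _ _ (e1 * (cabs E * (2 * sg)))); first by rewrite ler_wpM2l // ltW.
  rewrite !mulrA ler_wpM2r //.
  have -> : e / 2 = e1 * ((cabs E + 1) * 2) by rewrite /e1; field; lra.
  by rewrite -mulrA ler_wpM2l ?ler_wpM2r ?lerDl // ltW.
have b2 : cabs (l * E * k) <= e / 2 * sg.
  rewrite !cabsM.
  apply: (@le_trans _ _ (cabs l * cabs E * (e2 * sg))); first by rewrite ler_wpM2l.
  rewrite mulrA ler_wpM2r //; apply: le_trans e2e; rewrite mulrC ler_wpM2l ?lerDl // ltW //.
lra.
Qed.

End Polar.

Lemma derivable_affine_pert (K : numFieldType) (f : K -> K) (a b c x : K) :
  derivable (f : K^o -> K^o) x 1 ->
  derivable (fun z : K^o => a * f z + b * (z - c) : K^o) x 1.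
Proof.
move=> df; apply: derivableD.
  by apply: derivableM; [exact: derivable_cst|].
apply: derivableM; first exact: derivable_cst.
by apply: derivableB; [exact: derivable_id|exact: derivable_cst].
Qed.

Lemma continuous_affine_pert (K : numFieldType) (f : K -> K) (a b c x : K) :
  {for x, continuous f} -> {for x, continuous (fun z : K => a * f z + b * (z - c))}.
Proof.
move=> cf.
have h1 : a * f z @[z --> x] --> a * f x by exact: (cvgM (cvg_cst a) cf).
have h2 : z - c @[z --> x] --> x - c by exact: (cvgB (@cvg_id _ (nbhs x)) (cvg_cst c)).
exact: (cvgD h1 (cvgM (cvg_cst b) h2)).
Qed.

Lemma derivable_slope (K : numFieldType) (f : K -> K) (c x : K) : x != 0 ->
  derivable (f : K^o -> K^o) x 1 ->
  derivable (fun z : K^o => z^-1 * (f z - c) : K^o) x 1.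
Proof.
move=> x0 df; apply: derivableM.
  by apply: derivableV => //; exact: derivable_id.
by apply: derivableB => //; exact: derivable_cst.
Qed.

Section MaxPrinciple.
Variable R : realType.
Local Notation C := (Cx R).

Lemma polar_continuous (F : C -> C) (w : C) (x y : R) :
  derivable (F : C^o -> C^o) (w + expc x y) 1 ->
  forall e, 0 < e -> exists2 d, 0 < d &
   forall x' y', `|x' - x| <= d -> `|y' - y| <= d ->
    cabs (F (w + expc x' y') - F (w + expc x y)) <= e.
Proof.
move=> /polar_diff[m Hm] e e0; have [d d0 H] := Hm 1 ltr01.
have m0 : 0 <= cabs m := cabs_ge0 _.
exists (Num.min d (e / (2 * (cabs m + 1)))).
  by rewrite lt_min d0 divr_gt0 //; lra.
move=> x' y'; rewrite !le_min => /andP[s1 s2] /andP[t1 t2].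
have := H _ _ s1 t1; set s := x' - x in s1 s2 *; set t := y' - y in t1 t2 *.
set D := F _ - F _ => h.
have -> : D = (D - m * mkC s t) + m * mkC s t by rewrite subrK.
apply: le_trans (cabsD _ _) _; rewrite cabsM.
have k : cabs (mkC s t) <= `|s| + `|t| by apply: cabs_le_sum.
have k2 : cabs m * cabs (mkC s t) <= cabs m * (`|s| + `|t|) by rewrite ler_wpM2l.
apply: (@le_trans _ _ ((cabs m + 1) * (`|s| + `|t|))); first by rewrite mulrDl; lra.
have -> : e = (cabs m + 1) * (e / (2 * (cabs m + 1)) + e / (2 * (cabs m + 1))).
  by field; lra.
by apply: ler_wpM2l; [lra|apply: lerD].
Qed.

Lemma continuous_le (f : R -> R) (x : R) :
  (forall e, 0 < e -> exists2 d, 0 < d & forall y, `|y - x| <= d -> `|f y - f x| <= e) ->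
  {for x, continuous f}.
Proof.
move=> H; apply/cvgrPdist_le => e e0; have [d d0 Hd] := H e e0.
apply: filterS (nbhsx_ballx x d d0) => y; rewrite -ball_normE /= => xy.
by rewrite distrC; apply: Hd; rewrite distrC ltW.
Qed.

(** A weak mean value property, sufficient for the maximum principle.  By
    [goursat] in logarithmic polar coordinates the integral of Re F over
    the circle of radius e^x does not depend on x; by the mean value theorem the
    average is attained, and letting x tend to minus infinity it equals
    Re F(w).  Only continuity is required at w, so that difference quotients
    are covered. *)
Lemma circle_point (F : C -> C) (w : C) (r : R) : 0 < r ->
  (forall h, h != 0 -> cabs h <= r -> derivable (F : C^o -> C^o) (w + h) 1) ->
  {for w, continuous F} ->
  exists y, reC (F (w + expc (ln r) y)) = reC (F w).
Proof.
move=> r0 dF cF; set b := ln r.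
pose u x y := reC (F (w + expc x y)); pose v x y := imC (F (w + expc x y)).
have dE x y : x <= b -> derivable (F : C^o -> C^o) (w + expc x y) 1.
  by move=> xb; apply: dF; rewrite ?expc_neq0 // cabs_expc -(lnK r0) ler_expR.
(* The truncation at b makes the integrand continuous on the whole line, and
   the base point x0 - 1 lies left of the interval that is used. *)
pose A x0 x y := prim (x0 - 1) (fun t => v (Num.min t b) y) x.
pose B x y := prim (- 1) (u x) y.
have cu x : x <= b -> continuous (u x).
  move=> xb y; apply: continuous_le => e e0.
  have [d d0 H] := polar_continuous (dE x y xb) e0; exists d => // y' yy'.
  rewrite /u -reCN -reCD (le_trans (reC_le _)) // H // subrr normr0 ltW //.
have cv y : continuous (fun t => v (Num.min t b) y).
  move=> x.
  have cm : continuous (fun t : R => Num.min t b).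
    by move=> t; apply: (@continuous_min R R id (cst b) t) => //; exact: cst_continuous.
  apply: (@continuous_comp _ _ _ (fun t : R => Num.min t b) (v^~ y) x (cm x)).
  apply: continuous_le => e e0.
  have xb : Num.min x b <= b by rewrite ge_min lexx orbT.
  have [d d0 H] := polar_continuous (dE _ y xb) e0; exists d => // x' xx'.
  by rewrite /v -imCN -imCD (le_trans (imC_le _)) // H // subrr normr0 ltW.
have pi0 : 0 <= 2 * pi :> R by rewrite mulr_ge0 // pi_ge0.
have key a : a < b -> B b (2 * pi) - B b 0 = B a (2 * pi) - B a 0.
  move=> ab.
  have : rect_sum (A a) B (a, b, 0, 2 * pi) = 0.
  apply: (@goursat R (A a) B v u (a, b, 0, 2 * pi)).
  - move=> x y [/andP[ax xb] _]; rewrite -[v x y]/((fun x => v x y) x).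
    have {2}-> : x = Num.min x b by apply/esym/min_idPl.
    by apply: (prim_derive (cv y)); lra.
  - move=> x y [/andP[ax xb] /andP[y0 _]]; apply: (prim_derive (cu x xb)); lra.
  - move=> x y [/andP[ax xb] _].
    have [m Hm] := polar_diff (dE x y xb).
    exists (imC m), (reC m), (- imC m) => e e0.
    have [d d0 H] := Hm e e0; exists d => // x' y' _ xx yy.
    have Hb := H x' y' xx yy.
    set z := F (w + expc x' y') - F (w + expc x y) - m * mkC (x' - x) (y' - y) in Hb.
    have -> : v x' y' - v x y - imC m * (x' - x) - reC m * (y' - y) = imC z.
      by rewrite /z !imCD !imCN imCM reC_mkC imC_mkC /v; ring.
    have -> : u x' y' - u x y - reC m * (x' - x) - - imC m * (y' - y) = reC z.
      by rewrite /z !reCD !reCN reCM reC_mkC imC_mkC /u; ring.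
    by split; apply: le_trans Hb; [exact: imC_le|exact: reC_le].
  - by split; first exact: ltW.
  rewrite /rect_sum.
  have AE x : A a x (2 * pi) = A a x 0.
    by congr (prim _ _ _); apply/funext => t; rewrite /v expc2pi.
  by rewrite !AE; move: (B b _) (B b _) (B a _) (B a _) (A a _ _) (A a _ _) => *; lra.
have ub x : x <= b -> exists2 y, 0 <= y <= 2 * pi & B x (2 * pi) - B x 0 = u x y * (2 * pi).
  move=> xb; have [|y y0 E] := @MVT_is_derive R (B x) (u x) 0 (2 * pi) pi0.
    by move=> y /andP[y0 _]; apply: (prim_derive (cu x xb)); lra.
  by exists y => //; rewrite E subr0.
have [yb _ Eb] := ub b (lexx b).
exists yb; rewrite -/(u b yb); apply/eqP/negPn/negP => ne.
set e := `|u b yb - reC (F w)|.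
have e0 : 0 < e by rewrite normr_gt0 subr_eq0.
have e20 : 0 < e / 2 by rewrite divr_gt0.
have [d d0 Hd] := (nbhsCP _ _).1 ((cvgCP F (F w)).1 cF _ e20).
(* On the circle of radius e^a <= d, F is within e / 2 of F w. *)
pose a := Num.min (b - 1) (ln d).
have ab : a < b by rewrite /a gt_min; apply/orP; left; lra.
have [ya _ Ea] := ub a (ltW ab).
have uE : u b yb = u a ya.
  have pi2 : 2 * pi != 0 :> R by rewrite mulf_neq0 // gt_eqF ?pi_gt0.
  by apply: (mulIf pi2); rewrite -Eb -Ea; exact: (key a ab).
have : cabs (w + expc a ya - w) <= d.
  by rewrite addrAC subrr add0r cabs_expc -[leRHS](lnK d0) ler_expR ge_min lexx orbT.
move=> /Hd H.
have : e <= e / 2.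
  by rewrite {1}/e uE /u -reCN -reCD (le_trans (reC_le _)).
by rewrite ler_pdivlMr // ger_pMr // (ler_nat _ 2 1).
Qed.

Lemma sqmodD (z w : C) : sqmod (z + w) = sqmod z + 2 * reC (z^* * w) + sqmod w.
Proof. by rewrite /sqmod !reCD !imCD reCM reC_conj imC_conj; ring. Qed.

Lemma mkC_continuous : continuous (fun p : R * R => mkC p.1 p.2 : C).
Proof.
move=> p; apply/cvgC_split; split; first exact: cvg_fst.
exact: cvg_snd.
Qed.

Lemma cvgC_re (T : Type) (F : set_system T) {FF : Filter F} (f : T -> C) (l : C) :
  f @ F --> l -> (fun x => reC (f x)) @ F --> reC l.
Proof. by move=> /cvgC_split[]. Qed.

Lemma cvgC_im (T : Type) (F : set_system T) {FF : Filter F} (f : T -> C) (l : C) :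
  f @ F --> l -> (fun x => imC (f x)) @ F --> imC l.
Proof. by move=> /cvgC_split[]. Qed.

Lemma cvgC_sqmod (T : Type) (F : set_system T) {FF : Filter F} (f : T -> C) (l : C) :
  f @ F --> l -> (fun x => sqmod (f x)) @ F --> sqmod l.
Proof.
move=> /cvgC_split[h1 h2]; rewrite /sqmod.
exact: (cvgD (cvgM h1 h1) (cvgM h2 h2)).
Qed.

Lemma compact_disc (rho : R) : compact [set p : R * R | cabs (mkC p.1 p.2) <= rho].
Proof.
apply: (@subclosed_compact _ _ (`[- rho, rho]%classic `*` `[- rho, rho]%classic)).
- rewrite (_ : [set p | _] = (fun p : R * R => cabs (mkC p.1 p.2)) @^-1` [set x | x <= rho]) //.
  apply: preimage_closed; last exact: closed_le.
  move=> p _; apply: (@continuous_comp _ _ _ (fun p : R * R => sqmod (mkC p.1 p.2)) (@Num.sqrt R)).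
    exact: (cvgC_sqmod (@mkC_continuous p)).
  exact: sqrt_continuous.
- by apply: compact_setX; exact: segment_compact.
move=> [x y] /= h; split; rewrite /= in_itv /= -ler_norml.
  exact: le_trans (reC_le (mkC x y)) h.
exact: le_trans (imC_le (mkC x y)) h.
Qed.

Lemma derivable_continuousC (F : C -> C) (w : C) :
  derivable (F : C^o -> C^o) w 1 -> {for w, continuous F}.
Proof. by move=> /derivable1_diffP/differentiable_continuous. Qed.

(** If |F| exceeded M at w0, then psi(z) = Re(conj(F(w0)) F(z)) + e |z|^2 with small
    e would have an interior maximum w1 on the disc.  Near w1 psi is the real part of
    a holomorphic function plus e |z - w1|^2 up to a constant, so by
    [circle_point] it takes on small circles a value above psi(w1). *)
Lemma max_principle (F : C -> C) (rho M : R) : 0 < rho ->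
  (forall w, w != 0 -> cabs w <= rho -> derivable (F : C^o -> C^o) w 1) ->
  {for 0, continuous F} ->
  (forall w, cabs w = rho -> cabs (F w) <= M) ->
  forall w, cabs w <= rho -> cabs (F w) <= M.
Proof.
move=> rho0 dF cF0 FM w0 w0r; rewrite leNgt; apply/negP => Mlt.
have cF w : cabs w <= rho -> {for w, continuous F}.
  have [-> _|wn0 wr] := eqVneq w 0; first exact: cF0.
  exact: (derivable_continuousC (dF w wn0 wr)).
set c := F w0 in Mlt; set m0 := cabs c in Mlt.
have M0 : 0 <= M.
  have rr : cabs ((rho%:C)%C : C) = rho by rewrite cabs_real gtr0_norm.
  exact: le_trans (cabs_ge0 _) (FM _ rr).
have S0 : 0 < m0 * (m0 - M) by rewrite mulr_gt0 //; lra.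
(* With this e the quadratic term is at most half of the gap between psi w0
   and the values allowed on the boundary circle. *)
pose e := m0 * (m0 - M) / (2 * rho ^+ 2).
have rho20 : 0 < rho ^+ 2 by rewrite exprn_gt0.
have e0 : 0 < e by rewrite divr_gt0 //; lra.
have er : e * rho ^+ 2 = m0 * (m0 - M) / 2 by rewrite /e; field; rewrite gt_eqF.
pose psi z := reC (c^* * F z) + e * sqmod z.
pose K := [set p : R * R | cabs (mkC p.1 p.2) <= rho].
have [||[x1 y1] /set_mem /= w1r pmax] :=
    @compact_EVT_max _ R (fun p : R * R => psi (mkC p.1 p.2)) K _ (@compact_disc rho).
- by exists (reC w0, imC w0); rewrite /K /= mkCE.
- apply: continuous_in_subspaceT => p /set_mem Kp.
  have h1 : F (mkC q.1 q.2) @[q --> p] --> F (mkC p.1 p.2).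
    by apply: (@continuous_comp _ _ _ (fun q : R * R => mkC q.1 q.2 : C) F);
      [exact: mkC_continuous|exact: cF].
  exact: (cvgD (cvgC_re (cvgM (cvg_cst (c^* )) h1)) (cvgM (cvg_cst e) (cvgC_sqmod (@mkC_continuous p)))).
set w1 := mkC x1 y1 in w1r.
have wmax z : cabs z <= rho -> psi z <= psi w1.
  by move=> zr; have := pmax (reC z, imC z); rewrite /= mkCE; apply; rewrite inE /K /= mkCE.
have pw0 : m0 ^+ 2 <= psi w0.
  by rewrite /psi -/c mulrC conj_sqmod reCR -sqr_cabs lerDl mulr_ge0 ?sqmod_ge0 // ltW.
have w1lt : cabs w1 < rho.
  rewrite lt_neqAle w1r andbT; apply/eqP => w1e.
  have h1 := wmax w0 w0r.
  have h2 : psi w1 <= m0 * M + m0 * (m0 - M) / 2.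
    rewrite /psi -sqr_cabs w1e er lerD2r.
    apply: le_trans (ler_norm _) _; apply: le_trans (reC_le _) _.
    by rewrite cabsM cabs_conj ler_wpM2l ?cabs_ge0 ?FM.
  have : m0 * m0 - m0 * M <= m0 * (m0 - M) / 2 by rewrite -expr2; lra.
  rewrite -mulrBr; lra.
(* The circle around w1 must stay in the disc and avoid 0, where only
   continuity is known. *)
pose r := if w1 == 0 then rho else Num.min (cabs w1 / 2) (rho - cabs w1).
have r0 : 0 < r.
  rewrite /r; case: eqVneq => // w1n0; rewrite lt_min subr_gt0 w1lt andbT.
  by rewrite divr_gt0 // cabs_gt0.
have hr h : cabs h <= r -> cabs (w1 + h) <= rho.
  move=> hr; apply: le_trans (cabsD _ _) _.
  move: hr; rewrite /r; case: eqVneq => [->|_]; first by rewrite cabs0 add0r.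
  by rewrite le_min => /andP[_]; lra.
have h0 h : h != 0 -> cabs h <= r -> w1 + h != 0.
  move=> hn0 hr'; apply/eqP => /eqP; rewrite addrC addr_eq0 => /eqP hE.
  move: hr'; rewrite hE cabsN /r; case: eqVneq => [w10|w1n0].
    by move: hn0; rewrite hE w10 oppr0 eqxx.
  rewrite le_min => /andP[+ _]; have : 0 < cabs w1 by rewrite cabs_gt0.
  lra.
pose Phi z : C := c^* * F z + ((2 * e)%:C)%C * w1^* * (z - w1).
have [||y] := @circle_point Phi w1 r r0.
- move=> h hn0 hr'; apply: derivable_affine_pert.
  by apply: dF; [exact: h0|exact: hr].
- by apply: continuous_affine_pert; apply: cF; exact: ltW.
set h := expc _ y.
have hE : cabs h = r by rewrite cabs_expc lnK.
have := wmax (w1 + h) (hr _ _); rewrite hE lexx => /(_ isT).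
rewrite /psi /Phi sqmodD -(sqr_cabs h) hE.
have -> : w1 + h - w1 = h by rewrite addrAC subrr add0r.
rewrite subrr mulr0 addr0 reCD -mulrA (reCM ((2 * e)%:C)%C) reCR imCR mul0r subr0.
have : 0 < e * r ^+ 2 by rewrite mulr_gt0 // exprn_gt0.
rewrite !mulrDr; move: (reC (w1^* * h)) (reC (c^* * _)) (reC (c^* * _)) => X Y Z.
lra.
Qed.

(** The maximum principle applied to the difference quotient (g(z) - g(0)) / z. *)
Lemma schwarz_lipschitz (g : C -> C) (rho A : R) : 0 < rho ->
  (forall w, cabs w <= rho -> derivable (g : C^o -> C^o) w 1) ->
  (forall w, cabs w <= rho -> cabs (g w) <= A) ->
  forall w, cabs w <= rho -> cabs (g w - g 0) <= 2 * A / rho * cabs w.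
Proof.
move=> rho0 dg gA w wr.
have [->|w0] := eqVneq w 0; first by rewrite subrr cabs0 mulr0.
have c0 : cabs (0 : C) <= rho by rewrite cabs0 ltW.
have [l Hl] := derivableC (dg 0 c0).
pose phi z : C := if z == 0 then l else z^-1 * (g z - g 0).
have phiE : cabs (phi w) <= 2 * A / rho.
  apply: (@max_principle phi rho) => //.
  - move=> z z0 zr.
    apply: (@near_eq_derivable _ _ _ (fun z : C^o => z^-1 * (g z - g 0) : C^o)).
      have : nbhs z [set y : C | y != 0].
        apply/nbhsCP; exists (cabs z / 2); first by rewrite divr_gt0 // cabs_gt0.
        move=> y yz; apply/eqP => y0; move: yz; rewrite y0 sub0r cabsN.
        have : 0 < cabs z by rewrite cabs_gt0.
        lra.
      by apply: filterS => y y0; rewrite /phi ifN.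
    by apply: derivable_slope => //; exact: dg.
  - suff : phi @ nbhs (0 : C) --> phi 0 by [].
    apply/cvgCP => e e0; have [d d0 H] := Hl e e0.
    apply/nbhsCP; exists d => // z; rewrite subr0 => zd.
    rewrite /phi; case: eqVneq => [_|z0]; first by rewrite eqxx subrr cabs0 ltW.
    rewrite eqxx.
    have := H z zd; rewrite add0r => h.
    have -> : z^-1 * (g z - g 0) - l = z^-1 * (g z - g 0 - l * z).
      by rewrite [RHS]mulrBr [l * z]mulrC mulrA mulVf // mul1r.
    by rewrite cabsM cabsV mulrC ler_pdivrMr // cabs_gt0.
  - move=> z zr; rewrite /phi ifN; last by rewrite -cabs_gt0 zr.
    rewrite cabsM cabsV zr mulrC ler_pM2r ?invr_gt0 //.
    apply: le_trans (cabsD _ _) _; rewrite cabsN.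
    have := gA z; rewrite zr lexx => /(_ isT); have := gA 0 c0; lra.
have -> : g w - g 0 = phi w * w.
  by rewrite /phi ifN // mulrAC mulVf // mul1r.
by rewrite cabsM ler_wpM2r // cabs_ge0.
Qed.

End MaxPrinciple.

(** * Integrals over boxes and positive determinants *)

(** The integral of a nonnegative function is a supremum over the simple
    functions below it, hence monotone for arbitrary functions; the inner integrals
    of a box integral are compared in this generality. *)
Lemma ge0_le_integral_nomeas d (T : measurableType d) (R : realType)
    (mu : {measure set T -> \bar R}) (D : set T) (f g : T -> \bar R) :
  (forall x, D x -> (0 <= f x)%E) -> (forall x, D x -> (f x <= g x)%E) ->
  (\int[mu]_(x in D) f x <= \int[mu]_(x in D) g x)%E.
Proof.
move=> f0 fg; rewrite !ge0_integralE //; last first.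
  by move=> x Dx; exact: le_trans (f0 x Dx) (fg x Dx).
apply: ereal_sup_le => _ [h hf <-]; exists h => // x.
apply: le_trans (hf x) _; rewrite /patch; case: ifPn => // /set_mem Dx; exact: fg.
Qed.

Lemma Rintegral_bounds (R : realType) (f : R -> R) (a b c C : R) :
  a <= b -> 0 <= c -> (forall x, a <= x <= b -> c <= f x <= C) ->
  c * (b - a) <= (\int[lebesgue_measure]_(x in `[a, b]) f x)%R <= C * (b - a).
Proof.
move=> ab c0 fcC.
have mab : (lebesgue_measure (`[a, b]%classic : set R) = (b - a)%:E)%E.
  rewrite lebesgue_measure_itv /= lte_fin; case: ltP => // ba.
  have -> : b = a by apply/eqP; rewrite eq_le ab ba.
  by rewrite subrr.
have cst r : (\int[lebesgue_measure]_(x in `[a, b]) r%:E = (r * (b - a))%:E :> \bar R)%E.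
  by rewrite integral_cst // EFinM; congr (_ * _)%E; exact: mab.
have ge : ((c * (b - a))%:E <= \int[lebesgue_measure]_(x in `[a, b]) (f x)%:E)%E.
  rewrite -cst; apply: ge0_le_integral_nomeas => x /=; rewrite in_itv /= lee_fin //.
  by move=> /fcC /andP[].
have le : (\int[lebesgue_measure]_(x in `[a, b]) (f x)%:E <= (C * (b - a))%:E)%E.
  rewrite -cst; apply: ge0_le_integral_nomeas => x /=; rewrite in_itv /= lee_fin.
    by move=> /fcC /andP[+ _]; apply: le_trans.
  by move=> /fcC /andP[].
rewrite /Rintegral.
case E : (integral _ _ _) ge le => [r| |] //=.
by rewrite !lee_fin => -> ->.
Qed.

Lemma box_integral_bounds (R : realType) m (a b : 'rV[R]_m) (f : 'rV[R]_m -> R) (c C : R) :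
  (forall i, a 0 i <= b 0 i) -> 0 <= c ->
  (forall x, box a b x -> c <= f x <= C) ->
  c * \prod_i (b 0 i - a 0 i) <= box_integral a b f <= C * \prod_i (b 0 i - a 0 i).
Proof.
elim: m a b f c C => [|m IH] a b f c C ab c0 fcC.
  by rewrite !big_ord0 !mulr1 /=; apply: fcC => -[].
rewrite !big_ord_recl /=.
set P := \prod_(i < m) _.
have -> : c * ((b 0 ord0 - a 0 ord0) * P) = c * P * (b 0 ord0 - a 0 ord0) by ring.
have -> : C * ((b 0 ord0 - a 0 ord0) * P) = C * P * (b 0 ord0 - a 0 ord0) by ring.
have P0 : 0 <= P by apply: prodr_ge0 => i _; rewrite subr_ge0.
apply: Rintegral_bounds => //; first by rewrite mulr_ge0.
move=> t tab.
have := IH (\row_i a 0 (lift ord0 i)) (\row_i b 0 (lift ord0 i))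
  (fun y : 'rV[R]_m => f (row_mx (const_mx t : 'rV[R]_1) y)) c C.
rewrite (_ : \prod_(i < m) _ = P); last by apply: eq_bigr => i _; rewrite !mxE.
apply=> //; first by move=> i; rewrite !mxE.
move=> y yb; apply: fcC => i.
rewrite mxE; case: split_ordP => i' ->.
  rewrite mxE ord1 (_ : lshift m 0 = ord0) //; exact: val_inj.
have := yb i'; rewrite !mxE (_ : rshift 1 i' = lift ord0 i') //; exact: val_inj.
Qed.

Section DetPositive.
Variable R : realType.

Lemma curv_hermE n (F : 'M[Cx R]_n) (v w : 'rV[Cx R]_n) :
  curv_herm F v w = \sum_k (v *m F) 0 k * (w 0 k)^*.
Proof.
rewrite /curv_herm exchange_big /=; apply: eq_bigr => k _.
by rewrite mxE mulr_suml; apply: eq_bigr => j _; rewrite [F j k * _]mulrC.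
Qed.

(** All eigenvalues are positive, and the determinant is their product. *)
Lemma det_positive n (F : 'M[Cx R]_n) :
  (forall v : 'rV[Cx R]_n, v != 0 -> 0 < curv_herm F v v) -> 0 < \det F.
Proof.
move=> Fpos.
have eig (a : Cx R) : eigenvalue F a -> 0 < a.
  move=> /eigenvalueP[v vF v0].
  have h1 := Fpos v v0.
  have E : curv_herm F v v = a * \sum_k v 0 k * (v 0 k)^*.
    rewrite curv_hermE vF mulr_sumr; apply: eq_bigr => k _.
    by rewrite mxE mulrA.
  have s0 : 0 <= \sum_k v 0 k * (v 0 k)^* by apply: sumr_ge0 => k _; exact: mul_conjC_ge0.
  have s1 : \sum_k v 0 k * (v 0 k)^* != 0.
    by apply: contraTneq h1 => s00; rewrite E s00 mulr0 ltxx.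
  move: h1; rewrite E pmulr_lgt0 // lt_neqAle eq_sym s1 s0 //.
have [rs Hrs] := closed_field_poly_normal (char_poly F).
have mon := char_poly_monic F.
rewrite (monicP mon) scale1r in Hrs.
have sz : size rs = n by have := size_char_poly F; rewrite Hrs size_prod_XsubC => -[].
have rs0 a : a \in rs -> 0 < a.
  move=> ars; apply: eig; rewrite eigenvalue_root_char Hrs root_prod_XsubC //.
have : (char_poly F)`_0 = (-1) ^+ n * \det F by rewrite char_poly_det.
rewrite Hrs -horner_coef0 horner_prod.
have -> : \prod_(z <- rs) ('X - z%:P).[0] = (-1) ^+ n * \prod_(z <- rs) z.
  rewrite -sz; elim: rs {Hrs sz rs0} => [|z s IH]; first by rewrite !big_nil mulr1.
  by rewrite !big_cons IH hornerXsubC sub0r /= exprS; ring.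
move=> /(mulfI _) <-; last by rewrite signr_eq0.
by rewrite big_seq; apply: prodr_gt0 => z /rs0.
Qed.

End DetPositive.

(** * Directional derivatives *)

Lemma cvg_rowP (T : topologicalType) n (X : Type) (F : set_system X) {FF : Filter F}
    (f : X -> 'rV[T]_n) (l : 'rV[T]_n) :
  f @ F --> l <-> forall j, (fun x => f x 0 j) @ F --> l 0 j.
Proof.
split=> [H j P Pl|H P [Q Ql QP]].
  apply: (H [set v | P (v 0 j)]).
  exists (fun _ j' => if j' == j then P else setT).
    by move=> i j'; rewrite ord1; case: eqVneq => [->//|_]; exact: filterT.
  by move=> v /(_ 0 j); rewrite eqxx.
have : \forall x \near F, forall j, Q 0 j (f x 0 j).
  by apply: filter_forall => j; apply: H; exact: Ql.
by apply: filterS => x Hx; apply: QP => i j; rewrite ord1.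
Qed.

Section Lines.
Variables (K : numFieldType) (V W : normedModType K).

Lemma derivable_lineP (f : V -> W) (x v : V) (t : K) :
  derivable f (t *: v + x) v <-> derivable (fun h : K => f (h *: v + x)) t 1.
Proof.
rewrite /derivable; set g1 := fun h => h^-1 *: _; set g2 := fun h => h^-1 *: _.
suff -> : g1 = g2 by [].
by rewrite funeqE /g1 /g2 => h /=; rewrite [_%:A]mulr1 scalerDl addrA.
Qed.

Lemma derive_line (f : V -> W) (x v : V) (t : K) :
  'D_v f (t *: v + x) = 'D_1 (fun h : K => f (h *: v + x)) t.
Proof.
rewrite /derive; set g1 := fun h => h^-1 *: _; set g2 := fun h => h^-1 *: _.
suff -> : g1 = g2 by [].
by rewrite funeqE /g1 /g2 => h /=; rewrite [_%:A]mulr1 scalerDl addrA.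
Qed.

End Lines.

Section C1Functions.
Variables (R : realType) (m : nat).
Implicit Types (f : 'rV[R]_m -> R) (U : set 'rV[R]_m) (x v w : 'rV[R]_m).

Lemma is_derive_line f x v (t : R) :
  derivable (f : _ -> R^o) (t *: v + x) v ->
  is_derive t (1 : R) (fun h : R => f (h *: v + x)) ('D_v (f : _ -> R^o) (t *: v + x)).
Proof.
by move=> /derivable_lineP df; rewrite derive_line; exact: (derivableP (df : derivable (_ : R -> R^o) t 1)).
Qed.

Lemma is_derive_line0 f x v : derivable (f : _ -> R^o) x v ->
  is_derive (0 : R) (1 : R) (fun h : R => f (h *: v + x)) ('D_v (f : _ -> R^o) x).
Proof. by move=> df; have := @is_derive_line f x v 0; rewrite scale0r add0r; apply. Qed.

Lemma is_derive_of_line f x v (l : R) :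
  is_derive (0 : R) (1 : R) (fun h : R => f (h *: v + x)) l ->
  is_derive x v (f : _ -> R^o) l.
Proof.
move=> [df dl]; have := derivable_lineP (f : _ -> R^o) x v 0; have := derive_line (f : _ -> R^o) x v 0.
rewrite scale0r add0r dl => <- [_ H]; apply: derivableP; exact: H.
Qed.

Lemma derive_scale (f : 'rV[R]_m -> R) x v (c : R) : derivable (f : _ -> R^o) x v ->
  derivable (f : _ -> R^o) x (c *: v) /\
  'D_(c *: v) (f : _ -> R^o) x = c * 'D_v (f : _ -> R^o) x.
Proof.
move=> df.
have d1 : is_derive ((fun h : R => c * h) 0) (1 : R) (fun h : R => f (h *: v + x)) ('D_v (f : _ -> R^o) x).
  by rewrite /= mulr0; exact: is_derive_line0.
have d2 : is_derive (0 : R) (1 : R) (fun h : R => c * h) c.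
  have -> : (fun h : R => c * h) = c *: (id : R -> R) by [].
  by apply: is_derive_eq; rewrite /GRing.scale /= mulr1.
have [d3 e3] := @is_derive1_comp R (fun h : R => f (h *: v + x)) (fun h => c * h) 0 _ _ d1 d2.
have E : (fun h : R => f (h *: v + x)) \o (fun h => c * h) = (fun h : R => f (h *: (c *: v) + x)).
  by apply/funext => h /=; rewrite scalerA mulrC.
rewrite E in d3 e3.
have d4 : is_derive (0 : R) (1 : R) (fun h : R => f (h *: (c *: v) + x)) (c * 'D_v (f : _ -> R^o) x).
  by split=> //; rewrite e3 mulrC.
by have [] := is_derive_of_line d4.
Qed.

(** The one-sided difference quotient in the direction v + w splits into two
    steps; the second one starts at a moving point, whence the hypotheses on a
    neighbourhood for the direction w. *)
Lemma derive_add (f : 'rV[R]_m -> R) x v w :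
  (\forall y \near x, derivable (f : _ -> R^o) y w) ->
  {for x, continuous (fun y => 'D_w (f : _ -> R^o) y : R)} ->
  derivable (f : _ -> R^o) x v -> derivable (f : _ -> R^o) x (v + w) ->
  'D_(v + w) (f : _ -> R^o) x = 'D_v (f : _ -> R^o) x + 'D_w (f : _ -> R^o) x.
Proof.
have aux (a b c X Y t : R) : `|b - Y| <= t / 3 -> `|a - (X + Y)| <= t / 3 -> `|c - X| <= t / 3 ->
    `|a - (b + c)| <= t.
  rewrite !ler_norml => /andP[? ?] /andP[? ?] /andP[? ?]; apply/andP; split; lra.
move=> dw cw dv dvw; apply/eqP; rewrite -subr_eq0 -normr_eq0; apply/eqP.
apply/eqP; rewrite eq_le normr_ge0 andbT; apply/ler_addgt0Pl => e e0; rewrite addr0.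
have e30 : 0 < e / 3 by lra.
have L u (du : derivable (f : _ -> R^o) x u) : \forall h \near (0 : R)^'+,
    `|'D_u (f : _ -> R^o) x - h^-1 * (f (h *: u + x) - f x)| <= e / 3.
  have := cvg_dnbhs_at_right du.
  by move/cvgrPdist_le/(_ _ e30).
have Lv := L _ dv. have Lvw := L _ dvw.
have N : \forall y \near x, derivable (f : _ -> R^o) y w /\
    `|'D_w (f : _ -> R^o) x - 'D_w (f : _ -> R^o) y| <= e / 3.
  apply: filterI dw _.
  by move/cvgrPdist_le/(_ _ e30) : cw.
have [d /= d0 Hd] := (nbhs_ballP _ _).1 N.
have dd0 : 0 < d / (`|v| + `|w| + 1) by rewrite divr_gt0 // ltr_wpDl // addr_ge0.
near (0 : R)^'+ => h.
have h0 : 0 < h by near: h; exact: nbhs_right_gt.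
have hd : h < d / (`|v| + `|w| + 1) by near: h; exact: nbhs_right_lt.
have k1 : `|'D_v (f : _ -> R^o) x - h^-1 * (f (h *: v + x) - f x)| <= e / 3 by near: h.
have k2 : `|'D_(v + w) (f : _ -> R^o) x - h^-1 * (f (h *: (v + w) + x) - f x)| <= e / 3 by near: h.
have inball s : 0 <= s <= h -> ball x d (s *: w + (h *: v + x)).
  move=> /andP[s0 sh]; rewrite -ball_normE /=.
  have -> : x - (s *: w + (h *: v + x)) = - (s *: w) - h *: v.
    by rewrite addrA opprD addrCA subrr addr0 opprD.
  rewrite (le_lt_trans (ler_normD _ _)) //.
  rewrite !normrN !normrZ !ger0_norm // ?ltW //.
  move: hd; rewrite ltr_pdivlMr; last by rewrite ltr_wpDl // addr_ge0.
  apply: le_lt_trans; rewrite !mulrDr mulr1.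
  have : s * `|w| <= h * `|w| by rewrite ler_wpM2r.
  lra.
have [s sh E] := @MVT_is_derive R (fun s : R => f (s *: w + (h *: v + x)))
   (fun s => 'D_w (f : _ -> R^o) (s *: w + (h *: v + x))) 0 h (ltW h0)
   (fun s hs => is_derive_line (Hd _ (inball s hs)).1).
have [_ k3] := Hd _ (inball s sh).
move: E; rewrite scale0r add0r subr0 => E.
have Q : h^-1 * (f (h *: (v + w) + x) - f x) =
    'D_w (f : _ -> R^o) (s *: w + (h *: v + x)) + h^-1 * (f (h *: v + x) - f x).
  have -> : f (h *: (v + w) + x) = f (h *: w + (h *: v + x)).
    by congr (f _); rewrite scalerDr addrA (addrC (h *: w)).
  have -> : f (h *: w + (h *: v + x)) - f x =
     (f (h *: w + (h *: v + x)) - f (h *: v + x)) + (f (h *: v + x) - f x) by ring.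
  by rewrite E; field; rewrite gt_eqF.
rewrite Q in k2; move: k1 k2 k3.
exact: aux.
Unshelve. all: end_near. Qed.

(** Directional derivatives are only known to be additive for functions of
    class C1 ([derive_add]). *)
Lemma derive_sum_delta (f : 'rV[R]_m -> R) (U : set 'rV[R]_m) x v :
  open U -> Ck (W := R^o) 1 U f -> U x ->
  'D_v (f : _ -> R^o) x = \sum_i v 0 i * 'D_(delta_mx 0 i) (f : _ -> R^o) x.
Proof.
move=> oU [df cf] Ux.
have dD v' w' : 'D_(v' + w') (f : _ -> R^o) x = 'D_v' (f : _ -> R^o) x + 'D_w' (f : _ -> R^o) x.
  apply: derive_add; try exact: df.
    by apply: filterS (open_nbhs_nbhs (conj oU Ux)) => y Uy; exact: df.
  exact: cf.
rewrite {1}(row_sum_delta v).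
elim/big_ind2: _ => [|v1 r1 v2 r2 <- <-|i _]; [by rewrite derive0|by rewrite dD|].
by have [] := derive_scale (v 0 i) (df (delta_mx 0 i) x Ux).
Qed.

Lemma derive_ln_comp (f : 'rV[R]_m -> R) x v : 0 < f x -> derivable (f : _ -> R^o) x v ->
  derivable ((fun y => ln (f y)) : _ -> R^o) x v /\
  'D_v ((fun y => ln (f y)) : _ -> R^o) x = 'D_v (f : _ -> R^o) x / f x.
Proof.
move=> fx df.
have d1 := is_derive_line0 df.
have d2 : is_derive ((fun h : R => f (h *: v + x)) 0) (1 : R) (@ln R) (f x)^-1.
  by rewrite /= scale0r add0r; exact: is_derive1_ln.
have [d3 e3] := @is_derive1_comp R (@ln R) (fun h => f (h *: v + x)) 0 _ _ d2 d1.
have d4 : is_derive (0 : R) (1 : R) (fun h : R => ln (f (h *: v + x))) ('D_v (f : _ -> R^o) x / f x).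
  by split=> //; rewrite e3 mulrC.
by have [] := is_derive_of_line (f := fun y => ln (f y)) d4.
Qed.

End C1Functions.

Lemma cvg_near_eq (X : Type) (T : topologicalType) (F : set_system X) {FF : Filter F}
    (f g : X -> T) (l : T) :
  (\forall x \near F, f x = g x) -> g @ F --> l -> f @ F --> l.
Proof. by move=> E; apply: cvg_trans; apply: near_eq_cvg; apply: filterS E. Qed.

Lemma cvg_seq_sum (K : numFieldType) (X : Type) (F : set_system X) {FF : Filter F}
    (I : Type) (r : seq I) (P : pred I) (f : I -> X -> K) (l : I -> K) :
  (forall i, P i -> f i @ F --> l i) ->
  (fun x => \sum_(i <- r | P i) f i x) @ F --> \sum_(i <- r | P i) l i.
Proof.
move=> H; elim: r => [|i r IH].
  rewrite big_nil; under eq_fun do rewrite big_nil; exact: cvg_cst.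
rewrite big_cons; under eq_fun do rewrite big_cons.
by case: ifP => // Pi; apply: cvgD => //; exact: H.
Qed.

Lemma cvg_seq_prod (K : numFieldType) (X : Type) (F : set_system X) {FF : Filter F}
    (I : Type) (r : seq I) (P : pred I) (f : I -> X -> K) (l : I -> K) :
  (forall i, P i -> f i @ F --> l i) ->
  (fun x => \prod_(i <- r | P i) f i x) @ F --> \prod_(i <- r | P i) l i.
Proof.
move=> H; elim: r => [|i r IH].
  rewrite big_nil; under eq_fun do rewrite big_nil; exact: cvg_cst.
rewrite big_cons; under eq_fun do rewrite big_cons.
by case: ifP => // Pi; apply: cvgM => //; exact: H.
Qed.

Lemma cvg_det (K : numFieldType) (X : Type) (F : set_system X) {FF : Filter F} n
    (f : X -> 'M[K]_n) (l : 'M[K]_n) :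
  (forall i j, (fun x => f x i j) @ F --> l i j) ->
  (fun x => \det (f x)) @ F --> \det l.
Proof.
move=> H; rewrite /determinant; apply: cvg_seq_sum => s _.
by apply: cvgM; [exact: cvg_cst|apply: cvg_seq_prod => i _; exact: H].
Qed.

Section LogDerivatives.
Variables (R : realType) (m : nat) (U : set 'rV[R]_m) (f : 'rV[R]_m -> R).
Hypotheses (oU : open U) (sf : smooth_on (W := R^o) U f) (f0 : forall x, U x -> 0 < f x).

Lemma smooth_derivable x v : U x -> derivable (f : _ -> R^o) x v.
Proof. by move=> Ux; have [H _] := sf 1%N; exact: H. Qed.

Lemma smooth_continuous x : U x -> {for x, continuous f}.
Proof. by move=> Ux; exact: (sf 0%N). Qed.

Lemma smooth_derive v : smooth_on (W := R^o) U (fun x => 'D_v (f : _ -> R^o) x).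
Proof. by move=> k; have [_ H] := sf k.+1; exact: H. Qed.

Lemma derive_lnE x v : U x ->
  'D_v ((fun y => ln (f y)) : _ -> R^o) x = 'D_v (f : _ -> R^o) x / f x.
Proof. by move=> Ux; apply: (derive_ln_comp _ _).2; [exact: f0|exact: smooth_derivable]. Qed.

End LogDerivatives.

Section LogSecondDerivatives.
Variables (R : realType) (m : nat) (U : set 'rV[R]_m) (f : 'rV[R]_m -> R).
Hypotheses (oU : open U) (sf : smooth_on (W := R^o) U f) (f0 : forall x, U x -> 0 < f x).

Lemma derive_ln2E x v w : U x ->
  'D_v ((fun z => 'D_w ((fun y => ln (f y)) : _ -> R^o) z) : _ -> R^o) x =
  'D_w (f : _ -> R^o) x * - ((f x)^-1 ^+ 2 * 'D_v (f : _ -> R^o) x)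
  + (f x)^-1 * 'D_v ((fun z => 'D_w (f : _ -> R^o) z) : _ -> R^o) x.
Proof.
move=> Ux.
have E : \forall z \near x, 'D_w ((fun y => ln (f y)) : _ -> R^o) z =
    ((fun y => 'D_w (f : _ -> R^o) y) * (fun y => (f y)^-1) : _ -> R^o) z.
  apply: filterS (open_nbhs_nbhs (conj oU Ux)) => z Uz; exact: derive_lnE.
rewrite (near_eq_derive v E).
have d1 : derivable (f : _ -> R^o) x v := smooth_derivable sf Ux.
have d2 : derivable ((fun z => 'D_w (f : _ -> R^o) z) : _ -> R^o) x v := smooth_derivable (smooth_derive sf w) Ux.
have fx : f x != 0 by rewrite gt_eqF // f0.
rewrite (deriveM d2 (derivableV fx d1)) (deriveV fx d1) /GRing.scale /= exprVn.
by congr (_ * _ + _); rewrite mulNr.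
Qed.

(** These second derivatives are the entries of the curvature. *)
Lemma derive_ln2_continuous x v w : U x ->
  {for x, continuous (fun t =>
    'D_v ((fun z => 'D_w ((fun y => ln (f y)) : _ -> R^o) z) : _ -> R^o) t : R)}.
Proof.
move=> Ux.
have fx : f x != 0 by rewrite gt_eqF // f0.
have cf := smooth_continuous sf Ux.
have cw := smooth_continuous (smooth_derive sf w) Ux.
have cv := smooth_continuous (smooth_derive sf v) Ux.
have cvw := smooth_continuous (smooth_derive (smooth_derive sf w) v) Ux.
have ci : {for x, continuous (fun y => (f y)^-1)} by exact: (cvgV fx cf).
have H : 'D_w (f : _ -> R^o) t * - ((f t)^-1 * (f t)^-1 * 'D_v (f : _ -> R^o) t)
  + (f t)^-1 * 'D_v ((fun z => 'D_w (f : _ -> R^o) z) : _ -> R^o) t @[t --> x] -->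
  'D_w (f : _ -> R^o) x * - ((f x)^-1 * (f x)^-1 * 'D_v (f : _ -> R^o) x)
  + (f x)^-1 * 'D_v ((fun z => 'D_w (f : _ -> R^o) z) : _ -> R^o) x.
  exact: (cvgD (cvgM cw (cvgN (cvgM (cvgM ci ci) cv))) (cvgM ci cvw)).
have {}H : 'D_v ((fun z => 'D_w ((fun y => ln (f y)) : _ -> R^o) z) : _ -> R^o) t @[t --> x] -->
  'D_v ((fun z => 'D_w ((fun y => ln (f y)) : _ -> R^o) z) : _ -> R^o) x.
  rewrite derive_ln2E // expr2; apply: (cvg_near_eq _ H).
  by apply: filterS (open_nbhs_nbhs (conj oU Ux)) => z Uz; rewrite derive_ln2E // expr2.
exact: H.
Qed.

End LogSecondDerivatives.

Section RealCoordinates.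
Variables (R : realType) (n : nat).

Lemma to_realK : cancel (@to_real R n) (@of_real R n).
Proof.
by move=> z; apply/rowP => j; rewrite mxE row_mxEl row_mxEr !mxE mkCE.
Qed.

Lemma of_realK : cancel (@of_real R n) (@to_real R n).
Proof.
move=> x; apply/rowP => j; rewrite mxE; case: split_ordP => k ->; rewrite !mxE //.
Qed.

Lemma of_real_continuous : continuous (@of_real R n).
Proof.
move=> x; suff : @of_real R n @ nbhs x --> of_real x by [].
apply/cvg_rowP => j; apply/cvgC_split; split.
  under eq_fun do rewrite mxE; rewrite mxE /=; exact: coord_continuous.
under eq_fun do rewrite mxE; rewrite mxE /=; exact: coord_continuous.
Qed.

Lemma of_realD (x y : 'rV[R]_(n + n)) : of_real (x + y) = of_real x + of_real y.
Proof. by apply/rowP => j; rewrite !mxE. Qed.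

Lemma of_realZ (t : R) (x : 'rV[R]_(n + n)) : of_real (t *: x) = (t%:C)%C *: of_real x.
Proof.
apply/rowP => j; rewrite !mxE; apply: Cx_eq.
  by rewrite reCM reCR imCR mul0r subr0.
by rewrite imCM reCR imCR mul0r addr0.
Qed.

End RealCoordinates.

(** * Sections in charts and frames *)

Section Coordinates.
Variables (R : realType) (n : nat) (M : ptopologicalType) (AM : set (chart M 'rV[Cx R]_n)).
Variables (fr : frame_family R M) (hL : M -> R).
Hypotheses (HA : is_atlas AM) (HL : line_bundle AM fr) (HhL : hermitian_metric AM fr hL).
Variables (c : chart M 'rV[Cx R]_n) (U : set M) (e : M -> Cx R).
Hypotheses (Ac : AM c) (fU : fr (U, e)).

Definition coord_dom : set 'rV[R]_(n + n) := cmap (real_chart c) @` (cdom c `&` U).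
Definition ccoord_dom : set 'rV[Cx R]_n := cmap c @` (cdom c `&` U).
Local Notation psi := (cinv (real_chart c)).

Definition frame_norm (x : 'rV[R]_(n + n)) : R := sqmod (e (psi x)) * hL (psi x).
Definition frame_fun k (s : M -> Cx R) (z : 'rV[Cx R]_n) : Cx R :=
  s (cinv c z) / e (cinv c z) ^+ k.

Let chartc : chart_axiom c. Proof. by have [H _] := HA; exact: H. Qed.
Let openU : open U. Proof. by have [H _ _] := HL; have [] := H _ _ fU. Qed.

Lemma frame_neq0 q : U q -> e q != 0.
Proof. by have [H _ _] := HL; have [_] := H _ _ fU; apply. Qed.

Lemma open_ccoord_dom : open ccoord_dom.
Proof.
have [oc oic cK cc ci] := chartc.
rewrite openE => _ [q [cq Uq] <-].
have im : (cmap c @` cdom c) (cmap c q) by exists q.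
have N1 : \forall z \near cmap c q, (cmap c @` cdom c) z.
  exact: (open_nbhs_nbhs (conj oic im)).
have N2 : \forall z \near cmap c q, U (cinv c z).
  apply: (ci _ im); rewrite cK //; exact: (open_nbhs_nbhs (conj openU Uq)).
rewrite /interior /=; near=> z.
have [q' cq' Eq'] : (cmap c @` cdom c) z by near: z.
exists q' => //; split => //.
have : U (cinv c z) by near: z.
by rewrite -Eq' cK.
Unshelve. all: end_near. Qed.

Lemma coord_domP x : coord_dom x <-> ccoord_dom (of_real x).
Proof.
split=> [[q [cq Uq] <-]|[q [cq Uq] Eq]]; first by exists q => //=; rewrite to_realK.
by exists q => //=; rewrite Eq of_realK.
Qed.

Lemma open_coord_dom : open coord_dom.
Proof.
have -> : coord_dom = @of_real R n @^-1` ccoord_dom.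
  by apply/seteqP; split=> x /coord_domP.
by apply: open_comp open_ccoord_dom => x _; exact: of_real_continuous.
Qed.

Lemma near_coord_dom x : coord_dom x -> \forall y \near x, coord_dom y.
Proof. by move=> Dx; exact: (open_nbhs_nbhs (conj open_coord_dom Dx)). Qed.

Lemma coord_psi x : coord_dom x ->
  [/\ cdom c (psi x), U (psi x) & cmap (real_chart c) (psi x) = x].
Proof.
have [_ _ cK _ _] := chartc.
by move=> [q [cq Uq] <-] /=; rewrite to_realK cK.
Qed.

Lemma coord_cmap q : cdom c q -> U q -> coord_dom (cmap (real_chart c) q).
Proof. by move=> cq Uq; exists q. Qed.

Lemma psi_cmap q : cdom c q -> psi (cmap (real_chart c) q) = q.
Proof. by have [_ _ cK _ _] := chartc => cq /=; rewrite to_realK cK. Qed.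

Lemma cmap_ccontinuous q : cdom c q -> {for q, continuous (cmap c)}.
Proof. by have [_ _ _ cc _] := chartc; exact: cc. Qed.

Lemma cmap_continuous q : cdom c q -> {for q, continuous (cmap (real_chart c))}.
Proof.
move=> cq; suff : cmap (real_chart c) @ nbhs q --> cmap (real_chart c) q by [].
have H : cmap c @ nbhs q --> cmap c q := cmap_ccontinuous cq.
move/cvg_rowP in H; apply/cvg_rowP => j.
case: (split_ordP j) => i ->.
  under eq_fun do rewrite /= row_mxEl mxE.
  by rewrite /= row_mxEl mxE; apply: cvgC_re.
under eq_fun do rewrite /= row_mxEr mxE.
by rewrite /= row_mxEr mxE; apply: cvgC_im.
Qed.

Lemma near_chart q : cdom c q -> U q -> \forall q' \near q, cdom c q' /\ U q'.
Proof.
have [oc _ _ _ _] := chartc => cq Uq.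
by apply: filterI; [exact: (open_nbhs_nbhs (conj oc cq))|exact: (open_nbhs_nbhs (conj openU Uq))].
Qed.

Lemma frame_norm_smooth : smooth_on (W := R^o) coord_dom frame_norm.
Proof. by have [_ H] := HhL; have := H _ _ fU (real_chart c); apply; exists c. Qed.

Lemma frame_norm_gt0 x : coord_dom x -> 0 < frame_norm x.
Proof.
move=> /coord_psi[_ Ux _]; have [H _] := HhL.
by rewrite /frame_norm mulr_gt0 // sqmod_gt0 frame_neq0.
Qed.

Lemma norm2_ge0 k s q : 0 <= norm2 hL k s q.
Proof. by rewrite /norm2 mulr_ge0 ?sqmod_ge0 // exprn_ge0 // ltW //; have [h _] := HhL; exact: h. Qed.

Lemma frame_norm_continuous x : coord_dom x -> {for x, continuous frame_norm}.
Proof. by move=> Dx; exact: (smooth_continuous frame_norm_smooth Dx). Qed.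

Lemma frame_fun_differentiable k s z : holo_section AM fr k s -> ccoord_dom z ->
  differentiable (frame_fun k s : _ -> (Cx R)^o) z.
Proof. by move=> Hs Dz; have := Hs _ _ fU _ Ac _ Dz. Qed.

Lemma frame_fun_continuous k s z : holo_section AM fr k s -> ccoord_dom z ->
  {for z, continuous (frame_fun k s)}.
Proof. by move=> Hs Dz; exact: (differentiable_continuous (frame_fun_differentiable Hs Dz)). Qed.

Lemma frame_funE k s q : cdom c q -> U q -> s q = frame_fun k s (cmap c q) * e q ^+ k.
Proof.
have [_ _ cK _ _] := chartc => cq Uq.
by rewrite /frame_fun cK // mulfVK // expf_neq0 // frame_neq0.
Qed.

Lemma norm2_frame k s q : cdom c q -> U q ->
  norm2 hL k s q = sqmod (frame_fun k s (cmap c q)) * frame_norm (cmap (real_chart c) q) ^+ k.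
Proof.
move=> cq Uq; rewrite /norm2 /frame_norm psi_cmap // {1}(frame_funE k s cq Uq).
by rewrite sqmodM sqmodX exprMn mulrA.
Qed.

Lemma hprod_frame k s t q : cdom c q -> U q ->
  s q * (t q)^* * ((hL q ^+ k)%:C)%C =
  frame_fun k s (cmap c q) * (frame_fun k t (cmap c q))^* *
   ((frame_norm (cmap (real_chart c) q) ^+ k)%:C)%C.
Proof.
move=> cq Uq; rewrite /frame_norm psi_cmap // {1}(frame_funE k s cq Uq) {1}(frame_funE k t cq Uq).
have -> : ((sqmod (e q) * hL q) ^+ k)%:C%C = (e q ^+ k * (e q ^+ k)^* ) * ((hL q ^+ k)%:C)%C :> Cx R.
  by rewrite conj_sqmod sqmodX exprMn rmorphM.
by rewrite rmorphM /=; ring.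
Qed.

(** The functions s and t themselves are in general discontinuous: they are
    values in a set-theoretic trivialisation. *)
Lemma hprod_continuous_at k s t q : holo_section AM fr k s -> holo_section AM fr k t ->
  cdom c q -> U q ->
  (s q' * (t q')^* * ((hL q' ^+ k)%:C)%C) @[q' --> q] --> s q * (t q)^* * ((hL q ^+ k)%:C)%C.
Proof.
move=> Hs Ht cq Uq.
have Dq : ccoord_dom (cmap c q) by exists q.
have cf s' : holo_section AM fr k s' ->
    frame_fun k s' (cmap c q') @[q' --> q] --> frame_fun k s' (cmap c q).
  move=> Hs'; apply: (@continuous_comp _ _ _ (cmap c) (frame_fun k s') q).
    exact: cmap_ccontinuous.
  exact: frame_fun_continuous.
have cn : frame_norm (cmap (real_chart c) q') @[q' --> q] --> frame_norm (cmap (real_chart c) q).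
  apply: (@continuous_comp _ _ _ (cmap (real_chart c)) frame_norm q).
    exact: cmap_continuous.
  by apply: frame_norm_continuous; exact: coord_cmap.
rewrite (hprod_frame k s t cq Uq).
apply: (@cvg_near_eq _ _ _ _ _ (fun q' => frame_fun k s (cmap c q') * (frame_fun k t (cmap c q'))^* *
   ((frame_norm (cmap (real_chart c) q') ^+ k)%:C)%C)).
  by apply: filterS (near_chart cq Uq) => q' [cq' Uq']; exact: hprod_frame.
have [s1 s2] := (cvgC_split _ _).1 (cf _ Hs).
have [t1 t2] := (cvgC_split _ _).1 (cf _ Ht).
have cX : frame_norm (cmap (real_chart c) q') ^+ k @[q' --> q] --> frame_norm (cmap (real_chart c) q) ^+ k.
  apply: (@continuous_comp _ _ _ (fun q' => frame_norm (cmap (real_chart c) q')) (fun x => x ^+ k) q cn).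
  exact: exprn_continuous.
apply/cvgC_split; split.
  under eq_fun do rewrite reCM reCR imCR mulr0 subr0 reCM reC_conj imC_conj.
  rewrite reCM reCR imCR mulr0 subr0 reCM reC_conj imC_conj.
  exact: (cvgM (cvgB (cvgM s1 t1) (cvgM s2 (cvgN t2))) cX).
under eq_fun do rewrite imCM reCR imCR mulr0 add0r imCM reC_conj imC_conj.
rewrite imCM reCR imCR mulr0 add0r imCM reC_conj imC_conj.
exact: (cvgM (cvgD (cvgM s1 (cvgN t2)) (cvgM s2 t1)) cX).
Qed.

End Coordinates.

(** * The supremum and the square integral of a section *)

Lemma compact_uniform (R : realType) (T : topologicalType) (K : set T) (P : T -> R -> Prop) :
  compact K ->
  (forall x, K x -> exists C : R, \forall y \near x, P y C) ->
  (forall y C C', C <= C' -> P y C -> P y C') ->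
  exists C : R, forall x, K x -> P x C.
Proof.
move=> cK loc mono.
have := (compact_near_coveringP K).1 cK R (pinfty_nbhs R) (fun C x => P x C) _.
case=> [x Kx|M [Mr HM]].
  have [C HC] := loc x Kx.
  exists ([set y | P y C], [set C' | C < C']).
    by split => //=; exists C; split => //; exact: num_real.
  by move=> [y C'] /= [Py CC']; exact: mono (ltW CC') Py.
by exists (M + 1) => x Kx; apply: HM => //; rewrite ltrDl.
Qed.

Lemma rV_norm_le (R : realType) m (x : 'rV[R]_m) (t : R) : 0 <= t ->
  (forall i, `|x 0 i| <= t) -> `|x| <= t.
Proof.
move=> t0 H; rewrite /Num.Def.normr /= mx_normrE (bigmax_le _ t0) // => -[i j] _ /=.
by rewrite ord1.
Qed.

Lemma rV_norm_ge (R : realType) m (x : 'rV[R]_m) i : `|x 0 i| <= `|x|.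
Proof.
rewrite [leRHS]/Num.Def.normr /= mx_normrE.
exact: (le_bigmax _ (fun ij : 'I_1 * 'I_m => `|x ij.1 ij.2|) (0, i)).
Qed.

Lemma compact_box (R : realType) m (a b : 'rV[R]_m) : compact (box a b).
Proof.
have := @rV_compact R m (fun i => `[a 0 i, b 0 i]%classic)
  (fun i => @segment_compact R (a 0 i) (b 0 i)).
congr (compact _); apply/seteqP; split=> x /= H i; have := H i; by rewrite /= in_itv.
Qed.

Section HolomorphicLipschitz.
Variables (R : realType) (n : nat).

Lemma to_real_scale_le (w : Cx R) (v : 'rV[R]_(n + n)) (t : R) : `|v| <= t ->
  `|to_real (w *: of_real v)| <= cabs w * (2 * t).
Proof.
move=> vt.
have t0 : 0 <= t := le_trans (normr_ge0 _) vt.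
have cv j : cabs (of_real v 0 j) <= 2 * t.
  apply: le_trans (cabs_le_sum _) _; rewrite mxE reC_mkC imC_mkC.
  have := le_trans (rV_norm_ge v (lshift n j)) vt.
  have := le_trans (rV_norm_ge v (rshift n j)) vt.
  lra.
have b j : cabs ((w *: of_real v) 0 j) <= cabs w * (2 * t).
  by rewrite mxE cabsM ler_wpM2l ?cabs_ge0.
apply: rV_norm_le; first by rewrite mulr_ge0 ?cabs_ge0 //; lra.
move=> i; case: (split_ordP i) => j ->; rewrite ?row_mxEl ?row_mxEr mxE.
  exact: le_trans (reC_le _) (b j).
exact: le_trans (imC_le _) (b j).
Qed.

(** The one-variable estimate [schwarz_lipschitz] on the complex line through
    the two points. *)
Lemma holomorphic_lipschitz (F : 'rV[Cx R]_n -> Cx R) (x1 y : 'rV[R]_(n + n)) (d t A : R) :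
  0 < t -> 2 * t <= d ->
  (forall x, `|x - x1| <= d -> differentiable (F : _ -> (Cx R)^o) (of_real x)) ->
  (forall x, `|x - x1| <= d -> cabs (F (of_real x)) <= A) ->
  `|y - x1| <= t ->
  cabs (F (of_real y) - F (of_real x1)) <= 4 * A * t / d.
Proof.
move=> t0 td dF FA yt.
have d0 : 0 < d by lra.
pose v := of_real (y - x1).
pose g (w : Cx R) : Cx R := F (w *: v + of_real x1).
have pt w : cabs w <= d / (2 * t) -> exists2 x, w *: v + of_real x1 = of_real x & `|x - x1| <= d.
  move=> wd; exists (to_real (w *: v) + x1); first by rewrite of_realD to_realK.
  rewrite addrK; apply: le_trans (to_real_scale_le w yt) _.
  by rewrite -ler_pdivlMr //; lra.
have r0 : 0 < d / (2 * t) by rewrite divr_gt0 //; lra.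
have c1 : cabs (1 : Cx R) <= d / (2 * t) by rewrite cabs1 ler_pdivlMr ?mul1r //; lra.
have := @schwarz_lipschitz R g (d / (2 * t)) A r0 _ _ 1 c1.
have -> : g 0 = F (of_real x1) by rewrite /g scale0r add0r.
have -> : g 1 = F (of_real y) by rewrite /g scale1r -of_realD subrK.
rewrite cabs1 mulr1.
have -> : 2 * A / (d / (2 * t)) = 4 * A * t / d by field; rewrite !gt_eqF.
apply.
  move=> w /pt[x Ex xd]; apply: (derivable_lineP (F : _ -> (Cx R)^o) (of_real x1) v w).1.
  by rewrite Ex; apply: diff_derivable; exact: dF.
by move=> w /pt[x Ex xd]; rewrite /g Ex; exact: FA.
Qed.

End HolomorphicLipschitz.

Section SupL2.
Variables (R : realType) (n : nat) (M : ptopologicalType) (AM : set (chart M 'rV[Cx R]_n)).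
Variables (fr : frame_family R M) (hL : M -> R).
Hypotheses (HM : projective_manifold AM) (HL : line_bundle AM fr).
Hypotheses (HhL : hermitian_metric AM fr hL) (HOmega : kahler_curvature AM fr hL).
Variable (vol : {measure set (g_sigma_algebraType (@open M)) -> \bar R}).
Hypothesis (Hvol : volume_measure AM fr hL vol).

Let HA : is_atlas AM. Proof. by have [[_ H _] _ _] := HM. Qed.
Let hausM : hausdorff_space M. Proof. by have [[H _ _] _ _] := HM. Qed.
Let cM : compact [set: M]. Proof. by have [_ H _] := HM. Qed.

Lemma closed_measurable_open (A : set M) : closed A ->
  measurable (A : set (g_sigma_algebraType (@open M))).
Proof.
move=> cA; rewrite -[A]setCK; apply: measurableC.
by apply: sub_sigma_algebra; exact: closed_openC.
Qed.

Section Local.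
Variables (c : chart M 'rV[Cx R]_n) (U : set M) (e : M -> Cx R) (p : M).
Hypotheses (Ac : AM c) (fU : fr (U, e)) (cp : cdom c p) (Up : U p).
Local Notation psi := (cinv (real_chart c)).
Local Notation x0 := (cmap (real_chart c) p).
Local Notation D := (coord_dom c U).
Local Notation H := (frame_norm hL c e).

Let Dx0 : D x0. Proof. exact: coord_cmap. Qed.

Let density (x : 'rV[R]_(n + n)) : R := reC (\det (curvature c e hL x)) / pi ^+ n.

Let density_continuous : {for x0, continuous density}.
Proof.
have cvgdet : \det (curvature c e hL x) @[x --> x0] --> \det (curvature c e hL x0).
  apply: (@cvg_det _ _ (nbhs x0) (nbhs_filter x0)) => i j.
  apply/(@cvgC_split _ _ (nbhs x0) (nbhs_filter x0)).
  have cd v w := derive_ln2_continuous (open_coord_dom HA HL Ac fU)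
    (frame_norm_smooth HhL Ac fU) (fun x Dx => frame_norm_gt0 HA HL HhL Ac fU Dx) (v := v) (w := w) Dx0.
  have c1 : ddx i (ddx j (log_norm c e hL)) x @[x --> x0] --> ddx i (ddx j (log_norm c e hL)) x0.
    exact: cd.
  have c2 : ddy i (ddy j (log_norm c e hL)) x @[x --> x0] --> ddy i (ddy j (log_norm c e hL)) x0.
    exact: cd.
  have c3 : ddx i (ddy j (log_norm c e hL)) x @[x --> x0] --> ddx i (ddy j (log_norm c e hL)) x0.
    exact: cd.
  have c4 : ddy i (ddx j (log_norm c e hL)) x @[x --> x0] --> ddy i (ddx j (log_norm c e hL)) x0.
    exact: cd.
  rewrite /curvature; split.
    under eq_fun do rewrite mxE reCN reC_mkC.
    rewrite mxE reCN reC_mkC.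
    have H5 := cvgN (cvgM (cvgD c1 c2) (cvg_cst (4^-1 : R))).
    exact: H5.
  under eq_fun do rewrite mxE imCN imC_mkC.
  rewrite mxE imCN imC_mkC.
  have H5 := cvgN (cvgM (cvgB c3 c4) (cvg_cst (4^-1 : R))).
  exact: H5.
exact: (cvgM (cvgC_re cvgdet) (cvg_cst ((pi ^+ n)^-1 : R))).
Qed.

Let density_gt0 : 0 < density x0.
Proof.
rewrite divr_gt0 ?exprn_gt0 ?pi_gt0 //.
have := det_positive (fun v v0 => HOmega fU Ac Up cp v0).
by rewrite [X in is_true X -> _]ltcE => /andP[].
Qed.

(** The volume density is continuous and positive at p, hence small boxes have
    volume at least kappa times the Euclidean one.  The factor 2t is the side of the
    box. *)
Lemma chart_ball : exists del kappa : R, [/\ 0 < del, 0 < kappa,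
  forall x, `|x - x0| <= del -> D x &
  forall x1 t, `|x1 - x0| <= del / 2 -> 0 <= t <= del / 2 ->
    (((kappa * (2 * t) ^+ (n + n))%:E <=
      vol (psi @` box (x1 - const_mx t) (x1 + const_mx t)))%E /\
    measurable (psi @` box (x1 - const_mx t) (x1 + const_mx t) : set (g_sigma_algebraType (@open M))))].
Proof.
have := density_gt0; set a0 := density x0 => a00.
have N : \forall x \near x0, D x /\ a0 / 2 <= density x <= 2 * a0.
  apply: filterI; first exact: (near_coord_dom HA HL Ac fU).
  have h1 : a0 / 2 < a0 by lra.
  have h2 : a0 < 2 * a0 by lra.
  near=> x; apply/andP; split; apply: ltW; near: x.
    exact: cvgr_gt density_continuous _ h1.
  exact: cvgr_lt density_continuous _ h2.
have [del /= del0 Hdel] := (nbhs_ballP _ _).1 N.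
have inb x : `|x - x0| <= del / 2 -> D x /\ a0 / 2 <= density x <= 2 * a0.
  by move=> xd; apply: Hdel; rewrite -ball_normE /= distrC; lra.
exists (del / 2), (a0 / 2); split; [lra|lra|by move=> x /inb[]|].
move=> x1 t x1d /andP[t0 td].
set a := x1 - const_mx t; set b := x1 + const_mx t.
have bx x : box a b x -> `|x - x0| <= del / 2.
  move=> xb; have : `|x - x1| <= t.
    by apply: rV_norm_le => // i; have := xb i; rewrite !mxE ler_norml; lra.
  have -> : x - x0 = (x - x1) + (x1 - x0) by rewrite addrA subrK.
  move=> xt; apply: le_trans (ler_normD _ _) _; lra.
have ab i : a 0 i <= b 0 i by rewrite !mxE; lra.
have bD : box a b `<=` D by move=> x /bx /inb[].
split.
  rewrite (Hvol fU Ac ab bD) lee_fin.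
  have a20 : 0 <= a0 / 2 by lra.
  have /andP[+ _] := box_integral_bounds ab a20 (fun x xb => (inb x (bx x xb)).2).
  apply: le_trans; rewrite (eq_bigr (fun=> 2 * t)); last by move=> i _; rewrite !mxE; ring.
  by rewrite prodr_const card_ord.
apply: closed_measurable_open; apply: compact_closed => //.
apply: continuous_compact; last exact: compact_box.
apply: continuous_in_subspaceT => x /set_mem /bD Dx.
have [_ _ _ _ ci] := HA.1 c Ac.
apply: (@continuous_comp _ _ _ (@of_real R n) (cinv c) x); first exact: of_real_continuous.
by apply: ci; have [q [cq _] E] := (coord_domP c U x).1 Dx; exists q.
Unshelve. all: end_near. Qed.

(** The estimate at a point q where |s|^2 is maximal: the frame function F is
    then bounded near q by theta^(-k) |F(q)|, because H oscillates by less than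
    theta^2; so |F| >= |F(q)| / 2 on a ball of radius proportional to theta^k.
    The powers of theta are 2k for H^k and 2nk for the volume of the ball. *)
Lemma sup_L2_local (theta : R) : 0 < theta < 1 ->
  exists kappa, 0 < kappa /\ \forall q \near p, forall k s, holo_section AM fr k s ->
    (forall q', norm2 hL k s q' <= norm2 hL k s q) ->
    ((kappa * (norm2 hL k s q * theta ^+ ((n + n).+2 * k)))%:E <=
       \int[vol]_x (norm2 hL k s x)%:E)%E.
Proof.
move=> /andP[th0 th1].
have [del [kappa [del0 kappa0 ballD Hv]]] := chart_ball.
have th20 : 0 < theta ^+ 2 by rewrite exprn_gt0.
have th21 : theta ^+ 2 < 1 by rewrite exprn_ilt1 // ltW.
have H0 : 0 < H x0 := frame_norm_gt0 HA HL HhL Ac fU Dx0.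
(* Then theta^2 (1 + eta) <= 1 - eta. *)
pose eta := (1 - theta ^+ 2) / 2.
have eta0 : 0 < eta by rewrite /eta; lra.
have N : \forall x \near x0, H x0 * (1 - eta) <= H x <= H x0 * (1 + eta).
  have cH := frame_norm_continuous HhL Ac fU Dx0.
  have h1 : H x0 * (1 - eta) < H x0 by rewrite gtr_pMr //; lra.
  have h2 : H x0 < H x0 * (1 + eta) by rewrite ltr_pMr //; lra.
  near=> x; apply/andP; split; apply: ltW; near: x.
    exact: cvgr_gt cH _ h1.
  exact: cvgr_lt cH _ h2.
have [d1 /= d10 Hd1] := (nbhs_ballP _ _).1 N.
pose d := Num.min del (d1 / 2).
have d0 : 0 < d by rewrite lt_min del0; lra.
have dd1 : d <= d1 / 2 by rewrite ge_min lexx orbT.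
have ddel : d <= del by rewrite ge_min lexx.
have inH x : `|x - x0| <= d -> H x0 * (1 - eta) <= H x <= H x0 * (1 + eta).
  by move=> xd; apply: Hd1; rewrite -ball_normE /= distrC; lra.
have osc x y : `|x - x0| <= d -> `|y - x0| <= d -> theta ^+ 2 * H x <= H y.
  move=> /inH /andP[_ hx] /inH /andP[hy _].
  apply: le_trans hy; apply: (@le_trans _ _ (theta ^+ 2 * (H x0 * (1 + eta)))).
    by rewrite ler_wpM2l // ltW.
  rewrite mulrCA ler_wpM2l ?(ltW H0) // /eta.
  have := sqr_ge0 (1 - theta ^+ 2); nra.
pose K := kappa * (d / 8) ^+ (n + n) / 4.
exists K; split; first by rewrite /K divr_gt0 // mulr_gt0 // exprn_gt0 //; lra.
have N1 : \forall q \near p, `|cmap (real_chart c) q - x0| < d / 2.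
  have /cvgrPdist_lt/(_ (d / 2)) : cmap (real_chart c) @ p --> x0 by exact: (cmap_continuous HA Ac cp).
  have d20 : 0 < d / 2 by lra.
  by move=> /(_ d20); apply: filterS => q; rewrite distrC.
have N2 := near_chart HA HL Ac fU cp Up.
near=> q => k s Hs smax.
have [cq Uq] : cdom c q /\ U q by near: q.
have x1d : `|cmap (real_chart c) q - x0| < d / 2 by near: q.
set x1 := cmap (real_chart c) q in x1d.
set F := frame_fun c e k s.
have b1 x : `|x - x1| <= d / 2 -> `|x - x0| <= d.
  move=> h; have -> : x - x0 = (x - x1) + (x1 - x0) by rewrite addrA subrK.
  apply: le_trans (ler_normD _ _) _; lra.
have nE x : `|x - x0| <= d -> norm2 hL k s (psi x) = sqmod (F (of_real x)) * H x ^+ k.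
  move=> xd; have Dx : D x by apply: ballD; lra.
  have [cx Ux Ex] := coord_psi HA Ac Dx.
  rewrite (norm2_frame hL HA HL Ac fU k s cx Ux) Ex; congr (sqmod (F _) * _).
  by rewrite -{2}Ex /= to_realK.
have x1x0 : `|x1 - x0| <= d by lra.
have q1 : psi x1 = q by exact: (psi_cmap HA Ac cq).
set m := norm2 hL k s q.
have mE : m = sqmod (F (of_real x1)) * H x1 ^+ k by rewrite -nE // q1.
have Hpos x : `|x - x0| <= d -> 0 < H x.
  by move=> xd; apply: (frame_norm_gt0 HA HL HhL Ac fU); apply: ballD; lra.
have thk : 0 < theta ^+ k by rewrite exprn_gt0.
have thk1 : theta ^+ k <= 1 by rewrite exprn_ile1 // ltW.
have FA x : `|x - x1| <= d / 2 -> cabs (F (of_real x)) <= cabs (F (of_real x1)) / theta ^+ k.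
  move=> xd; have xd0 := b1 x xd.
  rewrite ler_pdivlMr // -(ler_sqr (x := _ * _)) ?nnegrE ?mulr_ge0 ?cabs_ge0 // ?(ltW thk) //.
  rewrite exprMn !sqr_cabs -exprM mulnC exprM.
  have h1 := smax (psi x); rewrite nE // -/m mE in h1.
  have Hk : 0 < H x ^+ k by rewrite exprn_gt0 // Hpos.
  have Hk1 : 0 < H x1 ^+ k by rewrite exprn_gt0 // Hpos.
  rewrite -(ler_pM2r Hk1) -mulrA -exprMn; apply: le_trans h1.
  rewrite ler_wpM2l ?sqmod_ge0 //; apply: lerXn2r; rewrite ?nnegrE.
  - exact: mulr_ge0 (ltW th20) (ltW (Hpos _ x1x0)).
  - exact: ltW (Hpos _ xd0).
  - exact: osc.
(* The radius for which the Lipschitz estimate loses at most half of the value. *)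
pose t := d * theta ^+ k / 16.
have t0 : 0 < t by rewrite divr_gt0 // mulr_gt0.
have td : t <= d / 16 by rewrite /t ler_pM2r ?invr_gt0 // ler_piMr // ltW.
have low y : `|y - x1| <= t -> m / 4 * (theta ^+ 2) ^+ k <= norm2 hL k s (psi y).
  move=> yt; have yd : `|y - x1| <= d / 2 by lra.
  have := @holomorphic_lipschitz R n F x1 y (d / 2) t (cabs (F (of_real x1)) / theta ^+ k) t0 _ _ FA yt.
  have -> : 4 * (cabs (F (of_real x1)) / theta ^+ k) * t / (d / 2) = cabs (F (of_real x1)) / 2.
    by rewrite /t; field; rewrite !gt_eqF.
  move=> L.
  have {}L : cabs (F (of_real y) - F (of_real x1)) <= cabs (F (of_real x1)) / 2.
    apply: L; first lra.
    move=> x xd; apply: (frame_fun_differentiable Ac fU Hs).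
    by apply/(coord_domP c U); apply: ballD; have := b1 x xd; lra.
  have L2 : cabs (F (of_real x1)) / 2 <= cabs (F (of_real y)).
    have : cabs (F (of_real x1)) <= cabs (F (of_real y)) + cabs (F (of_real y) - F (of_real x1)).
      have {1}-> : F (of_real x1) = F (of_real y) - (F (of_real y) - F (of_real x1)) by ring.
      by apply: le_trans (cabsD _ _) _; rewrite cabsN.
    move=> L3; rewrite -(lerD2r (cabs (F (of_real x1)) / 2)) -splitr (le_trans L3) // lerD2l.
    exact: L.
  rewrite nE ?b1 // mE.
  have -> : sqmod (F (of_real x1)) * H x1 ^+ k / 4 * (theta ^+ 2) ^+ k =
     (cabs (F (of_real x1)) / 2) ^+ 2 * (theta ^+ 2 * H x1) ^+ k.
    rewrite expr_div_n sqr_cabs [(_ * H x1) ^+ k]exprMn.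
    by move: (sqmod _) (H x1 ^+ k) ((theta ^+ 2) ^+ k) => X Y Z; field.
  apply: ler_pM.
  - exact: sqr_ge0.
  - exact: exprn_ge0 (mulr_ge0 (ltW th20) (ltW (Hpos _ x1x0))).
  - by rewrite -(sqr_cabs (F (of_real y))) ler_sqr ?nnegrE ?cabs_ge0 // divr_ge0 ?cabs_ge0.
  apply: lerXn2r; rewrite ?nnegrE.
  - exact: mulr_ge0 (ltW th20) (ltW (Hpos _ x1x0)).
  - exact: ltW (Hpos _ (b1 _ yd)).
  - exact: osc x1x0 (b1 _ yd).
have m0 : 0 <= m by rewrite mE mulr_ge0 ?sqmod_ge0 // exprn_ge0 // ltW // Hpos.
have x1del : `|x1 - x0| <= del / 2 by lra.
have tdel : 0 <= t <= del / 2 by apply/andP; split; lra.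
have [v1 v2] := Hv x1 t x1del tdel.
set B := psi @` _ in v1 v2.
set lo := m / 4 * (theta ^+ 2) ^+ k in low.
have lo0 : 0 <= lo by rewrite mulr_ge0 ?exprn_ge0 ?(ltW th20) //; lra.
have n20 x : 0 <= norm2 hL k s x := norm2_ge0 HhL k s x.
apply: (@le_trans _ _ (\int[vol]_(x in B) (lo%:E))%E).
  rewrite integral_cst //.
  apply: (@le_trans _ _ (lo%:E * (kappa * (2 * t) ^+ (n + n))%:E)%E); last first.
    by rewrite lee_wpmul2l // lee_fin.
  rewrite -EFinM lee_fin /lo /K /t.
  rewrite le_eqVlt; apply/orP; left; apply/eqP.
  have -> : 2 * (d * theta ^+ k / 16) = d / 8 * theta ^+ k by field.
  rewrite (exprMn (n + n) (d / 8)) -(exprM theta k) -(exprM theta 2).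
  have -> : ((n + n).+2 * k = 2 * k + k * (n + n))%N by rewrite -addn2 mulnDl [(k * _)%N]mulnC addnC.
  have aux (a1 a2 a3 X Y : R) : a1 * a2 / 4 * (a3 * (X * Y)) = a3 / 4 * X * (a1 * (a2 * Y)).
    by field.
  by rewrite (exprD theta) aux.
rewrite integral_mkcond; apply: ge0_le_integral_nomeas => x _.
  by rewrite /patch; case: ifP; rewrite lee_fin.
rewrite /patch; case: ifPn; rewrite lee_fin // => /set_mem [y yb <-].
apply: low; apply: rV_norm_le; first exact: ltW.
by move=> i; have := yb i; rewrite !mxE ler_norml; lra.
Unshelve. all: end_near. Qed.

End Local.

Lemma norm2_continuous k s : holo_section AM fr k s -> continuous (norm2 hL k s).
Proof.
move=> Hs q; have [c Ac cq] := HA.2 q.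
have [U [e [fU Uq]]] : exists U e, fr (U, e) /\ U q by have [_ h _] := HL; exact: h.
have h := @cvgC_re _ _ (nbhs q) (nbhs_filter q) _ _ (hprod_continuous_at HA HL HhL Ac fU Hs Hs cq Uq).
have -> : norm2 hL k s = (fun q' => reC (s q' * (s q')^* * ((hL q' ^+ k)%:C)%C)).
  by apply/funext => q'; rewrite conj_sqmod -rmorphM.
exact: h.
Qed.

(** A loss that is exponential in k, but at an arbitrarily small rate, suffices
    here: it is beaten by the decay of [isotypical_decay]. *)
Lemma sup_L2 (theta : R) : 0 < theta < 1 -> exists C, 0 < C /\
  forall k s, holo_section AM fr k s -> forall q,
    ((norm2 hL k s q * theta ^+ ((n + n).+2 * k))%:E <=
       C%:E * \int[vol]_x (norm2 hL k s x)%:E)%E.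
Proof.
move=> th.
pose P q C := 0 < C /\ forall k s, holo_section AM fr k s ->
    (forall q', norm2 hL k s q' <= norm2 hL k s q) ->
    ((norm2 hL k s q * theta ^+ ((n + n).+2 * k))%:E <=
       C%:E * \int[vol]_x (norm2 hL k s x)%:E)%E.
have I0 k s : (0 <= \int[vol]_x (norm2 hL k s x)%:E)%E.
  by apply: integral_ge0 => x _; rewrite lee_fin (norm2_ge0 HhL).
have [||C HC] := @compact_uniform R M setT P cM.
- move=> p _; have [c Ac cp] := HA.2 p.
  have [U [e [fU Up]]] : exists U e, fr (U, e) /\ U p by have [_ h _] := HL; exact: h.
  have [K [K0 HK]] := sup_L2_local Ac fU cp Up th.
  exists K^-1; apply: filterS HK => q HK; split; first by rewrite invr_gt0.
  move=> k s Hs smax; have := HK k s Hs smax.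
  by rewrite EFinM muleC -lee_pdivlMr // muleC.
- move=> q C C' CC' [C0 HC]; split; first exact: lt_le_trans CC'.
  move=> k s Hs smax; apply: le_trans (HC k s Hs smax) _.
  by rewrite lee_wpmul2r // lee_fin.
exists (Num.max C 1); split; first by rewrite lt_max ltr01 orbT.
move=> k s Hs q.
have [||q0 _ qmax] := @compact_EVT_max M R (norm2 hL k s) setT _ cM.
- by exists q.
- by apply: continuous_subspaceT; exact: norm2_continuous.
have [C0 HC0] := HC q0 I.
have smax q' : norm2 hL k s q' <= norm2 hL k s q0 by apply: qmax; rewrite inE.
apply: (@le_trans _ _ (C%:E * \int[vol]_x (norm2 hL k s x)%:E)%E).
  apply: le_trans (HC0 k s Hs smax); rewrite lee_fin ler_wpM2r // exprn_ge0 // ltW //.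
  by case/andP: th.
by rewrite lee_wpmul2r // lee_fin le_max lexx.
Qed.

End SupL2.

(** * Complex-valued curves *)

Lemma is_derive0P (R : realType) (f : R -> R) (l : R) :
  is_derive (0 : R) (1 : R) f l <-> (fun t => t^-1 * (f t - f 0)) @ 0^' --> l.
Proof.
have E : (fun h : R => h^-1 *: ((f \o shift 0) (h *: 1) - f 0)) = (fun t => t^-1 * (f t - f 0)).
  by apply/funext => h /=; rewrite addr0 [_%:A]mulr1.
split=> [[df <-]|H].
  by move: df; rewrite /derivable /derive E.
have df : derivable f 0 1 by rewrite /derivable E; apply/cvg_ex; exists l.
by split=> //; rewrite /derive E; apply/cvg_lim.
Qed.

(** Over an abstract numeric field, so that complex-valued limits are taken in
    one and the same structure. *)
Lemma cvgD_num (K : numFieldType) (X : Type) (F : set_system X) {FF : Filter F}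
    (f g : X -> K) (a b : K) :
  f @ F --> a -> g @ F --> b -> (fun x => f x + g x) @ F --> a + b.
Proof. exact: cvgD. Qed.

Lemma cvgM_num (K : numFieldType) (X : Type) (F : set_system X) {FF : Filter F}
    (f g : X -> K) (a b : K) :
  f @ F --> a -> g @ F --> b -> (fun x => f x * g x) @ F --> a * b.
Proof. exact: cvgM. Qed.

Lemma cvgN_num (K : numFieldType) (X : Type) (F : set_system X) {FF : Filter F}
    (f : X -> K) (a : K) : f @ F --> a -> (fun x => - f x) @ F --> - a.
Proof. exact: cvgN. Qed.

Lemma cvgV_num (K : numFieldType) (X : Type) (F : set_system X) {FF : Filter F}
    (f : X -> K) (a : K) :
  a != 0 -> f @ F --> a -> (fun x => (f x)^-1) @ F --> a^-1.
Proof. exact: cvgV. Qed.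

Lemma cvg_near_eq_num (K : numFieldType) (X : Type) (F : set_system X) {FF : Filter F}
    (f g : X -> K) (l : K) :
  (\forall x \near F, f x = g x) -> g @ F --> l -> f @ F --> l.
Proof. exact: cvg_near_eq. Qed.

Section ComplexCurves.
Variable R : realType.
Local Notation C := (Cx R).
Implicit Types f g : R -> C.

(** The complex numbers are normed over themselves, so differentiability in a
    real parameter is expressed componentwise. *)
Definition cderiv f (l : C) : Prop :=
  is_derive (0 : R) (1 : R) (fun t => reC (f t)) (reC l) /\
  is_derive (0 : R) (1 : R) (fun t => imC (f t)) (imC l).

Lemma cderivP f l : cderiv f l <->
  (fun t : R => ((t^-1)%:C)%C * (f t - f 0)) @ 0^' --> l.
Proof.
rewrite /cderiv cvgC_split !is_derive0P.
have E1 : (fun x => reC (((x^-1)%:C)%C * (f x - f 0))) = (fun t => t^-1 * (reC (f t) - reC (f 0))).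
  by apply/funext => t; rewrite reCM reCR imCR mul0r subr0 reCD reCN.
have E2 : (fun x => imC (((x^-1)%:C)%C * (f x - f 0))) = (fun t => t^-1 * (imC (f t) - imC (f 0))).
  by apply/funext => t; rewrite imCM reCR imCR mul0r addr0 imCD imCN.
by rewrite E1 E2.
Qed.

Lemma cderiv_cst (a : C) : cderiv (fun=> a) 0.
Proof. by split; exact: is_derive_cst. Qed.

Lemma cderivD f g lf lg : cderiv f lf -> cderiv g lg -> cderiv (fun t => f t + g t) (lf + lg).
Proof.
move=> [f1 f2] [g1 g2]; split.
  have -> : (fun t => reC (f t + g t)) = (fun t => reC (f t)) + (fun t => reC (g t)).
    by apply/funext => t; rewrite reCD.
  by rewrite reCD; exact: (is_deriveD f1 g1).
have -> : (fun t => imC (f t + g t)) = (fun t => imC (f t)) + (fun t => imC (g t)).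
  by apply/funext => t; rewrite imCD.
by rewrite imCD; exact: (is_deriveD f2 g2).
Qed.

Lemma cderivM f g lf lg : cderiv f lf -> cderiv g lg ->
  cderiv (fun t => f t * g t) (lf * g 0 + f 0 * lg).
Proof.
move=> [f1 f2] [g1 g2]; split.
  have -> : (fun t => reC (f t * g t)) = (fun t => reC (f t)) * (fun t => reC (g t)) -
     (fun t => imC (f t)) * (fun t => imC (g t)).
    by apply/funext => t; rewrite reCM.
  apply: (is_derive_eq (is_deriveB (is_deriveM f1 g1) (is_deriveM f2 g2))).
  by rewrite /GRing.scale /= reCD !reCM; ring.
have -> : (fun t => imC (f t * g t)) = (fun t => reC (f t)) * (fun t => imC (g t)) +
   (fun t => imC (f t)) * (fun t => reC (g t)).
  by apply/funext => t; rewrite imCM.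
apply: (is_derive_eq (is_deriveD (is_deriveM f1 g2) (is_deriveM f2 g1))).
by rewrite /GRing.scale /= imCD !imCM; ring.
Qed.

Lemma cderiv_eq f g l m : cderiv f l -> f =1 g -> l = m -> cderiv g m.
Proof. by move=> h /funext <- <-. Qed.

Lemma cderivZ (a : C) f l : cderiv f l -> cderiv (fun t => a * f t) (a * l).
Proof.
by move=> h; have := cderivM (cderiv_cst a) h; rewrite mul0r add0r.
Qed.

Lemma cderiv_sum (I : Type) (s : seq I) (f : I -> R -> C) (l : I -> C) :
  (forall i, cderiv (f i) (l i)) -> cderiv (fun t => \sum_(i <- s) f i t) (\sum_(i <- s) l i).
Proof.
move=> H; elim: s => [|i s IH].
  by apply: cderiv_eq (cderiv_cst 0) _ _ => [t|]; rewrite big_nil.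
by apply: cderiv_eq (cderivD (H i) IH) _ _ => [t|]; rewrite big_cons.
Qed.

Lemma cderivX f l k : f 0 = 1 -> cderiv f l -> cderiv (fun t => f t ^+ k) (k%:R * l).
Proof.
move=> f0 df; elim: k => [|k IH].
  by apply: cderiv_eq (cderiv_cst 1) _ _ => [t|]; rewrite ?expr0 ?mul0r.
apply: cderiv_eq (cderivM df IH) _ _ => [t|]; first by rewrite exprS.
by rewrite f0 expr1n mulr1 mul1r mulrS mulrDl mul1r.
Qed.

Lemma cderivV f l : f 0 = 1 -> cderiv f l -> cderiv (fun t => (f t)^-1) (- l).
Proof.
move=> f0 df.
have f0' : f 0 != 0 by rewrite f0 oner_neq0.
have cf : f t @[t --> 0^'] --> f 0.
  have H : ((t%:C)%C * (((t^-1)%:C)%C * (f t - f 0)) + f 0) @[t --> (0 : R)^'] --> 0 * l + f 0.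
    apply: cvgD_num; last exact: cvg_cst.
    apply: cvgM_num; last exact/cderivP.
    apply/cvgC_split; split; last exact: cvg_cst.
    by move=> P; exact: nbhs_dnbhs.
  rewrite mul0r add0r in H; apply: (cvg_near_eq_num _ H).
  near=> t; have t0 : t != 0 by near: t; exact: nbhs_dnbhs_neq.
  by rewrite mulrA -rmorphM /= divff // mul1r subrK.
have nf : \forall t \near (0 : R)^', f t != 0.
  have h2 : 0 < 1 / 2 :> R by lra.
  have h3 : \forall t \near (0 : R)^', cabs (f t - f 0) <= 1 / 2 by exact: (cvgCP f (f 0)).1 cf _ h2.
  apply: filterS h3 => t; rewrite f0; apply: contraTN => /eqP ->.
  by rewrite sub0r cabsN cabs1 -ltNge; lra.
have cv : (f t)^-1 @[t --> 0^'] --> (f 0)^-1 by exact: cvgV_num.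
apply/cderivP.
have H : (- ((f t)^-1) * (((t^-1)%:C)%C * (f t - f 0))) @[t --> (0 : R)^'] --> - ((f 0)^-1) * l.
  apply: cvgM_num; last exact/cderivP.
  exact: cvgN_num cv.
rewrite f0 invr1 mulN1r in H; apply: (cvg_near_eq_num _ H).
near=> t.
have ft : f t != 0 by near: t.
by rewrite f0 invr1; move: ((t^-1)%:C)%C => u; field.
Unshelve. all: end_near. Qed.

Lemma cderiv_near f g l : (\forall t \near (0 : R), f t = g t) -> cderiv g l -> cderiv f l.
Proof.
move=> E /cderivP h; apply/cderivP; move: h; have E0 := nbhs_singleton E.
move=> h; apply: (cvg_near_eq_num _ h); apply: filterS (nbhs_dnbhs E) => t ->.
by rewrite E0.
Qed.

Lemma cderiv_unique f l l' : cderiv f l -> cderiv f l' -> l = l'.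
Proof.
move=> [[_ h1] [_ h1']] [[_ h2] [_ h3]].
by apply: Cx_eq; [rewrite -h1 -h2|rewrite -h1' -h3].
Qed.

End ComplexCurves.

Section ChainRule.
Variables (R : realType) (n : nat).
Local Notation C := (Cx R).

Lemma differentiable_eps (F : 'rV[C]_n -> C) (z : 'rV[C]_n) :
  differentiable (F : _ -> C^o) z -> forall e : R, 0 < e ->
  \forall h \near (0 : 'rV[C]_n),
    `|F (h + z) - F z - 'd (F : _ -> C^o) z h| <= (e%:C)%C * `|h|.
Proof.
move=> dF e e0.
have e0' : 0 < ((e%:C)%C : C) by rewrite [X in is_true X]ltcR.
have /eqaddoP/(_ _ e0') := diff_locally dF.
apply: filterS => h; rewrite /= -[(_ - _) h]/(_ h - _ h) /= => H.
by rewrite -addrA -opprD.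
Qed.

Lemma cderiv_comp_holo (F : 'rV[C]_n -> C) (z : R -> 'rV[C]_n) (X : 'rV[C]_n) :
  differentiable (F : _ -> C^o) (z 0) -> (forall j, cderiv (fun t => z t 0 j) (X 0 j)) ->
  cderiv (fun t => F (z t)) ('d (F : _ -> C^o) (z 0) X).
Proof.
move=> dF dz; apply/cderivP.
(* Difference quotients of the curve, to which the differential is applied. *)
pose q t : 'rV[C]_n := ((t^-1)%:C)%C *: (z t - z 0).
have cqj j : q t 0 j @[t --> 0^'] --> X 0 j.
  have /cderivP := dz j.
  by have -> : (fun x => q x 0 j) = (fun t => ((t^-1)%:C)%C * (z t 0 j - z 0 0 j))
    by apply/funext => t; rewrite !mxE.
have cq : q t @[t --> 0^'] --> X.
  by apply/cvg_rowP.
have clin : continuous ('d (F : _ -> C^o) (z 0)) by exact: diff_continuous.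
have cdq : 'd (F : _ -> C^o) (z 0) (q t) @[t --> 0^'] --> 'd (F : _ -> C^o) (z 0) X.
  by apply: continuous_cvg cq; exact: clin.
have cz : z t - z 0 @[t --> 0^'] --> (0 : 'rV[C]_n).
  apply/cvg_rowP => j; rewrite mxE.
  have H : ((t%:C)%C * (q t 0 j)) @[t --> (0 : R)^'] --> 0 * X 0 j.
    apply: cvgM_num; last exact: cqj.
    apply/cvgC_split; split; last exact: cvg_cst.
    by move=> P; exact: nbhs_dnbhs.
  rewrite mul0r in H; apply: (cvg_near_eq_num _ H).
  near=> t; have t0 : t != 0 by near: t; exact: nbhs_dnbhs_neq.
  by rewrite !mxE mulrA -rmorphM /= divff // mul1r.
have bq : \forall t \near (0 : R)^', `|q t| <= `|X| + 1.
  have /cvgrPdist_lt/(_ 1 ltr01) := cq.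
  apply: filterS => t h; have -> : q t = X - (X - q t) by rewrite subKr.
  by apply: le_trans (ler_normB _ _) _; rewrite lerD2l ltW.
have rX : exists2 B : R, 0 < B & `|X| + 1 <= (B%:C)%C.
  have : 0 <= `|X| by exact: normr_ge0.
  rewrite [X in is_true X -> _]lecE /= => /andP[/eqP imX reX].
  exists (reC `|X| + 1); first by rewrite ltr_wpDl.
  rewrite rmorphD /= lerD2r le_eqVlt; apply/orP; left; apply/eqP; apply: Cx_eq => //.
have [B B0 XB] := rX.
apply/cvgCP => e e0.
have e20 : 0 < e / 2 by lra.
have eB0 : 0 < e / 2 / B by rewrite divr_gt0.
have N1 : \forall t \near (0 : R)^', `|F (z t - z 0 + z 0) - F (z 0) - 'd (F : _ -> C^o) (z 0) (z t - z 0)|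
     <= ((e / 2 / B)%:C)%C * `|z t - z 0|.
  exact: (cz _ (differentiable_eps dF eB0)).
have N2 : \forall t \near (0 : R)^', cabs ('d (F : _ -> C^o) (z 0) (q t) - 'd (F : _ -> C^o) (z 0) X) <= e / 2.
  by have /cvgCP := cdq; apply.
near=> t.
have t0 : t != 0 by near: t; exact: nbhs_dnbhs_neq.
have k1 : `|F (z t - z 0 + z 0) - F (z 0) - 'd (F : _ -> C^o) (z 0) (z t - z 0)|
     <= ((e / 2 / B)%:C)%C * `|z t - z 0| by near: t.
have k2 : cabs ('d (F : _ -> C^o) (z 0) (q t) - 'd (F : _ -> C^o) (z 0) X) <= e / 2 by near: t.
have k3 : `|q t| <= `|X| + 1 by near: t.
rewrite subrK in k1.
have E : ((t^-1)%:C)%C * (F (z t) - F (z 0)) - 'd (F : _ -> C^o) (z 0) X =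
  ((t^-1)%:C)%C * (F (z t) - F (z 0) - 'd (F : _ -> C^o) (z 0) (z t - z 0)) +
  ('d (F : _ -> C^o) (z 0) (q t) - 'd (F : _ -> C^o) (z 0) X).
  by rewrite /q linearZ /= /GRing.scale /=; ring.
rewrite E; apply: le_trans (cabsD _ _) _; rewrite [e]splitr; apply: lerD k2.
rewrite -lecR -cabsE normrM.
apply: (@le_trans _ _ (`|((t^-1)%:C)%C : C| * (((e / 2 / B)%:C)%C * `|z t - z 0|))).
  by rewrite ler_wpM2l.
rewrite mulrCA -normrZ -/(q t).
apply: (@le_trans _ _ (((e / 2 / B)%:C)%C * (B%:C)%C)).
  rewrite ler_wpM2l ?(le_trans k3) // [X in is_true X]lecR ltW //.
by rewrite -rmorphM /= divfK // gt_eqF.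
Unshelve. all: end_near. Qed.

End ChainRule.

(** * The span of a representation *)

Section FiniteSpan.
Variables (K : fieldType) (I : Type) (m : nat) (f : I -> 'rV[K]_m).

Definition family_mx N (g : 'I_N -> I) : 'M[K]_(N, m) := \matrix_(l < N) f (g l).

Definition cons_family N (i : I) (g : 'I_N -> I) (l : 'I_N.+1) : I :=
  if unlift ord0 l is Some l' then g l' else i.

Lemma cons_family_lift N i (g : 'I_N -> I) l : cons_family i g (lift ord0 l) = g l.
Proof. by rewrite /cons_family liftK. Qed.

Lemma cons_family0 N i (g : 'I_N -> I) : cons_family i g ord0 = i.
Proof. by rewrite /cons_family unlift_none. Qed.

Lemma cons_family_sub N i (g : 'I_N -> I) : (family_mx g <= family_mx (cons_family i g))%MS.
Proof.
apply/row_subP => l.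
have -> : row l (family_mx g) = row (lift ord0 l) (family_mx (cons_family i g)).
  by rewrite !rowK cons_family_lift.
exact: row_sub.
Qed.

Lemma cons_family_mem N i (g : 'I_N -> I) : (f i <= family_mx (cons_family i g))%MS.
Proof.
have -> : f i = row ord0 (family_mx (cons_family i g)) by rewrite rowK cons_family0.
exact: row_sub.
Qed.

(** Finitely many members of a family of vectors have the same span: add a new
    member as long as the rank increases. *)
Lemma finite_span : exists N (g : 'I_N -> I), forall i, (f i <= family_mx g)%MS.
Proof.
suff H k N (g : 'I_N -> I) : (m - \rank (family_mx g) <= k)%N ->
    exists N (g : 'I_N -> I), forall i, (f i <= family_mx g)%MS.
  by apply: (H m 0 (fun i : 'I_0 => False_rect I (notF (ltn_ord i)))); rewrite leq_subr.
elim: k N g => [|k IH] N g.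
  rewrite leqn0 subn_eq0 => full; exists N, g => i; apply: submx_full.
  by rewrite /row_full eqn_leq rank_leq_col full.
move=> Hk; have [all|/existsNP[i Hi]] := pselect (forall i, (f i <= family_mx g)%MS).
  by exists N, g.
apply: (IH N.+1 (cons_family i g)).
have lt : (\rank (family_mx g) < \rank (family_mx (cons_family i g)))%N.
  rewrite ltnNge; apply/negP => le; apply: Hi.
  apply: submx_trans (cons_family_mem i g) _.
  by have := mxrank_leqif_sup (cons_family_sub i g) => -[_ <-]; rewrite eqn_leq le mxrankS // cons_family_sub.
have rm := rank_leq_col (family_mx (cons_family i g)).
move: Hk lt rm; move: (\rank _) (\rank _) => a b; rewrite !leq_subLR => h1 h2 h3.
by rewrite (leq_trans h1) // addnS -addSn leq_add2r.
Qed.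

Lemma finite_span_head (i0 : I) : exists N (g : 'I_N.+1 -> I), g ord0 = i0 /\
  forall i, (f i <= family_mx g)%MS.
Proof.
have [N [g Hg]] := finite_span; exists N, (cons_family i0 g); rewrite cons_family0; split => //.
by move=> i; apply: submx_trans (Hg i) (cons_family_sub _ _).
Qed.

End FiniteSpan.

Section RepSpan.
Variables (K : fieldType) (G : groupType) (r : nat) (rho : G -> 'M[K]_r).
Hypothesis (rhoM : forall x y, rho (x * y)%g = rho x *m rho y).

(** The coefficients of rho(x) rho(g_m) in the rho(g_l) depend linearly on the
    matrix rho(x); in particular they are differentiable along a curve x(t) as soon
    as rho is. *)
Lemma rep_span : exists N (g : 'I_N.+1 -> G) (L : 'I_N.+1 -> 'M[K]_r -> 'rV[K]_N.+1),
  [/\ g ord0 = 1%g,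
      forall m (a : K) A B, L m (a *: A + B) = a *: L m A + L m B &
      forall x m, rho x *m rho (g m) = \sum_l (L m (rho x)) 0 l *: rho (g l)].
Proof.
have [N [g [g0 Hg]]] := finite_span_head (fun x => mxvec (rho x)) (1%g : G).
exists N, g, (fun m A => mxvec (A *m rho (g m)) *m pinvmx (family_mx (fun x => mxvec (rho x)) g)).
split=> // [m a A B|x m].
  by rewrite mulmxDl -scalemxAl linearD linearZ /= mulmxDl -scalemxAl.
apply: (can_inj mxvecK); rewrite -rhoM -[LHS](mulmxKpV (Hg _)) mulmx_sum_row.
rewrite linear_sum /=; apply: eq_bigr => l _; rewrite linearZ /= rowK.
by [].
Qed.

End RepSpan.

(** * The action in coordinates *)

Section Action.
Variables (R : realType) (n : nat) (M : ptopologicalType) (AM : set (chart M 'rV[Cx R]_n)).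
Variables (fr : frame_family R M).
Hypotheses (HA : is_atlas AM) (HL : line_bundle AM fr).
Variables (d : nat) (G : topGroupType) (AG : set (chart G 'rV[R]_d)).
Hypothesis (HG : lie_group AG).
Variables (c1 : chart G 'rV[R]_d) (Hc1 : AG c1) (Hc11 : cdom c1 1%g).
Variables (mu : G -> M -> M) (Hmu : holo_action AG AM mu).
Variables (j : G -> M -> Cx R) (Hj : holo_lift AG AM fr mu j).
Variable xi : 'rV[R]_d.
Local Notation gam := (curve1 c1 xi).

Let chart1 : chart_axiom c1.
Proof. by have [[_ [H _] _] _ _] := HG; exact: H. Qed.

Lemma mu1 q : mu 1%g q = q. Proof. by have [[H _] _ _] := Hmu; exact: H. Qed.

Lemma curve1_0 : gam 0 = 1%g.
Proof. by have [_ _ cK _ _] := chart1; rewrite /curve1 scale0r addr0 cK. Qed.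

Lemma curve1_continuous : {for 0, continuous gam}.
Proof.
have [_ _ cK _ ci] := chart1.
have im : (cmap c1 @` cdom c1) (cmap c1 1%g + (0 : R) *: xi) by exists 1%g => //; rewrite scale0r addr0.
apply: (@continuous_comp _ _ _ (fun t : R => cmap c1 1%g + t *: xi) (cinv c1) 0); last exact: ci.
by apply: cvgD; [exact: cvg_cst|apply: cvgZr_tmp; exact: cvg_id].
Qed.

Lemma orbit_continuous q : {for 0, continuous (fun t => mu (gam t) q)}.
Proof.
have [_ [cmu _] _] := Hmu.
have cp : {for 0, continuous (fun t => (gam t, q))}.
  by apply: cvg_pair; [exact: curve1_continuous|exact: cvg_cst].
exact: (@continuous_comp _ _ _ (fun t => (gam t, q)) (fun x : G * M => mu x.1 x.2) 0 cp (cmu _)).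
Qed.

Section AtPoint.
Variables (c : chart M 'rV[Cx R]_n) (U : set M) (e : M -> Cx R).
Hypotheses (Ac : AM c) (fU : fr (U, e)).

Let v : 'rV[R]_(d + (n + n)) := row_mx xi 0.
Let pt (x : 'rV[R]_(n + n)) : 'rV[R]_(d + (n + n)) := row_mx (cmap c1 1%g) x.
Let Psi : 'rV[R]_(d + (n + n)) -> 'rV[R]_(n + n) :=
  cmap (real_chart c) \o (fun x : G * M => mu x.1 x.2) \o cinv (prod_chart c1 (real_chart c)).

Lemma prod_line (x : 'rV[R]_(n + n)) t :
  cinv (prod_chart c1 (real_chart c)) (t *: v + pt x) = (gam t, cinv (real_chart c) x).
Proof.
rewrite /= /v /pt scale_row_mx add_row_mx row_mxKl row_mxKr scaler0 add0r /curve1.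
by rewrite addrC.
Qed.

Lemma near_orbit q : cdom c q -> U q ->
  \forall t \near (0 : R), cdom c (mu (gam t) q) /\ U (mu (gam t) q).
Proof.
move=> cq Uq.
have oc : mu (gam t) q @[t --> (0 : R)] --> mu (gam 0) q := @orbit_continuous q.
rewrite curve1_0 mu1 in oc.
exact: (oc _ (near_chart HA HL Ac fU cq Uq)).
Qed.

(** The vector field xi_M in real coordinates, as a directional derivative of the
    action map on G x M: in this form its continuity is visible. *)
Definition real_field (x : 'rV[R]_(n + n)) : 'rV[R]_(n + n) := 'D_v Psi (pt x).

Lemma Psi_smooth (x : 'rV[R]_(n + n)) : coord_dom c U x ->
  derivable Psi (pt x) v /\ {for x, continuous real_field}.
Proof.
move=> Dx; have [cx Ux Ex] := coord_psi HA Ac Dx.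
have [_ [_ smu] _] := Hmu.
have Apc : prod_atlas AG (real_atlas AM) (prod_chart c1 (real_chart c)).
  by exists c1 => //; exists (real_chart c) => //; exists c.
have Arc : real_atlas AM (real_chart c) by exists c.
have sP := smu _ _ Apc Arc.
have im : (cmap (prod_chart c1 (real_chart c)) @` (cdom (prod_chart c1 (real_chart c)) `&`
    (fun x : G * M => mu x.1 x.2) @^-1` cdom (real_chart c))) (pt x).
  exists (1%g, cinv (real_chart c) x); first by split => //=; rewrite mu1.
  by rewrite /pt -{2}Ex.
have [d1 d2] := sP 1%N.
split; first exact: d1.
have cont := d2 v _ im.
apply: (@continuous_comp _ _ _ pt (fun y => 'D_v Psi y) x); last exact: cont.
move=> {cont}; suff : pt @ nbhs x --> pt x by [].
apply/cvg_rowP => i; case: (split_ordP i) => i' ->.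
  under eq_fun do rewrite row_mxEl; rewrite row_mxEl; exact: cvg_cst.
under eq_fun do rewrite row_mxEr; rewrite row_mxEr; exact: coord_continuous.
Qed.

Lemma ind_fieldE x : coord_dom c U x ->
  ind_field c1 mu c xi (cinv (real_chart c) x) = of_real (real_field x).
Proof.
move=> Dx; rewrite /ind_field /real_field derive1E; congr of_real.
rewrite /derive; set g1 := fun h => h^-1 *: _; set g2 := fun h => h^-1 *: _.
suff -> : g1 = g2 by [].
rewrite funeqE /g1 /g2 => h; rewrite [in LHS]/comp /shift /= [h%:A]mulr1 addr0.
rewrite /Psi /comp prod_line /=.
have := prod_line x 0; rewrite scale0r add0r /= => -[-> ->].
by [].
Qed.

Lemma orbit_cderiv q : cdom c q -> U q -> forall i,
  cderiv (fun t => cmap c (mu (gam t) q) 0 i) (ind_field c1 mu c xi q 0 i).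
Proof.
move=> cq Uq i; have Dx := coord_cmap cq Uq.
have [d1 _] := Psi_smooth Dx.
have q1 := psi_cmap HA Ac cq.
have := ind_fieldE Dx; rewrite q1 => ->.
set x := cmap (real_chart c) q in Dx d1 q1 *.
have E t : Psi (t *: v + pt x) = cmap (real_chart c) (mu (gam t) q).
  by rewrite /Psi /comp prod_line q1.
have dl (l : 'I_(n + n)) : is_derive (0 : R) (1 : R) (fun t => cmap (real_chart c) (mu (gam t) q) 0 l)
    (real_field x 0 l).
  have h1 := (derivable_mxP _ _ _).1 d1 0 l.
  have h2 : 'D_v (fun y => Psi y 0 l : R^o) (pt x) = real_field x 0 l.
    by rewrite /real_field (derive_mx d1) mxE.
  have := @is_derive_line R _ (fun y => Psi y 0 l) (pt x) v 0.
  rewrite scale0r add0r h2 => /(_ h1).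
  by under eq_fun do rewrite E.
split.
  have := dl (lshift n i); rewrite mxE reC_mkC.
  by under eq_fun do rewrite /= row_mxEl mxE.
have := dl (rshift n i); rewrite mxE imC_mkC.
by under eq_fun do rewrite /= row_mxEr mxE.
Qed.

(** The function J(t) of the moment map condition. *)
Definition lift_curve q (t : R) : Cx R := j (gam t) q * e q / e (mu (gam t) q).

Lemma lift_curve0 q : U q -> lift_curve q 0 = 1.
Proof.
move=> Uq; have [[j1 _] _] := Hj.
by rewrite /lift_curve curve1_0 j1 mu1 mul1r divff // (frame_neq0 HL fU).
Qed.

Lemma lift_curve_cderiv q : cdom c q -> U q ->
  cderiv (lift_curve q) (mkC (derive1 (fun t => reC (lift_curve q t) : R^o) 0)
                             (derive1 (fun t => imC (lift_curve q t) : R^o) 0)).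
Proof.
move=> cq Uq; have [_ sj] := Hj; have [[s1 s2] _] := sj _ _ _ _ fU fU.
have Apc : prod_atlas AG (real_atlas AM) (prod_chart c1 (real_chart c)).
  by exists c1 => //; exists (real_chart c) => //; exists c.
have q1 := psi_cmap HA Ac cq.
set x := cmap (real_chart c) q in q1.
have im : (cmap (prod_chart c1 (real_chart c)) @` (cdom (prod_chart c1 (real_chart c)) `&`
    [set x : G * M | U x.2 /\ U (mu x.1 x.2)])) (pt x).
  by exists (1%g, q) => //; split => //=; rewrite mu1.
have key (f : G * M -> R) : smooth_fun (W := R^o) (prod_atlas AG (real_atlas AM))
   [set x : G * M | U x.2 /\ U (mu x.1 x.2)] f ->
   derivable ((fun t => f (gam t, q)) : R -> R^o) 0 1.
  move=> sf; have [df _] := sf _ Apc 1%N.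
  have := df v _ im => /derivable1P.
  suff -> : (fun h : R => (f \o cinv (prod_chart c1 (real_chart c))) (h *: v + pt x)) =
    (fun t => f (gam t, q)) by [].
  by apply/funext => t; rewrite /comp prod_line q1.
by split; rewrite ?reC_mkC ?imC_mkC derive1E; [exact: (derivableP (key _ s1))|exact: (derivableP (key _ s2))].
Qed.

End AtPoint.

Lemma section_act_inv k g (s : M -> Cx R) q :
  section_act mu j k g^-1 s q = (j g q)^-1 ^+ k * s (mu g q) /\ j g q != 0.
Proof.
have [[j1 jM] _] := Hj.
have E : j g^-1%g (mu g q) * j g q = 1 by rewrite -jM mulVg j1.
have j0 : j g q != 0.
  by apply: contra_eq_neq E => ->; rewrite mulr0 eq_sym oner_neq0.
split => //; rewrite /section_act invgK; congr (_ ^+ k * _).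
by rewrite -[LHS](mulfK j0) E mul1r.
Qed.

(** Equivariance in a frame: F(g z) = J(g)^k F_(g^-1 s)(z), with F the local
    expression of s. *)
Lemma frame_section_act (c : chart M 'rV[Cx R]_n) U e k g (s : M -> Cx R) q :
  AM c -> fr (U, e) -> cdom c q -> U q -> cdom c (mu g q) -> U (mu g q) ->
  frame_fun c e k s (cmap c (mu g q)) =
  (j g q * e q / e (mu g q)) ^+ k * frame_fun c e k (section_act mu j k g^-1 s) (cmap c q).
Proof.
move=> Ac fU cq Uq cgq Ugq.
have [_ _ cK _ _] := HA.1 c Ac.
rewrite /frame_fun !cK //; have [-> j0] := section_act_inv k g s q.
have e0 : e q != 0 := frame_neq0 HL fU Uq.
have e1 : e (mu g q) != 0 := frame_neq0 HL fU Ugq.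
rewrite !exprMn !exprVn; field.
by rewrite !expf_neq0.
Qed.

Section RepDerivative.
Variables (r : nat) (rho : G -> 'M[Cx R]_r) (Hrho : irreducible_rep rho).
Variables (k0 : nat) (T : 'cV[Cx R]_r -> M -> Cx R) (HT : intertwiner AM fr mu j rho k0 T).

Lemma intertwiner0 p : T 0 p = 0.
Proof. by have [_ H _] := HT; have := H (-1) 0 0 p; rewrite scaler0 addr0 mulN1r addNr. Qed.

Lemma intertwiner_row w p : T w p = ((\row_a T (delta_mx a 0) p) *m w) 0 0.
Proof.
have [_ H _] := HT.
rewrite mxE {1}(matrix_sum_delta w).
rewrite (eq_bigr (fun i => w i 0 *: delta_mx i 0)); last by move=> i _; rewrite big_ord1.
have -> (I : seq 'I_r) : T (\sum_(i <- I) w i 0 *: delta_mx i 0) p = \sum_(i <- I) w i 0 * T (delta_mx i 0) p.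
  elim: I => [|i I IH]; first by rewrite !big_nil intertwiner0.
  by rewrite !big_cons H IH.
by apply: eq_bigr => i _; rewrite mxE mulrC.
Qed.

Lemma section_act_cderiv k (s : M -> Cx R) q : holo_section AM fr k s ->
  exists l, cderiv (fun t => section_act mu j k ((gam t)^-1)%g s q) l.
Proof.
move=> Hs; have [c Ac cq] := HA.2 q.
have [U [e [fU Uq]]] : exists U e, fr (U, e) /\ U q by have [_ h _] := HL; exact: h.
have dJ := lift_curve_cderiv Ac fU cq Uq.
have J0 := lift_curve0 fU Uq.
have dF : differentiable (frame_fun c e k s : _ -> (Cx R)^o) (cmap c (mu (gam 0) q)).
  by rewrite curve1_0 mu1; apply: (frame_fun_differentiable Ac fU Hs); exists q.
have dFz := cderiv_comp_holo dF (orbit_cderiv Ac cq Uq).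
have dJk := cderivX k (f := fun t => (lift_curve e q t)^-1) (etrans (congr1 _ J0) (invr1 _)) (cderivV J0 dJ).
have H := cderivZ (e q ^+ k) (cderivM dJk dFz).
eexists; move: H; apply: cderiv_near.
apply: filterS (near_orbit Ac fU cq Uq) => t [ct Ut].
have [-> jn0] := section_act_inv k (gam t) s q.
rewrite (frame_funE HA HL Ac fU k s ct Ut) /lift_curve.
have e0 : e q != 0 := frame_neq0 HL fU Uq.
have e1 : e (mu (gam t) q) != 0 := frame_neq0 HL fU Ut.
rewrite !exprVn !exprMn !exprVn; field.
by rewrite !expf_neq0.
Qed.

(** A representation is only assumed continuous.  Here its matrix entries are
    recovered from the functions t |-> (gam(t)^-1 T v)(q), which are differentiable
    because the action is smooth: by irreducibility a nonzero intertwiner T is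
    injective, so finitely many evaluations of T determine a vector. *)
Lemma rep_cderiv v0 p0 : T v0 p0 != 0 ->
  exists B : 'M[Cx R]_r, forall a b, cderiv (fun t => rho ((gam t)^-1)%g a b) (B a b).
Proof.
move=> T0; have [hT _ eT] := HT; have [_ _ _ _ irr] := Hrho.
pose f q := \row_a T (delta_mx a 0) q : 'rV[Cx R]_r.
have [N [g Hg]] := finite_span f.
set A := family_mx f g.
have TA w : A *m w = 0 <-> T w = (fun=> 0).
  split=> [Aw|Tw].
    apply/funext => q; rewrite intertwiner_row -/(f q).
    have E : f q = (f q *m pinvmx A) *m A by rewrite mulmxKpV //; exact: Hg.
    by rewrite E -(mulmxA (f q *m pinvmx A)) Aw mulmx0 mxE.
  apply/matrixP => i b; rewrite ord1 mxE [RHS]mxE.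
  have := congr1 (fun h => h (g i)) Tw; rewrite /= intertwiner_row mxE => E0; rewrite -[RHS]E0.
  by apply: eq_bigr => a _; rewrite !mxE.
(* The kernel of T, an invariant subspace. *)
pose W : {vspace 'cV[Cx R]_r} := lker (linfun (mulmx A)).
have memW w : (w \in W) = (A *m w == 0) by rewrite memv_ker lfunE.
have [|W0|Wf] := irr W.
- move=> h w; rewrite !memW => /eqP/TA Tw; apply/eqP/TA.
  by rewrite eT Tw; apply/funext => q; rewrite /section_act mulr0.
- have full : row_full A.
    have : row_free A^T.
      rewrite -kermx_eq0; apply/eqP/row_matrixP => i; rewrite row0.
      have : (row i (kermx A^T))^T \in W.
        by rewrite memW -{1}[A]trmxK -trmx_mul -row_mul mulmx_ker row0 trmx0.
      rewrite W0 memv0 => /eqP h; by rewrite -[LHS]trmxK h trmx0.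
    by rewrite /row_free /row_full mxrank_tr.
  have PA1 : pinvmx A *m A = 1%:M by apply: mulVpmx.
  have /choice[l Hl] : forall ib : 'I_N * 'I_r, exists l,
      cderiv (fun t => section_act mu j k0 ((gam t)^-1)%g (T (delta_mx ib.2 0)) (g ib.1)) l.
    by move=> ib; apply: section_act_cderiv.
  exists (\matrix_(a, b) \sum_i pinvmx A a i * l (i, b)) => a b; rewrite mxE.
  have := @cderiv_sum R _ (index_enum 'I_N)
    (fun i t => pinvmx A a i * section_act mu j k0 ((gam t)^-1)%g (T (delta_mx b 0)) (g i))
    (fun i => pinvmx A a i * l (i, b)) (fun i => cderivZ _ (Hl (i, b))).
  move=> /cderiv_eq; apply => // t.
  rewrite -[rho _]mul1mx -PA1 -mulmxA mxE; apply: eq_bigr => i _; congr (_ * _).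
  rewrite -eT intertwiner_row -colE [RHS]mxE [LHS]mxE.
  by apply: eq_bigr => c _; rewrite !mxE.
- exfalso; have : v0 \in W by rewrite Wf memvf.
  rewrite memW => /eqP/TA Tv; move: T0; by rewrite Tv eqxx.
Qed.

End RepDerivative.

End Action.

(** * Growth along a field of directions *)

Lemma derive_gt_near (R : realType) (g : R -> R) (c D : R) :
  is_derive (0 : R) (1 : R) g D -> c < D ->
  \forall h \near 0^'+, g 0 + h * c < g h.
Proof.
move=> [dg <-] cD.
have /cvgr_gt/(_ _ cD) H := cvg_dnbhs_at_right dg.
near=> h.
have h0 : 0 < h by near: h; exact: nbhs_right_gt.
have : c < h^-1 *: (g (h *: (1 : R^o) + 0) - g 0) by near: h; exact: H.
rewrite addr0 /GRing.scale /= mulr1 mulrC ltr_pdivlMr // => H1.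
lra.
Unshelve. all: end_near. Qed.

Lemma compact_closed_ball_rV (R : realType) m (x : 'rV[R]_m) (e : R) :
  0 < e -> compact (closed_ball x e).
Proof.
move=> e0; apply: bounded_closed_compact; last exact: closed_ball_closed.
exists (`|x| + e); split=> [|M Mgt y]; first exact: num_real.
rewrite closed_ballE // /closed_ball_ /= => yx.
rewrite (le_trans _ (ltW Mgt)) // -[y](subrK x) addrC (le_trans (ler_normD _ _)) //.
by rewrite lerD2l distrC.
Qed.

Lemma closed_nbhsC (T : topologicalType) (A : set T) :
  (forall z, ~ A z -> nbhs z (~` A)) -> closed A.
Proof.
move=> H; rewrite -[A]setCK; apply: open_closedC.
by rewrite openE => z /H.
Qed.

Lemma is_derive_expRM (R : realType) (lam c : R) :
  is_derive (0 : R) (1 : R) (fun h : R => expR (lam * h) * c) (lam * c).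
Proof.
have e2 : is_derive (0 : R) (1 : R) (fun h : R => lam * h) lam.
  by apply: (is_derive_eq (is_deriveZ lam (is_derive_id (0 : R) (1 : R)))); rewrite /GRing.scale /= mulr1.
have e3 : is_derive ((fun h : R => lam * h) 0) (1 : R) expR 1.
  by apply: is_derive_eq; rewrite mulr0 expR0.
have e4 := @is_derive1_comp R (@expR R) (fun h => lam * h) 0 1 lam e3 e2.
have -> : (fun h : R => expR (lam * h) * c) = (expR \o (fun h : R => lam * h)) * cst c by [].
by apply: is_derive_eq; rewrite scaler0 add0r mul1r /GRing.scale /= mulrC.
Qed.

(** If u grows at a rate above lam in the direction Y(x) at each point, then from
    x1 one reaches in time tau a point where u is e^(lam tau) times larger.  No
    curve is integrated: among the pairs (t, x) for which the conclusion holds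
    at time t, a compact set, take one with t maximal; if t < tau, a short step in
    the direction Y(x) increases t. *)
Lemma growth_along_directions (R : realType) m (u : 'rV[R]_m -> R)
    (Y : 'rV[R]_m -> 'rV[R]_m) (x1 : 'rV[R]_m) (B tau lam : R) :
  0 <= B -> 0 <= tau ->
  (forall x, `|x - x1| <= B * tau ->
     [/\ {for x, continuous u}, `|Y x| <= B, derivable (u : _ -> R^o) x (Y x) &
         0 < u x -> lam * u x < 'D_(Y x) (u : _ -> R^o) x]) ->
  0 < u x1 -> exists2 x, `|x - x1| <= B * tau & expR (lam * tau) * u x1 <= u x.
Proof.
move=> B0 tau0 Hu ux1.
(* The pairs (t, x) reached: x is within B t of x1, and u x is as large as required
   at time t. *)
pose A := [set z : R * 'rV[R]_m | [/\ 0 <= z.1, z.1 <= tau, `|z.2 - x1| <= B * z.1 &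
   expR (lam * z.1) * u x1 <= u z.2]].
have cK : compact (`[0, tau]%classic `*` closed_ball x1 (B * tau + 1)).
  apply: compact_setX; first exact: segment_compact.
  by apply: compact_closed_ball_rV; rewrite ltr_wpDl // mulr_ge0.
have cA : compact A.
  apply: subclosed_compact cK _.
    apply: closed_nbhsC => -[t x] nA.
    have c1 : continuous (fst : R * 'rV[R]_m -> R) by move=> z; exact: cvg_fst.
    have cn : continuous (fun z : R * 'rV[R]_m => `|z.2 - x1| - B * z.1).
      move=> z; apply: cvgB; last by apply: cvgMl_tmp; exact: c1.
      by apply: cvg_norm; apply: cvgB; [exact: cvg_snd|exact: cvg_cst].
    have [t0|t0] := ltP t 0.
      by apply: filterS (cvgr_lt _ (c1 (t, x)) _ t0) => -[t' x'] /= t'0 [/=]; lra.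
    have [tt|tt] := ltP tau t.
      by apply: filterS (cvgr_gt _ (c1 (t, x)) _ tt) => -[t' x'] /= t'0 [/=]; lra.
    have [xB|xB] := ltP 0 (`|x - x1| - B * t).
      by apply: filterS (cvgr_gt _ (cn (t, x)) _ xB) => -[t' x'] /= t'0 [/=]; lra.
    have xBt : `|x - x1| <= B * tau.
      by rewrite (@le_trans _ _ (B * t)) ?ler_wpM2l //; lra.
    have [cu _ _ _] := Hu x xBt.
    have cg : (fun z : R * 'rV[R]_m => u z.2 - expR (lam * z.1) * u x1) @ (t, x) -->
        u x - expR (lam * t) * u x1.
      have c2 : continuous (snd : R * 'rV[R]_m -> 'rV[R]_m) by move=> z; exact: cvg_snd.
      apply: cvgB; first exact: (@continuous_comp _ _ _ snd u (t, x) (c2 _) cu).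
      apply: cvgMr_tmp.
      by apply: (@continuous_comp _ _ _ (fun z : R * 'rV[R]_m => lam * z.1) (@expR R) (t, x));
        [apply: cvgMl_tmp; exact: c1|exact: continuous_expR].
    have [ug|ug] := ltP (u x - expR (lam * t) * u x1) 0.
      by apply: filterS (cvgr_lt _ cg _ ug) => -[t' x'] /= t'0 [/=]; lra.
    by exfalso; apply: nA; split=> //=; lra.
  move=> [t x] /= [t0 tt xB _]; split=> /=; first by rewrite in_itv /= t0.
  rewrite closed_ballE //=; last by rewrite ltr_wpDl // mulr_ge0.
  rewrite /closed_ball_ /= distrC (le_trans xB) // (@le_trans _ _ (B * tau)) ?ler_wpM2l //.
  lra.
have A0 : A !=set0.
  by exists (0, x1); split=> //=; rewrite ?subrr ?normr0 ?mulr0 // expR0 mul1r.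
have [|[t x] /set_mem [/= t0 tt xB ux] tmax] := @compact_EVT_max _ R fst A A0 cA.
  by apply: continuous_subspaceT => z; exact: cvg_fst.
have [tlt|tge] := ltP t tau; last first.
  have -> : tau = t by apply/eqP; rewrite eq_le tge tt.
  by exists x.
have xBt : `|x - x1| <= B * tau by rewrite (le_trans xB) // ler_wpM2l.
have [_ YB du uD] := Hu x xBt.
have u0 : 0 < u x by apply: lt_le_trans ux; rewrite mulr_gt0 // expR_gt0.
exfalso.
pose g h := u (h *: Y x + x) - expR (lam * h) * u x.
have dg : is_derive (0 : R) (1 : R) g ('D_(Y x) (u : _ -> R^o) x - lam * u x).
  exact: (is_deriveB (is_derive_line0 du) (is_derive_expRM lam (u x))).
have g0 : g 0 = 0 by rewrite /g scale0r add0r mulr0 expR0 mul1r subrr.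
have H := derive_gt_near dg (c := 0).
have {H} H : \forall h \near 0^'+, 0 < g h.
  apply: filterS (H _); last by rewrite subr_gt0 uD.
  by move=> h; rewrite g0 mulr0 addr0.
have : \forall h \near 0^'+, A (t + h, h *: Y x + x).
  near=> h.
  have h0 : 0 < h by near: h; exact: nbhs_right_gt.
  split=> /=.
  - by rewrite addr_ge0 // ltW.
  - rewrite -lerBrDl; near: h; apply: nbhs_right_le; lra.
  - rewrite -addrA (le_trans (ler_normD _ _)) // normrZ gtr0_norm // mulrDr [leRHS]addrC lerD //.
      by rewrite mulrC ler_wpM2r // ltW.
  - have : 0 < g h by near: h.
    rewrite /g subr_gt0 => /ltW; apply: le_trans.
    by rewrite mulrDr addrC expRD -mulrA ler_wpM2l // expR_ge0.
move=> H2.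
have [h [h0 Ah]] : exists h : R, 0 < h /\ A (t + h, h *: Y x + x).
  near (0 : R)^'+ => h; exists h; split; first by [].
  by near: h.
have /= := tmax (t + h, h *: Y x + x) (mem_set Ah).
lra.
Unshelve. all: end_near. Qed.

(** * Growth of sections along i xi_M *)

Section Pairing.
Variables (R : realType) (m : nat).

Lemma pairing_continuous (eta : 'rV[R]_m) : continuous (fun v : 'rV[R]_m => pairing v eta).
Proof.
move=> v; suff : (fun v : 'rV[R]_m => pairing v eta) @ nbhs v --> pairing v eta by [].
rewrite /pairing; under eq_fun do rewrite mxE; rewrite mxE.
apply: (@cvg_seq_sum _ _ (nbhs v)) => i _.
by apply: cvgM; [exact: coord_continuous|exact: cvg_cst].
Qed.

Lemma pairing_gt0 (v : 'rV[R]_m) : v != 0 -> 0 < pairing v v.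
Proof.
move=> v0; rewrite /pairing mxE lt_neqAle eq_sym; apply/andP; split; last first.
  by apply: sumr_ge0 => i _; rewrite mxE -expr2 sqr_ge0.
apply: contra v0; rewrite psumr_eq0 => [|i _]; last by rewrite mxE -expr2 sqr_ge0.
move=> /allP H; apply/eqP/rowP => i; have := H i (mem_index_enum _).
by rewrite !mxE /= -expr2 sqrf_eq0 => /eqP.
Qed.

End Pairing.

Section MassDerivative.
Variables (R : realType) (n : nat).
Local Notation C := (Cx R).

Lemma cderiv_affine (a b : C) : cderiv (fun t => ((t%:C)%C : C) * a + b) a.
Proof.
have dR : cderiv (fun t : R => (t%:C)%C) 1.
  split.
    by have -> : (fun t : R => reC (t%:C)%C) = id by []; exact: is_derive_id.
  by have -> : (fun t : R => imC (t%:C)%C) = (fun=> 0) by []; exact: is_derive_cst.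
have := cderivD (cderivM dR (cderiv_cst a)) (cderiv_cst b).
by rewrite mul1r mulr0 !addr0.
Qed.

Lemma is_derive_sqmod_holo (F : 'rV[C]_n -> C) (x Y : 'rV[R]_(n + n)) :
  differentiable (F : _ -> C^o) (of_real x) ->
  is_derive x Y ((fun y => sqmod (F (of_real y))) : _ -> R^o)
    (2 * reC ((F (of_real x))^* * 'd (F : _ -> C^o) (of_real x) (of_real Y))).
Proof.
move=> dF; apply: is_derive_of_line.
pose z (t : R) : 'rV[C]_n := of_real (t *: Y + x).
have z0 : z 0 = of_real x by rewrite /z scale0r add0r.
have dz i : cderiv (fun t => z t 0 i) (of_real Y 0 i).
  apply: cderiv_eq (cderiv_affine (of_real Y 0 i) (of_real x 0 i)) _ _ => // t.
  by rewrite /z of_realD of_realZ !mxE.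
have dF' : differentiable (F : _ -> C^o) (z 0) by rewrite z0.
have [d1 d2] := cderiv_comp_holo dF' dz.
rewrite z0 in d1 d2.
have -> : (fun h : R => sqmod (F (of_real (h *: Y + x)))) =
   (fun t => reC (F (z t))) ^+ 2 + (fun t => imC (F (z t))) ^+ 2.
  by apply/funext => t; rewrite fctE /sqmod.
apply: (is_derive_eq (is_deriveD (is_deriveX 2 d1) (is_deriveX 2 d2))).
rewrite z0 reCM reC_conj imC_conj /GRing.scale /=; ring.
Qed.

End MassDerivative.

Section FrameDerivative.
Variables (R : realType) (n : nat) (M : ptopologicalType) (AM : set (chart M 'rV[Cx R]_n)).
Variables (fr : frame_family R M) (hL : M -> R).
Hypotheses (HA : is_atlas AM) (HL : line_bundle AM fr) (HhL : hermitian_metric AM fr hL).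
Variables (c : chart M 'rV[Cx R]_n) (U : set M) (e : M -> Cx R).
Hypotheses (Ac : AM c) (fU : fr (U, e)).
Local Notation C := (Cx R).
Local Notation psi := (cinv (real_chart c)).
Local Notation H := (frame_norm hL c e).
Local Notation ii := (mkC 0 1 : C).

(** In the direction iX the derivative of log H is - 2 Im a(X), where a = d' log H
    is the connection form. *)
Lemma is_derive_frame_norm (x : 'rV[R]_(n + n)) (X : 'rV[C]_n) : coord_dom c U x ->
  is_derive x (to_real (ii *: X)) (H : _ -> R^o) (- 2 * imC (conn_form c e hL x X) * H x).
Proof.
move=> Dx.
have sH := frame_norm_smooth HhL Ac fU.
have H0 y : coord_dom c U y -> 0 < H y := @frame_norm_gt0 _ _ _ _ _ _ HA HL HhL _ _ _ Ac fU y.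
have dH : derivable (H : _ -> R^o) x (to_real (ii *: X)) := smooth_derivable sH Dx.
suff <- : 'D_(to_real (ii *: X)) (H : _ -> R^o) x = - 2 * imC (conn_form c e hL x X) * H x by exact: derivableP.
rewrite (derive_sum_delta _ (open_coord_dom HA HL Ac fU) (sH 1%N) Dx) big_split_ord /=.
have Hn : H x != 0 by rewrite gt_eqF // H0.
have dln v : 'D_v (log_norm c e hL : _ -> R^o) x = 'D_v (H : _ -> R^o) x / H x.
  exact: (derive_lnE sH H0 v Dx).
rewrite /conn_form (big_morph (@imC R) (@imCD R) (@imC0 R)) mulr_sumr mulr_suml -big_split /=.
apply: eq_bigr => i _.
rewrite !row_mxEl !row_mxEr !mxE imCM !reC_mkC !imC_mkC reCM imCM !reC_mkC !imC_mkC /ddx /ddy !dln.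
move: Hn; move: (reC _) (imC _) ('D_ _ _ _) ('D_ _ _ _) (H x) => X1 X2 y1 y2 h h0; by field.
Qed.

Lemma is_derive_frame_mass k (F : 'rV[C]_n -> C) (x : 'rV[R]_(n + n)) (X : 'rV[C]_n) :
  coord_dom c U x -> differentiable (F : _ -> C^o) (of_real x) ->
  is_derive x (to_real (ii *: X)) ((fun y => sqmod (F (of_real y)) * H y ^+ k) : _ -> R^o)
    (H x ^+ k * (2 * reC ((F (of_real x))^* * (ii * 'd (F : _ -> C^o) (of_real x) X))
                 - 2 * k%:R * imC (conn_form c e hL x X) * sqmod (F (of_real x)))).
Proof.
move=> Dx dF.
have d1 := is_derive_sqmod_holo (to_real (ii *: X)) dF.
have d2 := is_derive_frame_norm X Dx.
rewrite to_realK linearZ /= in d1.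
have -> : (fun y => sqmod (F (of_real y)) * H y ^+ k) =
  ((fun y => sqmod (F (of_real y))) : _ -> R^o) * (H : _ -> R^o) ^+ k.
  by apply/funext => y; rewrite [in RHS]/GRing.mul /= exprfctE.
apply: is_derive_eq.
rewrite /GRing.scale /= exprfctE; set D := reC _; set a := imC _; set m := sqmod _.
case: k => [|k]; rewrite ?exprS /=; ring.
Qed.

End FrameDerivative.

Section FlowIdentity.
Variables (R : realType) (n : nat) (M : ptopologicalType) (AM : set (chart M 'rV[Cx R]_n)).
Variables (fr : frame_family R M) (hL : M -> R).
Hypotheses (HA : is_atlas AM) (HL : line_bundle AM fr) (HhL : hermitian_metric AM fr hL).
Variables (d : nat) (G : topGroupType) (AG : set (chart G 'rV[R]_d)).
Hypothesis (HG : lie_group AG).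
Variables (c1 : chart G 'rV[R]_d) (Hc1 : AG c1) (Hc11 : cdom c1 1%g).
Variables (mu : G -> M -> M) (Hmu : holo_action AG AM mu).
Variables (j : G -> M -> Cx R) (Hj : holo_lift AG AM fr mu j).
Variables (Phi : M -> 'rV[R]_d) (HPhij : moment_of_lift c1 AM fr hL mu j Phi).
Variable xi : 'rV[R]_d.
Local Notation C := (Cx R).
Local Notation gam := (curve1 c1 xi).
Variables (N : nat) (b : 'I_N -> 'I_N -> R -> C) (db : 'I_N -> 'I_N -> C).
Hypothesis b_cderiv : forall m l, cderiv (b m l) (db m l).

(** Sections S_m of L^k whose translates by the curve gam are combinations of
    the S_l, with coefficients b that do not depend on k. *)
Definition flow_family k (S : 'I_N -> M -> C) : Prop :=
  (forall m, holo_section AM fr k (S m)) /\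
  forall m t q, section_act mu j k (gam t)^-1%g (S m) q = \sum_l b m l t * S l q.

(** Both sides are the derivative at 0 of F_m along the orbit of q: by the chain
    rule, and by the equivariance of [frame_section_act], where the derivative of
    J is given by the moment map. *)
Lemma flow_differential (c : chart M 'rV[C]_n) U e k S m q :
  AM c -> fr (U, e) -> flow_family k S -> cdom c q -> U q ->
  'd (frame_fun c e k (S m) : _ -> C^o) (cmap c q) (ind_field c1 mu c xi q) =
  - (k%:R * (conn_form c e hL (cmap (real_chart c) q) (ind_field c1 mu c xi q)
             + mkC 0 (2 * pi * pairing (Phi q) xi))) * frame_fun c e k (S m) (cmap c q)
  + \sum_l db m l * frame_fun c e k (S l) (cmap c q).
Proof.
move=> Ac fU [hS eS] cq Uq.
have := HPhij xi fU Ac Uq cq => /= HJ.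
have dJ := lift_curve_cderiv HA Hc1 Hc11 Hmu Hj xi Ac fU cq Uq.
have J0 := lift_curve0 HL HG Hc1 Hc11 Hmu Hj xi fU Uq.
have dz := orbit_cderiv HA Hc1 Hc11 Hmu xi Ac cq Uq.
have z0 : cmap c (mu (gam 0) q) = cmap c q by rewrite (curve1_0 HG Hc1 Hc11) (mu1 Hmu).
have dF : differentiable (frame_fun c e k (S m) : _ -> C^o) (cmap c (mu (gam 0) q)).
  by rewrite z0; apply: (frame_fun_differentiable Ac fU (hS m)); exists q.
have := cderiv_comp_holo dF dz; rewrite z0 => D1.
have D2 := cderivM (cderivX k J0 dJ)
   (@cderiv_sum R _ (index_enum 'I_N) (fun l t => frame_fun c e k (S l) (cmap c q) * b m l t) _
      (fun l => cderivZ _ (b_cderiv m l))).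
have E : \forall t \near (0 : R), frame_fun c e k (S m) (cmap c (mu (gam t) q)) =
    lift_curve c1 mu j xi e q t ^+ k *
    \sum_l frame_fun c e k (S l) (cmap c q) * b m l t.
  apply: filterS (near_orbit HA HL HG Hc1 Hc11 Hmu xi Ac fU cq Uq) => t [ct Ut].
  rewrite (frame_section_act HA HL Hj k (S m) Ac fU cq Uq ct Ut); congr (_ * _).
  have [_ _ cK _ _] := HA.1 c Ac.
  rewrite /frame_fun eS mulr_suml; apply: eq_bigr => l _; by rewrite -mulrA mulrC.
have := cderiv_unique D1 (cderiv_near E D2) => ->.
rewrite J0 expr1n mul1r -HJ mulrN opprK.
congr (_ + _); last by apply: eq_bigr => l _; rewrite mulrC.
by congr (_ * _); have := nbhs_singleton E; rewrite J0 expr1n mul1r z0 => ->.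
Qed.

Local Notation psi c := (cinv (real_chart c)).
Local Notation ii := (mkC 0 1 : C).

(** The direction i xi_M, along which squared norms grow. *)
Definition flow_dir (c : chart M 'rV[C]_n) (x : 'rV[R]_(n + n)) : 'rV[R]_(n + n) :=
  to_real (ii *: of_real (real_field c1 mu xi c x)).

Definition frame_mass (c : chart M 'rV[C]_n) (e : M -> C) k (s : M -> C) (x : 'rV[R]_(n + n)) : R :=
  sqmod (frame_fun c e k s (of_real x)) * frame_norm hL c e x ^+ k.

Lemma frame_massE (c : chart M 'rV[C]_n) U e k s x : AM c -> fr (U, e) -> coord_dom c U x ->
  frame_mass c e k s x = norm2 hL k s (psi c x).
Proof.
move=> Ac fU Dx; have [cx Ux Ex] := coord_psi HA Ac Dx.
by rewrite (norm2_frame hL HA HL Ac fU k s cx Ux) /frame_mass Ex -{1}Ex /= to_realK.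
Qed.

(** The connection form enters through dF_m and through H^k with opposite
    signs and disappears; what remains is the moment map and the error due to the
    matrix db. *)
Lemma is_derive_flow_mass (c : chart M 'rV[C]_n) U e k S m x :
  AM c -> fr (U, e) -> flow_family k S -> coord_dom c U x ->
  is_derive x (flow_dir c x) (frame_mass c e k (S m) : _ -> R^o)
    (frame_norm hL c e x ^+ k *
      (4 * pi * k%:R * pairing (Phi (psi c x)) xi * sqmod (frame_fun c e k (S m) (of_real x))
       + 2 * reC ((frame_fun c e k (S m) (of_real x))^* *
                  (ii * \sum_l db m l * frame_fun c e k (S l) (of_real x))))).
Proof.
move=> Ac fU HS Dx; have [cx Ux Ex] := coord_psi HA Ac Dx.
have zx : cmap c (psi c x) = of_real x by rewrite -{2}Ex /= to_realK.
have dF : differentiable (frame_fun c e k (S m) : _ -> C^o) (of_real x).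
  by rewrite -zx; apply: (frame_fun_differentiable Ac fU (HS.1 m)); exists (psi c x).
have D := is_derive_frame_mass HA HL HhL Ac fU k (of_real (real_field c1 mu xi c x)) Dx dF.
have := flow_differential m Ac fU HS cx Ux; rewrite Ex zx (ind_fieldE c1 mu xi Dx) => dE.
rewrite dE in D; apply: is_derive_eq; congr (_ * _).
move: (frame_fun c e k (S m) (of_real x)) (\sum_(l < N) _) (conn_form _ _ _ _ _) => F E a.
have rk : reC (k%:R : C) = k%:R by rewrite -(rmorph_nat (real_complex R)).
have ik : imC (k%:R : C) = 0 by rewrite -(rmorph_nat (real_complex R)).
rewrite !(reCM, imCM, reCD, imCD, reCN, imCN, reC_conj, imC_conj, reC_mkC, imC_mkC) rk ik /sqmod.
ring.
Qed.

(** The error term is bounded below by a constant, independent of k, times the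
    total mass. *)
Lemma flow_error_le (F : 'I_N -> C) :
  - (2 * \sum_m \sum_l cabs (db m l)) * \sum_m sqmod (F m) <=
  \sum_m 2 * reC ((F m)^* * (ii * \sum_l db m l * F l)).
Proof.
set Q := \sum_m sqmod (F m).
have FQ m l : cabs (F m) * cabs (F l) <= Q.
  have h i : cabs (F i) ^+ 2 <= Q.
    by rewrite sqr_cabs /Q (bigD1 i) //= lerDl sumr_ge0 // => ? _; exact: sqmod_ge0.
  have amgm (x y q : R) : x ^+ 2 <= q -> y ^+ 2 <= q -> x * y <= q.
    by have := sqr_ge0 (x - y); nra.
  exact: amgm (h m) (h l).
rewrite mulNr lerNl -sumrN -mulrA mulr_suml mulr_sumr; apply: ler_sum => m _.
rewrite -mulrN ler_pM2l //.
apply: (@le_trans _ _ `|reC ((F m)^* * (ii * \sum_l db m l * F l))|).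
  by rewrite -normrN ler_norm.
apply: le_trans (reC_le _) _.
have i1 : cabs ii = 1 by rewrite /cabs /sqmod reC_mkC imC_mkC expr0n expr1n add0r sqrtr1.
rewrite !cabsM i1 mul1r cabs_conj.
apply: (@le_trans _ _ (cabs (F m) * \sum_l cabs (db m l * F l))).
  by rewrite ler_wpM2l ?cabs_ge0 ?cabs_sum.
rewrite mulr_sumr mulr_suml; apply: ler_sum => l _.
by rewrite cabsM mulrCA ler_wpM2l ?cabs_ge0.
Qed.

Lemma frame_mass_continuous (c : chart M 'rV[C]_n) U e k s x :
  AM c -> fr (U, e) -> holo_section AM fr k s -> coord_dom c U x ->
  {for x, continuous (frame_mass c e k s)}.
Proof.
move=> Ac fU Hs Dx; suff : frame_mass c e k s y @[y --> x] --> frame_mass c e k s x by [].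
have Dz : ccoord_dom c U (of_real x) by apply/(coord_domP c U).
have cF : frame_fun c e k s (of_real y) @[y --> x] --> frame_fun c e k s (of_real x).
  apply: (@continuous_comp _ _ _ (@of_real R n) (frame_fun c e k s) x).
    exact: of_real_continuous.
  exact: (frame_fun_continuous Ac fU Hs Dz).
apply: (cvgM (cvgC_sqmod cF)).
apply: (@continuous_comp _ _ _ (frame_norm hL c e) (fun t => t ^+ k) x).
  exact: (frame_norm_continuous HhL Ac fU Dx).
exact: exprn_continuous.
Qed.

Definition family_mass (c : chart M 'rV[C]_n) (e : M -> C) k (S : 'I_N -> M -> C) (x : 'rV[R]_(n + n)) : R :=
  \sum_m frame_mass c e k (S m) x.

(** Half of the rate 4 pi k phi0 is kept, the other half absorbs the error. *)
Lemma flow_mass_growth (c : chart M 'rV[C]_n) U e k S x (phi0 : R) :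
  AM c -> fr (U, e) -> flow_family k S -> coord_dom c U x ->
  phi0 <= pairing (Phi (psi c x)) xi ->
  2 * \sum_m \sum_l cabs (db m l) < 2 * pi * k%:R * phi0 ->
  [/\ {for x, continuous (family_mass c e k S)},
      derivable (family_mass c e k S : _ -> R^o) x (flow_dir c x) &
      0 < family_mass c e k S x ->
      2 * pi * k%:R * phi0 * family_mass c e k S x <
      'D_(flow_dir c x) (family_mass c e k S : _ -> R^o) x].
Proof.
move=> Ac fU HS Dx phix kbig.
have D m := is_derive_flow_mass m Ac fU HS Dx.
have [d1 d2] := @is_derive_sum _ _ _ N (fun m => frame_mass c e k (S m) : _ -> R^o) x (flow_dir c x) _ D.
have E : family_mass c e k S = \sum_m (frame_mass c e k (S m) : _ -> R^o).
  by apply/funext => y; rewrite /family_mass fct_sumE.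
split; first 1 last.
- by rewrite E.
- rewrite E d2 => m0; rewrite -mulr_sumr big_split /= -mulr_sumr -E.
  have hk : 0 < frame_norm hL c e x ^+ k by rewrite exprn_gt0 // (frame_norm_gt0 HA HL HhL Ac fU).
  have Em : family_mass c e k S x = frame_norm hL c e x ^+ k * \sum_m sqmod (frame_fun c e k (S m) (of_real x)).
    by rewrite mulr_sumr; apply: eq_bigr => m _; rewrite mulrC.
  rewrite -E Em in m0 *; have Q0 := m0; rewrite pmulr_rgt0 // in Q0.
  rewrite mulrCA ltr_pM2l //.
  have := flow_error_le (fun m => frame_fun c e k (S m) (of_real x)).
  move: kbig Q0; set K := 2 * \sum_m _; set Q := \sum_m sqmod _; set Er := \sum_m _ => kbig Q0 HE.
  have pk : 0 <= 4 * pi * k%:R :> R by rewrite !mulr_ge0 ?pi_ge0.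
  have h1 : 4 * pi * k%:R * phi0 * Q <= 4 * pi * k%:R * pairing (Phi (psi c x)) xi * Q.
    by rewrite ler_pM2r // ler_wpM2l.
  have h2 : K * Q < 2 * pi * k%:R * phi0 * Q by rewrite ltr_pM2r.
  move: h1 h2 HE; rewrite mulNr /=; lra.
- apply: (@cvg_seq_sum _ _ (nbhs x) _ _ _ _ (fun m => frame_mass c e k (S m))
    (fun m => frame_mass c e k (S m) x)) => m _.
  exact: (frame_mass_continuous Ac fU (HS.1 m) Dx).
Qed.

(** Near p the growth lemma can be applied for a fixed time tau within a fixed
    coordinate ball, and its end point has total mass at most N A. *)
Lemma flow_family_decay p : smooth_fun (real_atlas AM) setT Phi -> 0 < pairing (Phi p) xi ->
  exists (a : R) (k1 : nat), 0 < a /\ \forall q \near p, forall k, (k1 <= k)%N ->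
    forall S A, flow_family k S -> (forall m x, norm2 hL k (S m) x <= A) ->
    \sum_m norm2 hL k (S m) q <= N%:R * A * expR (- (a * k%:R)).
Proof.
move=> sPhi Pp0.
have [c Ac cp] := HA.2 p.
have [U [e [fU Up]]] : exists U e, fr (U, e) /\ U p by have [_ h _] := HL; exact: h.
set x0 := cmap (real_chart c) p.
have Dx0 : coord_dom c U x0 := coord_cmap cp Up.
have px0 : psi c x0 = p := psi_cmap HA Ac cp.
pose phi x := pairing (Phi (psi c x)) xi.
have cphi : {for x0, continuous phi}.
  apply: (@continuous_comp _ _ _ (Phi \o psi c) (fun v => pairing v xi) x0); last exact: pairing_continuous.
  have im : (cmap (real_chart c) @` (cdom (real_chart c) `&` setT)) x0 by exists p.
  by have := sPhi (real_chart c) _ 0%N x0 im; apply; exists c.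
have phi0 : 0 < phi x0 by rewrite /phi px0.
(* The pairing stays above p0, and the directions are bounded by Bd, on a ball of
   radius 2 del; a path of length del starting within del of x0 stays inside. *)
set p0 := phi x0 / 2.
have p00 : 0 < p0 by rewrite divr_gt0.
have N1 : \forall x \near x0, p0 <= phi x.
  have : \forall t \near phi x0, p0 <= t.
    by apply: lt_le_nbhsr; rewrite /p0 ltr_pdivrMr // mulr_natr mulr2n ltrDl.
  exact: cphi.
have [_ cX] := Psi_smooth HA Hc1 Hc11 Hmu xi Ac Dx0.
set t0 := `|real_field c1 mu xi c x0| + 1.
have t00 : 0 < t0 by rewrite ltr_wpDl.
have N2 : \forall x \near x0, `|real_field c1 mu xi c x| <= t0.
  have cn : `|real_field c1 mu xi c x| @[x --> x0] --> `|real_field c1 mu xi c x0| by exact: (cvg_norm cX).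
  have : \forall t \near `|real_field c1 mu xi c x0|, t <= t0.
    by apply: lt_le_nbhsl; rewrite ltrDl.
  exact: cn.
have [del d0 Hd] : exists2 del : R, 0 < del & forall x, `|x - x0| <= del + del ->
    [/\ coord_dom c U x, p0 <= phi x & `|real_field c1 mu xi c x| <= t0].
  have : \forall x \near x0, [/\ coord_dom c U x, p0 <= phi x & `|real_field c1 mu xi c x| <= t0].
    by near=> x; split; near: x => //; exact: (near_coord_dom HA HL Ac fU Dx0).
  move=> /nbhs_ballP[r /= r0 Hr]; exists (r / 3); first by rewrite divr_gt0.
  move=> x xr; apply: Hr; rewrite -ball_normE /= distrC; apply: le_lt_trans xr _.
  lra.
set Bd := 2 * t0; have Bd0 : 0 < Bd by rewrite mulr_gt0.
set tau := del / Bd; have tau0 : 0 < tau by rewrite divr_gt0.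
have Bt : Bd * tau = del by rewrite mulrC divfK // gt_eqF.
set K := 2 * \sum_m \sum_l cabs (db m l).
set g := 2 * pi * p0; have g0 : 0 < g by rewrite !mulr_gt0 // pi_gt0.
exists (g * tau), (Num.truncn (K / g)).+1; split; first by rewrite mulr_gt0.
have N3 : \forall q \near p, `|cmap (real_chart c) q - x0| < del.
  have : \forall x \near x0, `|x - x0| < del.
    by apply/nbhs_ballP; exists del => //= x; rewrite -ball_normE /= distrC.
  exact: (cmap_continuous HA Ac cp).
apply: filterS (filterI (near_chart HA HL Ac fU cp Up) N3) => q [[cq Uq] xq] k kk S A HS HSA.
have kbig : K < 2 * pi * k%:R * p0.
  have : K / g < k%:R.
    by apply: lt_le_trans (truncnS_gt _) _; rewrite ler_nat.
  by rewrite ltr_pdivrMr // /g; move=> h; apply: lt_le_trans h _; rewrite mulrC mulrAC.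
set x1 := cmap (real_chart c) q in xq.
have Dx1 : coord_dom c U x1 := coord_cmap cq Uq.
have qx1 : psi c x1 = q := psi_cmap HA Ac cq.
have mE x : coord_dom c U x -> family_mass c e k S x = \sum_m norm2 hL k (S m) (psi c x).
  by move=> Dx; apply: eq_bigr => m _; exact: (frame_massE k (S m) Ac fU Dx).
have mA x : coord_dom c U x -> family_mass c e k S x <= N%:R * A.
  move=> Dx; rewrite mE //; apply: (@le_trans _ _ (\sum_(m < N) A)).
    by apply: ler_sum => m _; exact: HSA.
  by rewrite sumr_const card_ord mulr_natl.
rewrite -qx1 -mE //.
have NA0 : 0 <= N%:R * A.
  by have := mA _ Dx1; apply: le_trans; rewrite mE // sumr_ge0 // => m _; exact: (norm2_ge0 HhL).
have [m0|m0] := leP (family_mass c e k S x1) 0.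
  by apply: le_trans m0 _; rewrite mulr_ge0 // expR_ge0.
have near1 x : `|x - x1| <= Bd * tau -> `|x - x0| <= del + del.
  rewrite Bt => h; rewrite -(subrK x1 x) -addrA; apply: le_trans (ler_normD _ _) _.
  by rewrite lerD // ltW.
have [|||x xx1 Hx] := @growth_along_directions R _ (family_mass c e k S) (flow_dir c) x1 Bd tau
  (2 * pi * k%:R * p0) _ _ _ m0.
- exact: ltW.
- exact: ltW.
- move=> x /near1/Hd[Dx px tx].
  have [h1 h2 h3] := flow_mass_growth Ac fU HS Dx px kbig.
  split => //; apply: le_trans (to_real_scale_le _ tx) _.
  by rewrite /cabs /sqmod reC_mkC imC_mkC expr0n expr1n add0r sqrtr1 mul1r.
have [Dx _ _] := Hd _ (near1 _ xx1).
have := le_trans Hx (mA _ Dx).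
rewrite expRN mulrC ler_pdivlMr ?expR_gt0 //.
by have -> : 2 * pi * k%:R * p0 * tau = g * tau * k%:R by rewrite /g; ring.
Unshelve. all: end_near. Qed.

End FlowIdentity.

(** * Isotypical sections *)

Lemma linear_mx_entry (K : fieldType) r N (f : 'M[K]_r -> 'rV[K]_N) l :
  (forall a A B, f (a *: A + B) = a *: f A + f B) ->
  forall A, f A 0 l = \sum_a \sum_b A a b * f (delta_mx a b) 0 l.
Proof.
move=> fL A.
have f0 : f 0 = 0 by have := fL (-1) 0 0; rewrite scaler0 addr0 scaleN1r addNr.
have fD B C : f (B + C) = f B + f C by have := fL 1 B C; rewrite !scale1r.
have fZ a B : f (a *: B) = a *: f B by have := fL a B 0; rewrite f0 !addr0.
rewrite {1}(matrix_sum_delta A) (big_morph f fD f0) summxE; apply: eq_bigr => a _.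
rewrite (big_morph f fD f0) summxE; apply: eq_bigr => b _.
by rewrite fZ mxE.
Qed.

Section Isotypical.
Variables (R : realType) (n : nat) (M : ptopologicalType) (AM : set (chart M 'rV[Cx R]_n)).
Variables (fr : frame_family R M) (hL : M -> R).
Hypotheses (HA : is_atlas AM) (HL : line_bundle AM fr) (HhL : hermitian_metric AM fr hL).
Local Notation C := (Cx R).

Lemma holo_section0 k : holo_section AM fr k (fun=> 0).
Proof.
move=> U e fU c Ac z zU.
have -> : (fun p => 0 / e p ^+ k) \o cinv c = cst 0 by apply/funext => q; rewrite /= mul0r.
exact: differentiable_cst.
Qed.

Lemma holo_sectionD k s t : holo_section AM fr k s -> holo_section AM fr k t ->
  holo_section AM fr k (fun p => s p + t p).
Proof.
move=> hs ht U e fU c Ac z zU.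
have -> : (fun p => (s p + t p) / e p ^+ k) \o cinv c =
   ((fun p => s p / e p ^+ k) \o cinv c : _ -> C^o) + ((fun p => t p / e p ^+ k) \o cinv c : _ -> C^o).
  by apply/funext => q; rewrite /= mulrDl.
exact: (differentiableD (hs _ _ fU _ Ac _ zU) (ht _ _ fU _ Ac _ zU)).
Qed.

Lemma holo_section_sum k (I : Type) (r : seq I) (s : I -> M -> C) :
  (forall i, holo_section AM fr k (s i)) ->
  holo_section AM fr k (fun p => \sum_(i <- r) s i p).
Proof.
move=> hs; elim: r => [|i r IH].
  by have -> : (fun p => \sum_(i <- [::]) s i p) = (fun=> 0 : C);
    [apply/funext => p; rewrite big_nil|exact: holo_section0].
have -> : (fun p => \sum_(j <- i :: r) s j p) = (fun p => s i p + \sum_(j <- r) s j p).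
  by apply/funext => p; rewrite big_cons.
exact: holo_sectionD.
Qed.

Variables (d : nat) (G : topGroupType) (AG : set (chart G 'rV[R]_d)).
Hypothesis (HG : lie_group AG).
Variables (c1 : chart G 'rV[R]_d) (Hc1 : AG c1) (Hc11 : cdom c1 1%g).
Variables (mu : G -> M -> M) (Hmu : holo_action AG AM mu).
Variables (j : G -> M -> Cx R) (Hj : holo_lift AG AM fr mu j).
Hypothesis Hinv : metric_invariant mu j hL.
Variables (r : nat) (rho : G -> 'M[Cx R]_r) (Hrho : irreducible_rep rho).

Lemma norm2_section_act k g s q :
  norm2 hL k (section_act mu j k g s) q = norm2 hL k s (mu g^-1%g q).
Proof.
have [[m1 mM] _ _] := Hmu.
rewrite /norm2 /section_act sqmodM sqmodX -(Hinv g (mu g^-1%g q)) -mM mulgV m1 exprMn; ring.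
Qed.

Lemma intertwiner_sum k T (I : Type) (s : seq I) (a : I -> C) (w : I -> 'cV[C]_r) p :
  intertwiner AM fr mu j rho k T ->
  T (\sum_(i <- s) a i *: w i) p = \sum_(i <- s) a i * T (w i) p.
Proof.
move=> HT; have [_ H _] := HT; elim: s => [|i s IH].
  by rewrite !big_nil (intertwiner0 HT).
by rewrite !big_cons H IH.
Qed.

Lemma isotypical_holo k s : isotypical AM fr mu j rho k s -> holo_section AM fr k s.
Proof.
move=> [l [T [v [HT /funext ->]]]]; apply: holo_section_sum => i.
by have [h _ _] := HT i; exact: h.
Qed.

Lemma isotypicalD k a s t : isotypical AM fr mu j rho k s -> isotypical AM fr mu j rho k t ->
  isotypical AM fr mu j rho k (fun p => a * s p + t p).
Proof.
move=> [l1 [T1 [v1 [HT1 E1]]]] [l2 [T2 [v2 [HT2 E2]]]].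
exists (l1 + l2)%N, (fun i => match fintype.split i with inl i => T1 i | inr i => T2 i end),
  (fun i => match fintype.split i with inl i => a *: v1 i | inr i => v2 i end).
split=> [i|p]; first by case: fintype.split => i'.
rewrite big_split_ord /= E1 E2 mulr_sumr; congr (_ + _); apply: eq_bigr => i _.
  rewrite -[lshift l2 i]/(unsplit (inl i)) unsplitK.
  have [_ H _] := HT1 i; have := H a (v1 i) 0 p.
  by rewrite addr0 (intertwiner0 (HT1 i)) addr0.
by rewrite -[rshift l1 i]/(unsplit (inr i)) unsplitK.
Qed.

Lemma isotypical_sum k (b : nat) (a : 'I_b -> C) (s : 'I_b -> M -> C) :
  (forall i, isotypical AM fr mu j rho k (s i)) ->
  isotypical AM fr mu j rho k (fun p => \sum_i a i * s i p).
Proof.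
move=> Hs; elim: (index_enum _) => [|i I IH].
  exists 0%N, (fun _ _ _ => 0), (fun=> 0).
  by split=> [[]|p] //; rewrite big_nil big_ord0.
have -> : (fun p => \sum_(j <- i :: I) a j * s j p) = (fun p => a i * s i p + \sum_(j <- I) a j * s j p).
  by apply/funext => p; rewrite big_cons.
exact: isotypicalD.
Qed.

Variables (Phi : M -> 'rV[R]_d) (HPhij : moment_of_lift c1 AM fr hL mu j Phi).
Hypothesis sPhi : smooth_fun (real_atlas AM) setT Phi.

(** If there is no nonzero intertwiner for any k, all sections considered
    vanish; otherwise [rep_cderiv] applies.  The family to which [flow_family_decay]
    is applied consists of the translates of s by the elements g_m, of which s is the
    first. *)
Lemma isotypical_decay p : Phi p != 0 ->
  exists (a C0 : R) (k1 : nat), [/\ 0 < a, 0 <= C0 & \forall q \near p, forall k, (k1 <= k)%N ->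
    forall s A, isotypical AM fr mu j rho k s -> (forall x, norm2 hL k s x <= A) ->
    norm2 hL k s q <= C0 * A * expR (- (a * k%:R))].
Proof.
move=> Phi0; set xi := Phi p.
have [_ rho1 rhoM _ _] := Hrho.
have [[k0 [T0 [v0 [p0 [HT0 T00]]]]]|trivial] := pselect (exists k0 T0 v0 p0,
    intertwiner AM fr mu j rho k0 T0 /\ T0 v0 p0 != 0); last first.
  (* No section of this type: any constants will do. *)
  exists 1, 0, 0%N; split=> //; apply: nearW => q k _ s A [l [T [v [HT E]]]] HA'.
  have -> : s = (fun=> 0).
    apply/funext => x; rewrite E big1 // => i _; apply/eqP/negPn/negP => h.
    by apply: trivial; exists k, (T i), (v i), x.
  by rewrite /norm2 !mul0r -sqr_cabs cabs0 expr0n mul0r.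
have [B HB] := rep_cderiv HA HL HG Hc1 Hc11 Hmu Hj xi Hrho HT0 T00.
have [N [g [L [g0 LL HL']]]] := rep_span rhoM.
pose b m l t := L m (rho (curve1 c1 xi t)^-1%g) 0 l.
have db m l : cderiv (b m l) (\sum_x \sum_y B x y * L m (delta_mx x y) 0 l).
  have D := @cderiv_sum R _ (index_enum 'I_r) _ _ (fun x => @cderiv_sum R _ (index_enum 'I_r) _ _
    (fun y => cderivZ (L m (delta_mx x y) 0 l) (HB x y))).
  apply: (cderiv_eq D) => [t|].
    rewrite /b (linear_mx_entry l (LL m)); apply: eq_bigr => x _; apply: eq_bigr => y _.
    by rewrite mulrC.
  by apply: eq_bigr => x _; apply: eq_bigr => y _; rewrite mulrC.
have [a [k1 [a0 near_p]]] := flow_family_decay HA HL HhL HG Hc1 Hc11 Hmu Hj HPhij db sPhi (pairing_gt0 Phi0).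
exists a, N.+1%:R, k1; split => //.
apply: filterS near_p => q Hq k kk s A Hs HsA.
have [l [T [v [HT Es]]]] := Hs.
pose S m x := \sum_i T i (rho (g m) *m v i) x.
have Sact m h x : section_act mu j k h (S m) x = \sum_i T i (rho h *m (rho (g m) *m v i)) x.
  rewrite /section_act /S mulr_sumr; apply: eq_bigr => i _.
  by have [_ _ eT] := HT i; rewrite (eT h).
have S_s m x : S m x = section_act mu j k (g m) s x.
  rewrite /section_act /S Es mulr_sumr; apply: eq_bigr => i _.
  by have [_ _ eT] := HT i; rewrite eT.
have HS : flow_family AM fr c1 mu j xi b k S.
  split=> [m|m t x].
    by apply: holo_section_sum => i; have [h _ _] := HT i; exact: h.
  rewrite Sact /S.
  under [RHS]eq_bigr do rewrite mulr_sumr.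
  rewrite exchange_big /=; apply: eq_bigr => i _.
  rewrite mulmxA HL' mulmx_suml -(intertwiner_sum _ _ _ _ (HT i)).
  by congr (T i _ x); apply: eq_bigr => y _; rewrite -scalemxAl.
have HSA m x : norm2 hL k (S m) x <= A.
  have -> : S m = section_act mu j k (g m) s by apply/funext => y; exact: S_s.
  by rewrite norm2_section_act.
have S0 : S ord0 = s.
  by apply/funext => x; rewrite /S Es g0 rho1; apply: eq_bigr => i _; rewrite mul1mx.
apply: le_trans (Hq k kk S A HS HSA).
rewrite (bigD1 ord0) //= S0 lerDl sumr_ge0 // => m _; exact: (norm2_ge0 HhL).
Qed.

End Isotypical.

(** * Orthonormal bases *)

Section BorelFunctions.
Variables (R : realType) (M : ptopologicalType).

Lemma continuous_borel (f : M -> R) : continuous f ->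
  measurable_fun setT (f : g_sigma_algebraType (@open M) -> R).
Proof.
move=> cf; apply: (measurability _ (RGenOInfty.measurableE R)).
move=> _ [_ [a ->] <-]; rewrite setTI.
by apply: sub_sigma_algebra; apply: open_comp => [x _|]; [exact: cf|exact: rray_open].
Qed.

End BorelFunctions.

Section L2.
Variables (R : realType) (n : nat) (M : ptopologicalType) (AM : set (chart M 'rV[Cx R]_n)).
Variables (fr : frame_family R M) (hL : M -> R).
Hypotheses (HA : is_atlas AM) (HL : line_bundle AM fr) (HhL : hermitian_metric AM fr hL).
Variable (vol : {measure set (g_sigma_algebraType (@open M)) -> \bar R}).
Local Notation C := (Cx R).
Variable k : nat.

Let hk q : 0 <= hL q ^+ k.
Proof. by rewrite exprn_ge0 // ltW //; have [h _] := HhL; exact: h. Qed.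

Lemma norm2E s q : reC (s q * (s q)^*) * hL q ^+ k = norm2 hL k s q.
Proof. by rewrite conj_sqmod reCR. Qed.

Lemma hprod_borel s t : holo_section AM fr k s -> holo_section AM fr k t ->
  measurable_fun setT ((fun q => reC (s q * (t q)^*) * hL q ^+ k) : g_sigma_algebraType (@open M) -> R) /\
  measurable_fun setT ((fun q => imC (s q * (t q)^*) * hL q ^+ k) : g_sigma_algebraType (@open M) -> R).
Proof.
move=> Hs Ht; split; apply: continuous_borel => q;
  have [c Ac cq] := HA.2 q;
  have [U [e [fU Uq]]] : exists U e, fr (U, e) /\ U q by have [_ h _] := HL; exact: h.
  have := @cvgC_re _ _ (nbhs q) (nbhs_filter q) _ _ (hprod_continuous_at HA HL HhL Ac fU Hs Ht cq Uq).
  suff E : (fun q' => reC (s q' * (t q')^* * ((hL q' ^+ k)%:C)%C)) =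
      (fun q' => reC (s q' * (t q')^*) * hL q' ^+ k).
    by rewrite E; move: (congr1 (fun h => h q) E) => /= ->.
  by apply/funext => q'; rewrite reCM reCR imCR mulr0 subr0.
have := @cvgC_im _ _ (nbhs q) (nbhs_filter q) _ _ (hprod_continuous_at HA HL HhL Ac fU Hs Ht cq Uq).
suff E : (fun q' => imC (s q' * (t q')^* * ((hL q' ^+ k)%:C)%C)) =
    (fun q' => imC (s q' * (t q')^*) * hL q' ^+ k).
  by rewrite E; move: (congr1 (fun h => h q) E) => /= ->.
by apply/funext => q'; rewrite imCM reCR imCR mulr0 add0r.
Qed.

(** The real-valued integral of a non-integrable function is 0 by convention; the
    value 1 thus forces integrability. *)
Lemma norm2_integrable s : holo_section AM fr k s -> l2_product hL vol k s s = 1 ->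
  vol.-integrable setT (EFin \o norm2 hL k s).
Proof.
move=> Hs; rewrite /l2_product => /(congr1 (@reC R)); rewrite reC_mkC reC1.
have -> : (fun q => reC (s q * (s q)^*) * hL q ^+ k) = norm2 hL k s by apply/funext => q; exact: norm2E.
move=> H; apply/integrableP; split.
  apply/measurable_EFinP; have [h _] := hprod_borel Hs Hs.
  move: h; have -> : (fun q => reC (s q * (s q)^*) * hL q ^+ k) = norm2 hL k s by
    apply/funext => q; exact: norm2E.
  by [].
have -> : (fun x => `|(EFin \o norm2 hL k s) x|)%E = EFin \o norm2 hL k s.
  by apply/funext => q /=; rewrite ger0_norm // (norm2_ge0 HhL).
move: H; rewrite /Rintegral /=; case: (integral _ _ _) => [x _|/eqP|/eqP] /=; rewrite ?ltry //.
all: by rewrite eq_sym oner_eq0.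
Qed.

Lemma hprod_integrable s t : holo_section AM fr k s -> holo_section AM fr k t ->
  vol.-integrable setT (EFin \o norm2 hL k s) -> vol.-integrable setT (EFin \o norm2 hL k t) ->
  vol.-integrable setT (EFin \o (fun q => reC (s q * (t q)^*) * hL q ^+ k)) /\
  vol.-integrable setT (EFin \o (fun q => imC (s q * (t q)^*) * hL q ^+ k)).
Proof.
move=> Hs Ht Is It; have [m1 m2] := hprod_borel Hs Ht.
have Ist := integrableD measurableT Is It.
have bound q : cabs (s q * (t q)^*) * hL q ^+ k <= norm2 hL k s q + norm2 hL k t q.
  rewrite /norm2 -mulrDl ler_wpM2r // cabsM cabs_conj -!sqr_cabs.
  by have := sqr_ge0 (cabs (s q) - cabs (t q)); nra.
have n0 q : `|norm2 hL k s q + norm2 hL k t q| = norm2 hL k s q + norm2 hL k t q.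
  by rewrite ger0_norm // addr_ge0 // (norm2_ge0 HhL).
split; apply: (le_integrable measurableT _ _ Ist); try exact/measurable_EFinP;
  move=> q _ /=; rewrite lee_fin n0; apply: le_trans (bound q);
  rewrite normrM (ger0_norm (hk q)) ler_wpM2r //; [exact: reC_le|exact: imC_le].
Qed.

(** Parseval's identity. *)
Lemma integral_norm2_comb b (s : 'I_b -> M -> C) (a : 'I_b -> C) :
  (forall i, holo_section AM fr k (s i)) ->
  (forall i i', l2_product hL vol k (s i) (s i') = (i == i')%:R) ->
  (\int[vol]_q (norm2 hL k (fun p => \sum_i a i * s i p) q)%:E = (\sum_i sqmod (a i))%:E)%E.
Proof.
move=> Hs on.
have Is i : vol.-integrable setT (EFin \o norm2 hL k (s i)) by apply: norm2_integrable => //; rewrite on eqxx.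
pose f (ij : 'I_b * 'I_b) q := reC (s ij.1 q * (s ij.2 q)^*) * hL q ^+ k.
pose g (ij : 'I_b * 'I_b) q := imC (s ij.1 q * (s ij.2 q)^*) * hL q ^+ k.
pose al (ij : 'I_b * 'I_b) := reC (a ij.1 * (a ij.2)^*).
pose be (ij : 'I_b * 'I_b) := - imC (a ij.1 * (a ij.2)^*).
have fg ij := hprod_integrable (Hs ij.1) (Hs ij.2) (Is ij.1) (Is ij.2).
have E q : norm2 hL k (fun p => \sum_i a i * s i p) q = \sum_ij (al ij * f ij q + be ij * g ij q).
  rewrite -norm2E rmorph_sum /= big_distrlr pair_big /= (big_morph (@reC R) (@reCD R) (@reC0 R)).
  rewrite mulr_suml; apply: eq_bigr => ij _.
  rewrite /al /be /f /g rmorphM /= mulrACA [X in X * _ = _]reCM; ring.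
have If ij : vol.-integrable setT (EFin \o (fun q => al ij * f ij q + be ij * g ij q)).
  have [h1 h2] := fg ij.
  exact: (integrableD measurableT (integrableZl measurableT _ h1) (integrableZl measurableT _ h2)).
have Ival ij : \int[vol]_q (al ij * f ij q + be ij * g ij q) = al ij * (ij.1 == ij.2)%:R.
  have [h1 h2] := fg ij.
  rewrite RintegralD //; last 2 first.
  - exact: (integrableZl measurableT _ h1).
  - exact: (integrableZl measurableT _ h2).
  rewrite !RintegralZl //.
  have [e1 e2] : reC (l2_product hL vol k (s ij.1) (s ij.2)) = (ij.1 == ij.2)%:R /\
     imC (l2_product hL vol k (s ij.1) (s ij.2)) = 0.
    by rewrite on; case: (_ == _).
  by move: e1 e2; rewrite /l2_product reC_mkC imC_mkC => -> ->; rewrite mulr0 addr0.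
under eq_integral do rewrite E -sumEFin.
rewrite integral_sum //.
have -> : (\sum_ij \int[vol]_q (al ij * f ij q + be ij * g ij q)%:E)%E =
    (\sum_ij (al ij * (ij.1 == ij.2)%:R)%:E)%E.
  apply: eq_bigr => ij _; rewrite -Ival /Rintegral fineK //.
  exact: (integrable_fin_num measurableT (If ij)).
rewrite sumEFin; congr (_%:E).
rewrite -(pair_big xpredT xpredT (fun i i' => al (i, i') * (i == i')%:R)) /=.
apply: eq_bigr => i _; rewrite (bigD1 i) //= eqxx mulr1 big1 ?addr0.
  by rewrite /al /= conj_sqmod reCR.
by move=> i' ii'; rewrite eq_sym (negbTE ii') mulr0.
Qed.

End L2.

(** * Decay of the densities *)

Section Bergman.
Variables (R : realType) (n : nat) (M : ptopologicalType) (AM : set (chart M 'rV[Cx R]_n)).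
Variables (fr : frame_family R M) (hL : M -> R).
Hypotheses (HM : projective_manifold AM) (HL : line_bundle AM fr)
  (HhL : hermitian_metric AM fr hL) (HOmega : kahler_curvature AM fr hL).
Variable (vol : {measure set (g_sigma_algebraType (@open M)) -> \bar R}).
Hypothesis (Hvol : volume_measure AM fr hL vol).
Variables (d : nat) (G : topGroupType) (AG : set (chart G 'rV[R]_d)).
Hypothesis (HG : lie_group AG).
Variables (c1 : chart G 'rV[R]_d) (Hc1 : AG c1) (Hc11 : cdom c1 1%g).
Variables (mu : G -> M -> M) (Hmu : holo_action AG AM mu).
Variables (j : G -> M -> Cx R) (Hj : holo_lift AG AM fr mu j).
Hypothesis Hinv : metric_invariant mu j hL.
Variables (Phi : M -> 'rV[R]_d) (HPhij : moment_of_lift c1 AM fr hL mu j Phi).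
Hypothesis sPhi : smooth_fun (real_atlas AM) setT Phi.
Variables (r : nat) (rho : G -> 'M[Cx R]_r) (Hrho : irreducible_rep rho).
Variables (b : nat -> nat) (s : forall k : nat, 'I_(b k) -> M -> Cx R).
Arguments s : clear implicits.
Hypothesis (Hs : forall k, orthonormal_basis hL vol k (isotypical AM fr mu j rho k) (s k)).

Let HA : is_atlas AM. Proof. by have [[_ h _] _ _] := HM. Qed.

(** The section sq below is the one that reproduces evaluation at q; w is the sum
    of the |s_i(q)|^2.  The choice theta^(2n+2) = e^(-a/2) makes the loss of [sup_L2]
    half of the gain. *)
Lemma bergman_decay p : Phi p != 0 -> exists (a C : R) (k1 : nat), [/\ 0 < a, 0 <= C &
  \forall q \near p, forall k, (k1 <= k)%N ->
    \sum_(i < b k) norm2 hL k (s k i) q <= C * expR (- (a * k%:R))].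
Proof.
move=> Phi0.
have [a [C0 [k1 [a0 C00 near_p]]]] :=
  isotypical_decay HA HL HhL HG Hc1 Hc11 Hmu Hj Hinv Hrho HPhij sPhi Phi0.
set m := (n + n).+2.
set theta := expR (- (a / (2 * m%:R))).
have m0 : 0 < m%:R :> R by rewrite ltr0n.
have th : 0 < theta < 1.
  by rewrite expR_gt0 /= expR_lt1 oppr_lt0 divr_gt0 // mulr_gt0.
have [C [C_gt0 HC]] := sup_L2 HM HL HhL HOmega Hvol th.
exists (a / 2), (C0 * C), k1; split; [by rewrite divr_gt0|by rewrite mulr_ge0 // ltW|].
apply: filterS near_p => q Hq k kk.
have [Is on _] := Hs k.
set E := \sum_(i < b k) norm2 hL k (s k i) q.
set w := \sum_(i < b k) sqmod (s k i q).
have Hhol i := isotypical_holo (Is i).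
pose sq x := \sum_i (s k i q)^* * s k i x.
have sq_iso : isotypical AM fr mu j rho k sq := isotypical_sum (fun i => (s k i q)^*) Is.
have sq_hol := isotypical_holo sq_iso.
have Isq : (\int[vol]_x (norm2 hL k sq x)%:E = w%:E)%E.
  rewrite (integral_norm2_comb HA HL HhL _ Hhol on); congr (_%:E).
  by apply: eq_bigr => i _; rewrite -!sqr_cabs cabs_conj.
have thk : 0 < theta ^+ (m * k) by rewrite exprn_gt0 // expR_gt0.
have sup x : norm2 hL k sq x <= C * w / theta ^+ (m * k).
  have := HC k sq sq_hol x; rewrite Isq -EFinM lee_fin => h.
  by rewrite ler_pdivlMr.
have := Hq k kk sq _ sq_iso sup.
have -> : norm2 hL k sq q = w * E.
  rewrite /norm2 /sq (eq_bigr (fun i => ((sqmod (s k i q))%:C)%C)); last first.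
    by move=> i _; rewrite mulrC conj_sqmod.
  rewrite -rmorph_sum /= /sqmod reCR imCR expr0n addr0 -/(sqmod _) expr2 -mulrA; congr (_ * _).
  by rewrite /E mulr_suml.
have E0 : 0 <= E by apply: sumr_ge0 => i _; exact: (norm2_ge0 HhL).
have [w0|w0] := leP w 0.
  move=> _; have wi i : sqmod (s k i q) = 0.
    apply/eqP; rewrite eq_le sqmod_ge0 andbT; apply: le_trans w0.
    by rewrite /w (bigD1 i) //= lerDl sumr_ge0 // => ? _; exact: sqmod_ge0.
  have -> : E = 0 by apply: big1 => i _; rewrite /norm2 wi mul0r.
  by rewrite mulr_ge0 ?expR_ge0 // mulr_ge0 // ltW.
have -> : C0 * (C * w / theta ^+ (m * k)) * expR (- (a * k%:R)) =
   w * (C0 * C * ((theta ^+ (m * k))^-1 * expR (- (a * k%:R)))) by ring.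
rewrite ler_pM2l // => h; apply: le_trans h _.
rewrite ler_wpM2l ?mulr_ge0 // ?(ltW C_gt0) //.
rewrite /theta -expRM_natl -expRN -expRD le_eqVlt; apply/orP; left; apply/eqP; congr expR.
rewrite natrM; field.
by rewrite gt_eqF.
Qed.

Lemma exp_decay_poly (a : R) (N k : nat) : 0 < a -> (0 < N)%N -> (0 < k)%N ->
  expR (- (a * k%:R)) <= (N%:R / a) ^+ N * k%:R ^- N.
Proof.
move=> a0 N0 k0.
have N0' : 0 < N%:R :> R by rewrite ltr0n.
have k0' : 0 < k%:R :> R by rewrite ltr0n.
set x := a * k%:R / N%:R.
have x0 : 0 < x by rewrite divr_gt0 // mulr_gt0.
have -> : - (a * k%:R) = - (N%:R * x) by rewrite /x mulrCA divff ?mulr1 // gt_eqF.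
rewrite expRN expRM_natl.
have -> : (N%:R / a) ^+ N * k%:R ^- N = (x ^+ N)^-1.
  rewrite -exprVn -exprMn -exprVn; congr (_ ^+ _); rewrite /x invfM invfM invrK; ring.
rewrite lef_pV2 ?posrE ?exprn_gt0 ?expR_gt0 //.
apply: lerXn2r; rewrite ?nnegrE ?expR_ge0 ?(ltW x0) //.
by apply: le_trans (expR_ge1Dx x); rewrite lerDr.
Qed.

Lemma bergman_decay_compact (K : set M) (N : nat) : compact K ->
  (forall p, K p -> Phi p != 0) -> (0 < N)%N ->
  exists C : R, \forall k \near \oo, forall p, K p ->
    \sum_(i < b k) norm2 hL k (s k i) p <= C * k%:R ^- N.
Proof.
move=> cK K0 N0.
pose P q C := forall k, C <= k%:R -> \sum_(i < b k) norm2 hL k (s k i) q <= C * k%:R ^- N.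
have [p Kp|y C C' CC' HP k Ck|C HC] := @compact_uniform R M K P cK.
- have [a [C [k1 [a0 C0 near_p]]]] := bergman_decay (K0 p Kp).
  exists (Num.max (Num.max k1%:R 1) (C * (N%:R / a) ^+ N)); apply: filterS near_p => q Hq k.
  rewrite !ge_max => /andP[/andP[k1k k1'] _].
  rewrite ler_nat in k1k; rewrite ler1n in k1'.
  apply: le_trans (Hq k k1k) _.
  apply: (@le_trans _ _ (C * ((N%:R / a) ^+ N * k%:R ^- N))).
    by rewrite ler_wpM2l // exp_decay_poly.
  rewrite mulrA ler_wpM2r ?invr_ge0 ?exprn_ge0 //.
  by rewrite le_max lexx orbT.
- apply: le_trans (HP k (le_trans CC' Ck)) _.
  by rewrite ler_wpM2r // invr_ge0 exprn_ge0.
exists C; near=> k => p Kp; apply: HC => //.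
near: k; exact: nbhs_infty_ger.
Unshelve. all: end_near. Qed.

End Bergman.

Theorem proposition1 (R : realType) (n : nat)
  (* the projective manifold M and the Hermitian ample line bundle L *)
  (M : ptopologicalType) (AM : set (chart M 'rV[Cx R]_n))
  (fr : frame_family R M) (hL : M -> R)
  (HM : projective_manifold AM) (HMconn : connected [set: M])
  (HL : line_bundle AM fr) (Hample : ample AM fr)
  (HhL : hermitian_metric AM fr hL) (HOmega : kahler_curvature AM fr hL)
  (vol : {measure set (g_sigma_algebraType (@open M)) -> \bar R})
  (Hvol : volume_measure AM fr hL vol)
  (* the compact connected Lie group G; Lie algebra in the chart c1 at 1 *)
  (d : nat) (G : topGroupType) (AG : set (chart G 'rV[R]_d))
  (HG : lie_group AG) (HGcomp : compact [set: G]) (HGconn : connected [set: G])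
  (c1 : chart G 'rV[R]_d) (Hc1 : AG c1) (Hc11 : cdom c1 1%g)
  (* the Hamiltonian action and its linearization *)
  (mu : G -> M -> M) (Hmu : holo_action AG AM mu)
  (j : G -> M -> Cx R) (Hj : holo_lift AG AM fr mu j)
  (Hinv : metric_invariant mu j hL)
  (Phi : M -> 'rV[R]_d) (HPhi : moment_map c1 AM fr hL mu Phi)
  (HPhij : moment_of_lift c1 AM fr hL mu j Phi)
  (* the complexification and the extended actions *)
  (dc : nat) (Gc : topGroupType) (AGc : set (chart Gc 'rV[Cx R]_dc))
  (iota : G -> Gc) (HGc : is_complexification AG AGc iota)
  (muc : Gc -> M -> M) (Hmuc : complex_action AGc AM muc)
  (Hmuext : forall g p, muc (iota g) p = mu g p)
  (jc : Gc -> M -> Cx R) (Hjc : complex_lift AGc AM fr muc jc)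
  (Hjext : forall g p, jc (iota g) p = j g p)
  (* Cartan subalgebra, basis of roots, dominant weight omega, V_omega *)
  (h : {vspace 'rV[R]_d}) (Hh : cartan_subalgebra c1 h)
  (Delta : seq (dual h)) (HDelta : root_basis c1 Delta)
  (omega : dual h) (Homega : char_lattice c1 omega)
  (Hdom : weyl_chamber c1 Delta omega)
  (r : nat) (rho : G -> 'M[Cx R]_r) (Hrho : irreducible_rep rho)
  (Hrhow : highest_weight c1 Delta rho omega)
  (* orthonormal bases of the isotypical components *)
  (b : nat -> nat) (s : forall k : nat, 'I_(b k) -> M -> Cx R)
  (Hs : forall k, orthonormal_basis hL vol k (isotypical AM fr mu j rho k) (s k))
  (Hreg : zero_regular AM Phi) (Hfree : free_on mu (zero_level Phi)) :
  (forall p : M, ~ zero_level Phi p ->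
     forall N : nat, (0 < N)%N ->
     exists C : R, \forall k \near \oo,
       \sum_(i < b k) norm2 hL k (s k i) p <= C * k%:R ^- N)
  /\
  (forall K : set M, compact K ->
     K `<=` ~` (zero_level Phi `|` unstable_set muc Phi) ->
     forall N : nat, (0 < N)%N ->
     exists C : R, \forall k \near \oo, forall p, K p ->
       \sum_(i < b k) norm2 hL k (s k i) p <= C * k%:R ^- N).

Proof.
have [sPhi _ _] := HPhi.
have key (K : set M) (N : nat) := @bergman_decay_compact R n M AM fr hL HM HL HhL HOmega vol Hvol d G AG HG
  c1 Hc1 Hc11 mu Hmu j Hj Hinv Phi HPhij sPhi r rho Hrho b s Hs K N.
split=> [p p0 N N0|K cK K0 N N0].
  have pK q : [set p] q -> Phi q != 0 by move=> ->; exact/eqP.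
  have [C HC] := key [set p] N (@compact_set1 _ p) pK N0.
  by exists C; apply: filterS HC => k; apply.
by apply: key => // p Kp; apply/eqP => Phip; apply: (K0 p Kp); left.
Qed.
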